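(* Let $k$ be a non-Archimedean field, let $X$ be a $k$-analytic space, and let $(u_j)_{j\in J}$ be a net of classically psh functions on $X$ which converges pointwise to an upper semicontinuous function $u\colon X\to\mathbb{R}\cup\{-\infty\}$. Then $u$ is classically psh.
   Context: **Analytic geometry.** A non-Archimedean field is a field complete with respect to a non-Archimedean absolute value, which may be trivial. An analytic extension field $k'/k$ is a non-Archimedean field $k'$ with an isometric embedding $k\hookrightarrow k'$. $k$-analytic spaces are those of Berkovich (Publ. Math. IHES 78, 1993); ''strictly'' means that strictly $k$-affinoid charts can be used. $X_{k'}$ is the base change of $X$ to $k'$ and $\pi_{k'/k}\colon X_{k'}\to X$ the structure map. $\partial X$ is Berkovich's boundary of $X$ relative to $\mathcal{M}(k)$; $X$ is boundaryless if $\partial X=\emptyset$. A $k$-analytic curve is a separated $k$-analytic space of pure dimension $1$. A space is rig-smooth if it is quasi-smooth in the sense of Ducros, and smooth if it is rig-smooth and boundaryless. **Thuillier's harmonic and subharmonic functions** ($k$ non-trivially valued). Let $U$ be a strictly $k$-affinoid rig-smooth curve. A continuous function $h\colon U\to\mathbb{R}$ is harmonic if there are a finite separable extension $k'/k$ and a semistable formal model of $U_{k'}$ over the valuation ring of $k'$ (special fiber reduced with at most ordinary double points, all double points and their branches being rational over the residue field), with skeleton $S$ and retraction $\tau\colon U_{k'}\to S$, such that $h\circ\pi_{k'/k}=g\circ\tau$, where $g\colon S\to\mathbb{R}$ is continuous, affine on each edge, and has sum of outgoing slopes equal to $0$ at every vertex of $S$ not in $\partial U_{k'}$. Here $S$ is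 the metric graph whose vertices are the points of $U_{k'}$ reducing to generic points of the special fiber (they include $\partial U_{k'}$) and whose open edges are the skeletons of the open annuli that are the preimages of the double points under reduction, the annulus $\{|\varpi|<|T|<1\}$ giving an edge of length $-\log|\varpi|$. A function $u\colon Y\to\mathbb{R}\cup\{-\infty\}$ on a smooth strictly $k$-analytic curve $Y$ is subharmonic in Thuillier's sense if it is upper semicontinuous, not identically $-\infty$ on any connected component, and for every strictly $k$-affinoid domain $U\subset Y$ and every harmonic $h\colon U\to\mathbb{R}$ with $u\le h$ on $\partial U$, one has $u\le h$ on $U$. **Subharmonic functions.** Let $X$ be a $k$-analytic curve ($k$ possibly trivially valued). An upper semicontinuous $u\colon X\to\mathbb{R}\cup\{-\infty\}$ is subharmonic if for every non-trivially valued analytic extension field $k'/k$, every smooth, connected, strictly $k'$-analytic curve $Y$ and every morphism $Y\to X_{k'}$, the composition $Y\to X_{k'}\xrightarrow{\pi_{k'/k}}X\xrightarrow{u}\mathbb{R}\cup\{-\infty\}$ is either subharmonic in Thuillier's sense or identically $-\infty$. **Classically psh functions.** Let $X$ be a $k$-analytic space. An upper semicontinuous $u\colon X\to\mathbb{R}\cup\{-\infty\}$ is classically psh (classically plurisubharmonic) if for every analytic extension field $k'/k$, every $k'$-analytic curve $Y$ and every morphism $f\colon Y\to X_{k'}$, the function $u\circ\pi_{k'/k}\circ f$ is subharmonic on $Y$. *)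

(* Defs.v *)
From HB Require Import structures.
From mathcomp Require Import all_boot all_order all_algebra.
From mathcomp Require Import separable.
From mathcomp Require Import all_classical all_reals all_analysis.

Set Implicit Arguments.
Unset Strict Implicit.
Unset Printing Implicit Defensive.

Import Order.TTheory GRing.Theory Num.Theory.
Import numFieldNormedType.Exports.

Local Open Scope classical_set_scope.
Local Open Scope ring_scope.

Definition norm_complete (R : realType) (V : zmodType) (nrm : V -> R) :=
  forall s : nat -> V,
    (forall e, 0 < e -> exists N, forall m n,
       (N <= m)%N -> (N <= n)%N -> nrm (s m - s n) < e) ->
    exists l, forall e, 0 < e -> exists N, forall n, (N <= n)%N -> nrm (s n - l) < e.

Record nafield (R : realType) := NAField {
  na_field :> fieldType;
  nabs : na_field -> R;
  nabs_ge0 : forall x, 0 <= nabs x;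
  nabs_eq0 : forall x, nabs x = 0 <-> x = 0;
  nabsM : forall x y, nabs (x * y) = nabs x * nabs y;
  nabsD : forall x y, nabs (x + y) <= Num.max (nabs x) (nabs y);
  nabs_complete : norm_complete nabs }.

Definition nontrivially_valued (R : realType) (k : nafield R) :=
  exists x : k, x != 0 /\ nabs x != 1.

Record aext (R : realType) (k K : nafield R) := AExt {
  aext_map :> {rmorphism k -> K};
  aext_isom : forall x, nabs (aext_map x) = nabs x }.

Definition aext_id (R : realType) (k : nafield R) : aext k k :=
  @AExt R k k idfun (fun=> erefl).

(* Commutative; the zero ring, the algebra of the empty space, is included.  *)
Record banalg (R : realType) (k : nafield R) := BanAlg {
  ba_ring :> comPzRingType;
  ba_str : {rmorphism k -> ba_ring};
  bnorm : ba_ring -> R;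
  bnorm_ge0 : forall x, 0 <= bnorm x;
  bnorm_eq0 : forall x, bnorm x = 0 <-> x = 0;
  bnormM : forall x y, bnorm (x * y) <= bnorm x * bnorm y;
  bnorm1 : bnorm 1 <= 1;
  bnormZ : forall c x, bnorm (ba_str c * x) = nabs c * bnorm x;
  bnormD : forall x y, bnorm (x + y) <= Num.max (bnorm x) (bnorm y);
  bnorm_complete : norm_complete bnorm }.

Section Affinoid.
Context {R : realType}.

(* Bounded homomorphisms of Banach algebras over the extension [io].         *)
Definition bhom (k K : nafield R) (io : aext k K) (A : banalg k) (B : banalg K)
    (f : A -> B) :=
  [/\ forall x y, f (x + y) = f x + f y,
      forall x y, f (x * y) = f x * f y,
      f 1 = 1,
      forall c, f (ba_str A c) = ba_str B (io c) &
      exists C, forall x, bnorm (f x) <= C * bnorm x].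

Definition khom (k : nafield R) (A B : banalg k) (f : A -> B) :=
  bhom (aext_id k) f.

Definition adm_epi (k : nafield R) (A B : banalg k) (f : A -> B) :=
  khom f /\ exists C, forall b, exists2 a, f a = b & bnorm a <= C * bnorm b.

Definition mindex n := {ffun 'I_n -> nat}.

Definition wt n (r : 'I_n -> R) (nu : mindex n) : R := \prod_i r i ^+ nu i.

Definition mon (A : comPzRingType) n (t : 'I_n -> A) (nu : mindex n) : A :=
  \prod_i t i ^+ nu i.

(* [a] is the coefficient family of an element of k{r^-1 T}.                 *)
Definition restricted (k : nafield R) n (r : 'I_n -> R) (a : mindex n -> k) :=
  forall e, 0 < e -> exists N, forall nu : mindex n,
    (N <= \sum_i nu i)%N -> nabs (a nu) * wt r nu < e.

Definition partial_sum (k : nafield R) (A : banalg k) n (t : 'I_n -> A)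
    (a : mindex n -> k) (N : nat) : A :=
  \sum_(nu : {ffun 'I_n -> 'I_N})
     ba_str A (a [ffun i => nat_of_ord (nu i)]) * mon t [ffun i => nat_of_ord (nu i)].

Definition sums_to (k : nafield R) (A : banalg k) n (t : 'I_n -> A)
    (a : mindex n -> k) (f : A) :=
  forall e, 0 < e -> exists N0, forall N, (N0 <= N)%N ->
    bnorm (partial_sum t a N - f) < e.

(* T_i |-> t_i defines an admissible epimorphism k{r^-1 T} -> A: the first   *)
(* bound makes the evaluation map well defined and bounded, the second one   *)
(* makes it surjective and admissible.                                       *)
Definition is_presentation (k : nafield R) (A : banalg k) n (r : 'I_n -> R)
    (t : 'I_n -> A) :=
  [/\ forall i, 0 < r i,
      exists C, forall nu, bnorm (mon t nu) <= C * wt r nu &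
      exists C, forall f, exists a : mindex n -> k,
        [/\ restricted r a, sums_to t a f &
            forall nu, nabs (a nu) * wt r nu <= C * bnorm f]].

Definition affinoid (k : nafield R) (A : banalg k) :=
  exists n (r : 'I_n -> R) (t : 'I_n -> A), is_presentation r t.

Definition strictly_affinoid (k : nafield R) (A : banalg k) :=
  exists n (t : 'I_n -> A), is_presentation (fun=> 1) t.

(* A = k{r^-1 T}, with coordinates t.                                        *)
Definition is_tate (k : nafield R) (A : banalg k) n (r : 'I_n -> R)
    (t : 'I_n -> A) :=
  is_presentation r t /\
  forall a : mindex n -> k, restricted r a -> sums_to t a 0 -> forall nu, a nu = 0.

(* A' is the completed tensor product of A with K over k.                    *)
Definition is_bc_alg (k K : nafield R) (io : aext k K) (A : banalg k)
    (A' : banalg K) (j : A -> A') :=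
  bhom io j /\
  forall (B : banalg K) (f : A -> B), bhom io f ->
    exists! g : A' -> B, khom g /\ forall a, g (j a) = f a.

(* D is the completed tensor product of A and B over k.                      *)
Definition is_ctensor (k : nafield R) (A B D : banalg k) (i1 : A -> D)
    (i2 : B -> D) :=
  [/\ khom i1, khom i2 &
      forall (E : banalg k) (f : A -> E) (g : B -> E), khom f -> khom g ->
        exists! h : D -> E,
          [/\ khom h, forall a, h (i1 a) = f a & forall b, h (i2 b) = g b]].

(* The points of M(A): bounded multiplicative seminorms.                     *)
Definition is_pt (k : nafield R) (A : banalg k) (x : A -> R) :=
  [/\ x 1 = 1,
      forall a b, x (a * b) = x a * x b,
      forall a b, x (a + b) <= Num.max (x a) (x b) &
      forall a, 0 <= x a <= bnorm a].

(* M(A) = [set x | is_pt x] lies in this space, with the induced topology.   *)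
Definition spec_top (k : nafield R) (A : banalg k) : topologicalType :=
  {ptws A -> R}.

(* (V, C) is an affinoid domain of M(A); the test algebras are affinoid over *)
(* arbitrary analytic extensions of k.                                       *)
Definition is_affdom (k : nafield R) (A : banalg k) (V : set (A -> R))
    (C : banalg k) (phi : A -> C) :=
  [/\ affinoid C, khom phi,
      forall y : C -> R, is_pt y -> V (y \o phi) &
      forall (K : nafield R) (io : aext k K) (B : banalg K) (f : A -> B),
        affinoid B -> bhom io f ->
        (forall y : B -> R, is_pt y -> V (y \o f)) ->
        exists! g : C -> B, bhom io g /\ forall a, g (phi a) = f a].

Definition is_interior (k : nafield R) (A : banalg k) (x : A -> R) :=
  exists n (r : 'I_n -> R) (t : 'I_n -> A),
    is_presentation r t /\ forall i, x (t i) < r i.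

Definition is_boundary (k : nafield R) (A : banalg k) (x : A -> R) :=
  is_pt x /\ ~ is_interior x.

Definition ideal_in (A : comPzRingType) (S P : set A) :=
  [/\ P `<=` S, P 0, forall a b, P a -> P b -> P (a + b) &
      forall a b, S a -> P b -> P (a * b)].

Definition prime_in (A : comPzRingType) (S P : set A) :=
  [/\ ideal_in S P, ~ P 1 &
      forall a b, S a -> S b -> P (a * b) -> P a \/ P b].

Definition maximal_in (A : comPzRingType) (S P : set A) :=
  [/\ ideal_in S P, ~ P 1 &
      forall Q, ideal_in S Q -> ~ Q 1 -> P `<=` Q -> Q = P].

Definition prime_chain (A : comPzRingType) (n : nat) :=
  exists p : nat -> set A,
    (forall i, (i <= n)%N -> prime_in setT (p i)) /\
    (forall i, (i < n)%N -> p i `<` p i.+1).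

Definition krull_dim_is (A : comPzRingType) (n : nat) :=
  prime_chain A n /\ ~ prime_chain A n.+1.

(* dim M(A): the Krull dimension after a base change making A strict.        *)
Definition affdim_is (k : nafield R) (A : banalg k) (n : nat) :=
  exists (K : nafield R) (io : aext k K) (A' : banalg K) (j : A -> A'),
    [/\ nontrivially_valued K, is_bc_alg io j, strictly_affinoid A' &
        krull_dim_is A' n].

End Affinoid.

Section Analytic.
Context {R : realType}.

Definition quasinet (T : topologicalType) (D : set T) (tau : set (set T)) :=
  forall x, D x -> exists n (V : 'I_n -> set T),
    (forall i, tau (V i) /\ V i x) /\
    \forall y \near x, D y -> exists i, V i y.

Definition is_net (T : topologicalType) (D : set T) (tau : set (set T)) :=
  quasinet D tau /\
  forall U V, tau U -> tau V ->
    quasinet (U `&` V) [set W | tau W /\ W `<=` U `&` V].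

(* [f] restricts to a homeomorphism from D onto its image.                   *)
Definition top_embedding (T T' : topologicalType) (D : set T) (f : T -> T') :=
  (forall p q, D p -> D q -> f p = f q -> p = q) /\
  forall p, D p -> forall P : set T,
    within D (nbhs p) P <->
    exists2 Q, nbhs (f p) Q & forall q, D q -> Q (f q) -> P q.

(* An affinoid algebra with an identification of a subset of T with its      *)
(* spectrum: [ch_ev p a] is |a(p)|.                                          *)
Record chart (k : nafield R) (T : Type) := Chart {
  ch_alg : banalg k;
  ch_ev : T -> ch_alg -> R }.
#[global] Arguments ch_ev {k T} _ _ _.

Definition chart_ok (k : nafield R) (T : topologicalType) (D : set T)
    (c : chart k T) :=
  [/\ affinoid (ch_alg c),
      top_embedding D (ch_ev c : T -> spec_top (ch_alg c)) &
      ch_ev c @` D = [set x | is_pt x]].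

(* The data of an affinoid atlas. [at_ch V] matters only for V in the net    *)
(* and [at_res V W] only for V, W in the net with W included in V.           *)
Record preatlas (k : nafield R) (T : Type) := PreAtlas {
  at_net : set (set T);
  at_ch : set T -> chart k T;
  at_res : forall V W, ch_alg (at_ch V) -> ch_alg (at_ch W) }.

Definition at_alg (k : nafield R) (T : Type) (s : preatlas k T) (V : set T) :=
  ch_alg (at_ch s V).
Definition at_ev (k : nafield R) (T : Type) (s : preatlas k T) (V : set T)
  (p : T) : at_alg s V -> R := ch_ev (at_ch s V) p.
Definition at_restr (k : nafield R) (T : Type) (s : preatlas k T) (V W : set T) :
  at_alg s V -> at_alg s W := @at_res k T s V W.
#[global] Arguments at_ev {k T} s V p _.
#[global] Arguments at_restr {k T} s V W _.

Definition is_atlas (k : nafield R) (T : topologicalType) (D : set T)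
    (s : preatlas k T) :=
  [/\ is_net D (at_net s),
      forall V, at_net s V -> V `<=` D,
      forall V, at_net s V -> chart_ok V (at_ch s V) &
      forall V W, at_net s V -> at_net s W -> W `<=` V ->
        is_affdom [set at_ev s V p | p in W] (at_restr s V W) /\
        forall p, W p -> forall a, at_ev s W p (at_restr s V W a) = at_ev s V p a].

Definition locally_hausdorff (T : topologicalType) :=
  forall x : T, exists O : set T,
    [/\ open O, O x & forall y z, O y -> O z -> y <> z ->
      exists A B : set T, [/\ open A, open B, A y, B z & A `&` B = set0]].

Record anspace (k : nafield R) := AnSpace {
  an_top :> topologicalType;
  an_atlas : preatlas k an_top;
  an_lhaus : locally_hausdorff an_top;
  an_atlasP : is_atlas setT an_atlas }.

(* The space M(A), as the one-chart preatlas on D.                           *)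
Definition single (k : nafield R) (T : Type) (D : set T) (c : chart k T) :
  preatlas k T := @PreAtlas k T [set D] (fun=> c) (fun _ _ a => a).

Definition spec_chart (k : nafield R) (A : banalg k) : chart k (spec_top A) :=
  @Chart k (spec_top A) A (fun x => x).

Definition spec_atlas (k : nafield R) (A : banalg k) : preatlas k (spec_top A) :=
  single [set x : A -> R | is_pt x] (spec_chart A).

(* The algebra part of a strong morphism with underlying map [f].            *)
Definition strong_data (k : nafield R) (T T' : topologicalType) (f : T -> T')
    (s : preatlas k T) (s' : preatlas k T')
    (phi : forall V V', at_alg s' V' -> at_alg s V) :=
  let adm V V' := [/\ at_net s V, at_net s' V' & f @` V `<=` V'] in
  [/\ forall V, at_net s V -> exists V', adm V V',
      forall V V', adm V V' ->
        khom (phi V V') /\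
        forall p, V p -> forall a, at_ev s V p (phi V V' a) = at_ev s' V' (f p) a &
      forall V V' W W', adm V V' -> adm W W' -> W `<=` V -> W' `<=` V' ->
        forall a, at_restr s V W (phi V V' a) = phi W W' (at_restr s' V' W' a)].

(* [f] is a strong morphism, a homeomorphism onto its image, and identifies  *)
(* charts of [s] with affinoid domains in charts of [s'].  For D the whole   *)
(* space and [f] the identity this is a quasi-isomorphism; in general it     *)
(* makes f(D) an analytic domain isomorphic to (D, s).                       *)
Definition is_immersion (k : nafield R) (T T' : topologicalType) (D : set T)
    (f : T -> T') (s : preatlas k T) (s' : preatlas k T') :=
  top_embedding D f /\
  exists2 phi : forall V V', at_alg s' V' -> at_alg s V,
    strong_data f phi &
    forall V V', at_net s V -> at_net s' V' -> f @` V `<=` V' ->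
      is_affdom [set at_ev s' V' (f p) | p in V] (phi V V').

(* The underlying maps of morphisms of k-analytic spaces, i.e. of fractions  *)
(* Y <- (Y, s) -> X of a quasi-isomorphism and a strong morphism.            *)
Definition is_morphism (k : nafield R) (Y X : anspace k) (f : Y -> X) :=
  exists s : preatlas k Y,
    [/\ is_atlas setT s,
        is_immersion setT idfun s (an_atlas Y),
        continuous f &
        exists phi : forall V V', at_alg (an_atlas X) V' -> at_alg s V,
          strong_data f phi].

(* (D, c) is an affinoid domain of X: an analytic domain isomorphic to M(A). *)
Definition an_affdom (k : nafield R) (X : anspace k) (D : set X) (c : chart k X) :=
  chart_ok D c /\
  exists s : preatlas k X,
    [/\ is_atlas D s,
        is_immersion D idfun s (single D c) &
        is_immersion D idfun s (an_atlas X)].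

(* X' is the base change of X: its charts are the preimages of the charts of *)
(* X, with the completed tensor products as algebras.                        *)
Definition is_base_change (k K : nafield R) (io : aext k K) (X : anspace k)
    (X' : anspace K) (pi : X' -> X) :=
  let s := an_atlas X in let s' := an_atlas X' in
  [/\ continuous pi,
      at_net s' = [set pi @^-1` V | V in at_net s] &
      exists j : forall V, at_alg s V -> at_alg s' (pi @^-1` V),
        (forall V, at_net s V ->
           is_bc_alg io (j V) /\
           forall p, V (pi p) -> forall a,
             at_ev s' (pi @^-1` V) p (j V a) = at_ev s V (pi p) a) /\
        (forall V W, at_net s V -> at_net s W -> W `<=` V -> forall a,
           at_restr s' (pi @^-1` V) (pi @^-1` W) (j V a) =
           j W (at_restr s V W a))].

Definition strictly_analytic (k : nafield R) (X : anspace k) :=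
  exists s r : preatlas k X,
    [/\ is_atlas setT s /\ is_atlas setT r,
        forall V, at_net s V -> strictly_affinoid (at_alg s V),
        is_immersion setT idfun r s &
        is_immersion setT idfun r (an_atlas X)].

(* The diagonal of X is a closed immersion.  The charts of X x X are the     *)
(* V x W, with algebras A_V (x) A_W, and the preimage of V x W under the     *)
(* diagonal is the intersection of V and W with the structure induced by X.  *)
Definition an_separated (k : nafield R) (X : anspace k) :=
  let s := an_atlas X in
  forall V W, at_net s V -> at_net s W ->
  exists (c : chart k X) (phi : at_alg s V -> ch_alg c) (psi : at_alg s W -> ch_alg c),
  [/\ chart_ok (V `&` W) c,
      is_affdom [set at_ev s V p | p in V `&` W] phi /\
      is_affdom [set at_ev s W p | p in V `&` W] psi,
      forall p, V p -> W p ->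
        (forall a, ch_ev c p (phi a) = at_ev s V p a) /\
        (forall b, ch_ev c p (psi b) = at_ev s W p b),
      forall U, at_net s U -> U `<=` V `&` W ->
        exists chi : ch_alg c -> at_alg s U,
          [/\ khom chi, forall a, chi (phi a) = at_restr s V U a &
              forall b, chi (psi b) = at_restr s W U b] &
      exists (D : banalg k) (i1 : at_alg s V -> D) (i2 : at_alg s W -> D)
             (theta : D -> ch_alg c),
        [/\ is_ctensor i1 i2, forall a, theta (i1 a) = phi a,
            forall b, theta (i2 b) = psi b & adm_epi theta]].

(* The dimension at x is the minimal dimension of an affinoid domain at x.   *)
Definition pure_dim1 (k : nafield R) (X : anspace k) :=
  forall x : X,
    (exists (D : set X) (c : chart k X),
       [/\ an_affdom D c, D x & affdim_is (ch_alg c) 1]) /\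
    (forall (D : set X) (c : chart k X) n,
       an_affdom D c -> D x -> affdim_is (ch_alg c) n -> (1 <= n)%N).

Definition is_curve (k : nafield R) (X : anspace k) := an_separated X /\ pure_dim1 X.

Definition boundaryless (k : nafield R) (X : anspace k) :=
  forall x : X, exists (D : set X) (c : chart k X),
    [/\ an_affdom D c, nbhs x D & is_interior (ch_ev c x)].

Definition bounded_derivation (k : nafield R) (C : banalg k) (d : C -> C) :=
  [/\ forall a b, d (a + b) = d a + d b,
      forall a b, d (a * b) = a * d b + b * d a,
      forall c, d (ba_str C c) = 0 &
      exists M, forall a, bnorm (d a) <= M * bnorm a].

(* Quasi-smoothness at x, by a Jacobian presentation: an affinoid domain at  *)
(* x is a closed subspace, defined by g, of an affinoid domain M(C) of       *)
(* affine n-space, and the Jacobian matrix of g has rank m at x.  Affinoid   *)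
(* domains of affine n-space are those of the polydiscs M(k{r^-1 T}); [d i]  *)
(* is the partial derivative along the i-th coordinate on M(C).              *)
Definition quasi_smooth_at (k : nafield R) (X : anspace k) (x : X) :=
  exists (D : set X) (c : chart k X),
  [/\ an_affdom D c, D x &
  exists n (r : 'I_n -> R) (P : banalg k) (t : 'I_n -> P)
         (W : set (P -> R)) (C : banalg k) (theta : P -> C)
         (q : C -> ch_alg c) (d : 'I_n -> C -> C) m (g : 'I_m -> C),
  [/\ is_tate r t, is_affdom W theta,
      adm_epi q /\
      (forall a, q a = 0 <-> exists b : 'I_m -> C, a = \sum_i b i * g i),
      (forall i, bounded_derivation (d i)) /\
      (forall i j, d i (theta (t j)) = (i == j)%:R) &
      exists e : 'I_m -> 'I_n,
        ch_ev c x (q (\det (\matrix_(i, j) d (e j) (g i)))) != 0]].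

Definition rig_smooth (k : nafield R) (X : anspace k) :=
  forall x : X, quasi_smooth_at x.

Definition an_smooth (k : nafield R) (X : anspace k) := rig_smooth X /\ boundaryless X.

End Analytic.

Section Models.
Context {R : realType}.

(* The image of K0{T}, K0 the valuation ring, under an admissible k{T} -> A. *)
Definition is_model_ring (k : nafield R) (A : banalg k) (S : set A) :=
  exists n (t : 'I_n -> A), is_presentation (fun=> 1) t /\
    S = [set f | exists a : mindex n -> k,
           [/\ restricted (fun=> 1) a, forall nu, nabs (a nu) <= 1 & sums_to t a f]].

(* The image in C of the completed localization S{f^-1}: the closure of the  *)
(* image of S[f^-1].                                                         *)
Definition loc_ring (k : nafield R) (A C : banalg k) (theta : A -> C)
    (S : set A) (f : A) : set C :=
  [set c | forall e, 0 < e -> exists (a : A) (n : nat) (w : C),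
     [/\ S a, w * theta f = 1 & bnorm (c - theta a * w ^+ n) < e]].

(* The ideal mS, m the maximal ideal of the valuation ring; the special      *)
(* fiber of Spf S is Spec (S / mS).                                          *)
Definition special_ideal (k : nafield R) (A : banalg k) (S : set A) : set A :=
  [set a | exists c b, [/\ nabs c < 1, S b & a = ba_str A c * b]].

Definition sp_reduced (k : nafield R) (A : banalg k) (S : set A) :=
  forall a n, S a -> special_ideal S (a ^+ n) -> special_ideal S a.

(* Points of the special fiber are represented by prime ideals of S.         *)
Definition sp_point (k : nafield R) (A : banalg k) (S P : set A) :=
  prime_in S P /\ special_ideal S `<=` P.

Definition sp_generic (k : nafield R) (A : banalg k) (S P : set A) :=
  sp_point S P /\ forall Q, sp_point S Q -> Q `<=` P -> Q = P.

Definition sp_closed (k : nafield R) (A : banalg k) (S P : set A) :=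
  maximal_in S P /\ special_ideal S `<=` P.

Definition red (A : Type) (S : set A) (y : A -> R) : set A :=
  [set a | S a /\ y a < 1].

(* Derivations of the special fiber with values in the residue field S/P,    *)
(* lifted to maps S -> S.                                                    *)
Definition sp_der (k : nafield R) (A : banalg k) (S P : set A) (d : A -> A) :=
  [/\ forall a, S a -> S (d a),
      forall a b, S a -> S b -> P (d (a + b) - (d a + d b)),
      forall a b, S a -> S b -> P (d (a * b) - (a * d b + b * d a)) &
      forall c, nabs c <= 1 -> P (d (ba_str A c))].

(* Smoothness of the special fiber, of pure dimension 1, over the residue    *)
(* field: the fiber of the sheaf of differentials has dimension 1.           *)
Definition sp_smooth (k : nafield R) (A : banalg k) (S P : set A) :=
  exists2 d, sp_der S P d /\ (exists2 a, S a & ~ P (d a)) &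
    forall d', sp_der S P d' ->
      exists2 e, S e & forall a, S a -> P (d' a - e * d a).

(* The n-th power of the image of P in S / mS, as an ideal of S.             *)
Definition sp_power (k : nafield R) (A : banalg k) (S P : set A) (n : nat) : set A :=
  [set x | exists N (b : 'I_N -> A) (m : 'I_N -> 'I_n -> A) s,
     [/\ forall i, S (b i), forall i j, P (m i j), special_ideal S s &
         x = \sum_i b i * \prod_j m i j + s]].

(* Rational ordinary double points with rational branches: the completed     *)
(* local ring is isomorphic to K[[u, v]]/(uv), K being the residue field of  *)
(* k.  The isomorphism is given by its truncations modulo the powers of the  *)
(* maximal ideal; 1, u, ..., u^(n-1), v, ..., v^(n-1) is the monomial basis  *)
(* of K[u, v]/((uv) + (u, v)^n).                                             *)
Definition sp_double (k : nafield R) (A : banalg k) (S P : set A) :=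
  exists u v : nat -> A,
  let comb n (c c' : nat -> k) : A :=
    \sum_(i < n) ba_str A (c i) * u n ^+ i
    + \sum_(1 <= i < n) ba_str A (c' i) * v n ^+ i in
  [/\ forall n, P (u n) /\ P (v n),
      forall n, sp_power S P n (u n.+1 - u n) /\ sp_power S P n (v n.+1 - v n),
      forall n, sp_power S P n (u n * v n),
      forall n a, S a -> exists c c' : nat -> k,
        (forall i, nabs (c i) <= 1 /\ nabs (c' i) <= 1) /\
        sp_power S P n (a - comb n c c') &
      forall n (c c' : nat -> k),
        (forall i, nabs (c i) <= 1 /\ nabs (c' i) <= 1) ->
        sp_power S P n (comb n c c') ->
        forall i, (i < n)%N -> nabs (c i) < 1 /\ ((0 < i)%N -> nabs (c' i) < 1)].

(* A formal model of M(B), given by a finite affine open covering Spf S_i.   *)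
Record fmodel (k : nafield R) (B : banalg k) := FModel {
  fm_n : nat;
  fm_alg : 'I_fm_n -> banalg k;
  fm_map : forall i, B -> fm_alg i;
  fm_ring : forall i, set (fm_alg i) }.
#[global] Arguments fm_map {k B} _ i _.
#[global] Arguments fm_ring {k B} _ i _.

(* The points of the generic fiber of Spf S_i are handled as seminorms on    *)
(* its algebra: y corresponds to x.                                          *)
Definition fm_lift (k : nafield R) (B : banalg k) (M : fmodel B) (i : 'I_(fm_n M))
    (y : fm_alg i -> R) (x : B -> R) :=
  is_pt y /\ x = y \o fm_map M i.
#[global] Arguments fm_lift {k B} M i y x.

(* In the last clause, Spf S_i and Spf S_j are glued along principal opens   *)
(* {f != 0} and {g != 0} with the same generic fiber and the same ring.      *)
Definition is_fmodel (k : nafield R) (B : banalg k) (M : fmodel B) :=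
  [/\ forall i : 'I_(fm_n M), strictly_affinoid (fm_alg i) /\
        is_affdom [set x | exists y, fm_lift M i y x] (fm_map M i),
      forall i, is_model_ring (fm_ring M i),
      forall x : B -> R, is_pt x -> exists i y, fm_lift M i y x &
      forall i j x y z, fm_lift M i y x -> fm_lift M j z x ->
        exists (f : fm_alg i) (g : fm_alg j) (C : banalg k)
               (th1 : fm_alg i -> C) (th2 : fm_alg j -> C),
        [/\ (fm_ring M i f /\ fm_ring M j g) /\ (y f = 1 /\ z g = 1),
            [set x' | exists2 y', fm_lift M i y' x' & y' f = 1] =
            [set x' | exists2 z', fm_lift M j z' x' & z' g = 1],
            is_affdom [set y' | is_pt y' /\ y' f = 1] th1 /\
            is_affdom [set z' | is_pt z' /\ z' g = 1] th2,
            forall b, th1 (fm_map M i b) = th2 (fm_map M j b) &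
            loc_ring th1 (fm_ring M i) f = loc_ring th2 (fm_ring M j) g]].

Definition semistable (k : nafield R) (B : banalg k) (M : fmodel B) :=
  [/\ is_fmodel M,
      forall i, sp_reduced (fm_ring M i) &
      forall i (P : set (fm_alg i)), sp_point (fm_ring M i) P ->
        sp_generic (fm_ring M i) P \/
        (sp_closed (fm_ring M i) P /\
         (sp_smooth (fm_ring M i) P \/ sp_double (fm_ring M i) P))].

(* The preimage under reduction of a point of the special fiber.             *)
Definition fm_tube (k : nafield R) (B : banalg k) (M : fmodel B) (i : 'I_(fm_n M))
    (P : set (fm_alg i)) : set (B -> R) :=
  [set x | exists2 y, fm_lift M i y x & red (fm_ring M i) y = P].

Definition fm_node (k : nafield R) (B : banalg k) (M : fmodel B) (i : 'I_(fm_n M))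
    (P : set (fm_alg i)) :=
  sp_closed (fm_ring M i) P /\ sp_double (fm_ring M i) P.

Definition fm_vertex (k : nafield R) (B : banalg k) (M : fmodel B) : set (B -> R) :=
  [set x | exists i, exists2 y, fm_lift M i y x &
     sp_generic (fm_ring M i) (red (fm_ring M i) y)].

(* The reduction of s specializes to the reduction of x.                     *)
Definition fm_specializes (k : nafield R) (B : banalg k) (M : fmodel B)
    (s x : B -> R) :=
  exists i y z, [/\ fm_lift M i y s, fm_lift M i z x &
    red (fm_ring M i) y `<=` red (fm_ring M i) z].

(* The annulus |w| < |T| < 1 in the unit disc M(P), P = k{T}.                *)
Definition annulus (k : nafield R) (P : banalg k) (t : 'I_1 -> P) (w : k) :
    set (P -> R) :=
  [set z | is_pt z /\ nabs w < z (t ord0) < 1].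

(* The seminorm sum_n a_n T^n |-> max_n |a_n| r^n, where r = |T(z)|: these   *)
(* points form the skeleton of an annulus.                                   *)
Definition is_gauss (k : nafield R) (P : banalg k) (t : 'I_1 -> P) (z : P -> R) :=
  forall (a : mindex 1 -> k) f, restricted (fun=> 1) a -> sums_to t a f ->
    (forall nu, nabs (a nu) * wt (fun i => z (t i)) nu <= z f) /\
    (exists nu, z f = nabs (a nu) * wt (fun i => z (t i)) nu).

(* An open annulus structure on an open subset D of M(B).                    *)
Definition annulus_iso (k : nafield R) (B P : banalg k) (t : 'I_1 -> P) (w : k)
    (D : set (B -> R)) (f : (B -> R) -> (P -> R)) :=
  [/\ 0 < nabs w < 1,
      exists s : preatlas k (spec_top B),
        [/\ @is_atlas R k (spec_top B) D s,
            @is_immersion R k (spec_top B) (spec_top B) D idfun s (spec_atlas B) &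
            @is_immersion R k (spec_top B) (spec_top P) D f s (spec_atlas P)] &
      f @` D = annulus t w].

(* The skeleton of a semistable model.  Vertices and nodes are enumerated;   *)
(* edge [e] is given by a node and a coordinate on its preimage, which is    *)
(* identified with an annulus |w| < |T| < 1; [sk_v1 e] and [sk_v2 e] are the *)
(* ends |T| -> 1 and |T| -> |w| of the edge.                                 *)
Record skeleton (k : nafield R) (B : banalg k) (M : fmodel B) := Skeleton {
  sk_disc : banalg k;
  sk_T : 'I_1 -> sk_disc;
  sk_nv : nat;
  sk_vertex : 'I_sk_nv -> (B -> R);
  sk_ne : nat;
  sk_chart : 'I_sk_ne -> 'I_(fm_n M);
  sk_node : forall e, set (fm_alg (sk_chart e));
  sk_w : 'I_sk_ne -> k;
  sk_coord : 'I_sk_ne -> (B -> R) -> (sk_disc -> R);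
  sk_v1 : 'I_sk_ne -> 'I_sk_nv;
  sk_v2 : 'I_sk_ne -> 'I_sk_nv }.
#[global] Arguments sk_T {k B M} _ _.
#[global] Arguments sk_vertex {k B M} _ _ _.
#[global] Arguments sk_node {k B M} _ e _.
#[global] Arguments sk_coord {k B M} _ e _ _.
#[global] Arguments sk_w {k B M} _ e.

Section Skeleton.
Variables (k : nafield R) (B : banalg k) (M : fmodel B) (G : skeleton M).

Definition sk_tube (e : 'I_(sk_ne G)) : set (B -> R) := fm_tube (sk_node G e).

(* |T(x)| on the annulus of [e].                                             *)
Definition sk_radius (e : 'I_(sk_ne G)) (x : B -> R) : R :=
  sk_coord G e x (sk_T G ord0).

Definition sk_edge (e : 'I_(sk_ne G)) : set (B -> R) :=
  [set x | sk_tube e x /\ is_gauss (sk_T G) (sk_coord G e x)].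

Definition sk_set : set (B -> R) :=
  [set x | fm_vertex M x \/ exists e, sk_edge e x].

Definition is_skeleton :=
  [/\ is_tate (fun=> 1) (sk_T G),
      injective (sk_vertex G) /\ range (sk_vertex G) = fm_vertex M,
      (forall e, fm_node (sk_node G e)) /\
      (forall i (P : set (fm_alg i)), @fm_node k B M i P ->
         exists! e, sk_tube e = fm_tube P),
      forall e, annulus_iso (sk_T G) (sk_w G e) (sk_tube e) (sk_coord G e) &
      forall e,
        (forall Q, nbhs (sk_vertex G (sk_v1 e) : spec_top B) Q ->
           exists2 r, r < 1 & forall s, sk_edge e s -> r < sk_radius e s -> Q s) /\
        (forall Q, nbhs (sk_vertex G (sk_v2 e) : spec_top B) Q ->
           exists2 r, nabs (sk_w G e) < r &
             forall s, sk_edge e s -> sk_radius e s < r -> Q s)].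

(* The points reducing to a smooth closed point retract to the vertex of the *)
(* component containing it.                                                  *)
Definition is_retraction (tau : (B -> R) -> (B -> R)) :=
  [/\ forall x, fm_vertex M x -> tau x = x,
      forall e x, sk_tube e x ->
        sk_edge e (tau x) /\ sk_radius e (tau x) = sk_radius e x &
      forall x, is_pt x -> ~ fm_vertex M x -> (forall e, ~ sk_tube e x) ->
        fm_vertex M (tau x) /\ fm_specializes M (tau x) x].

(* Continuous on S, affine on each edge for the length parameter - log |T|,  *)
(* and with outgoing slopes of sum 0 at the vertices off the boundary.       *)
Definition pl_harmonic (g : (B -> R) -> R) :=
  {within (sk_set : set (spec_top B)), continuous (g : spec_top B -> R)} /\
  exists al be : 'I_(sk_ne G) -> R,
    (forall e s, sk_edge e s -> g s = al e + be e * - ln (sk_radius e s)) /\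
    (forall i, ~ is_boundary (sk_vertex G i) ->
       \sum_(e | sk_v1 e == i) be e + \sum_(e | sk_v2 e == i) - be e = 0).

End Skeleton.

Definition finite_separable (k K : nafield R) (io : aext k K) :=
  (exists n (b : 'I_n -> K), forall z, exists c : 'I_n -> k,
     z = \sum_i io (c i) * b i) /\
  (forall z : K, exists p : {poly k},
     separable_poly p /\ root (map_poly io p) z).

Definition th_harmonic (k : nafield R) (B : banalg k) (h : (B -> R) -> R) :=
  {within [set x : spec_top B | is_pt (x : B -> R)],
     continuous (h : spec_top B -> R)} /\
  exists (K : nafield R) (io : aext k K) (B' : banalg K) (j : B -> B')
         (M : fmodel B') (G : skeleton M) (tau : (B' -> R) -> (B' -> R))
         (g : (B' -> R) -> R),
    [/\ finite_separable io, is_bc_alg io j, semistable M,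
        is_skeleton G /\ is_retraction G tau &
        pl_harmonic G g /\ forall x, is_pt x -> h (x \o j) = g (tau x)].

End Models.

Section Psh.
Context {R : realType}.
Local Open Scope ereal_scope.

Definition usc (T : topologicalType) (u : T -> \bar R) :=
  (forall x, u x <> +oo) /\
  forall x a, u x < a%:E -> exists2 V, nbhs x V & forall y, V y -> u y < a%:E.

Definition thuillier_subharmonic (k : nafield R) (Y : anspace k) (u : Y -> \bar R) :=
  [/\ usc u,
      forall y : Y, exists2 z, connected_component setT y z & u z <> -oo &
      forall (U : set Y) (c : chart k Y) (h : (ch_alg c -> R) -> R),
        an_affdom U c -> strictly_affinoid (ch_alg c) -> th_harmonic h ->
        (forall p, U p -> is_boundary (ch_ev c p) -> u p <= (h (ch_ev c p))%:E) ->
        forall p, U p -> u p <= (h (ch_ev c p))%:E].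

Definition subharmonic (k : nafield R) (X : anspace k) (u : X -> \bar R) :=
  usc u /\
  forall (K : nafield R) (io : aext k K) (XK : anspace K) (pi : XK -> X)
         (Y : anspace K) (f : Y -> XK),
    nontrivially_valued K -> is_base_change io pi ->
    is_curve Y -> an_smooth Y -> connected [set: Y] -> strictly_analytic Y ->
    is_morphism f ->
    thuillier_subharmonic (u \o pi \o f) \/ (forall y, u (pi (f y)) = -oo).

Definition classically_psh (k : nafield R) (X : anspace k) (u : X -> \bar R) :=
  usc u /\
  forall (K : nafield R) (io : aext k K) (XK : anspace K) (pi : XK -> X)
         (Y : anspace K) (f : Y -> XK),
    is_base_change io pi -> is_curve Y -> is_morphism f ->
    subharmonic (u \o pi \o f).

Definition directed (J : Type) (le : J -> J -> Prop) :=
  [/\ inhabited J, forall i, le i i, forall i j l, le i j -> le j l -> le i l &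
      forall i j, exists2 l, le i l & le j l].

Definition net_cvg_pointwise (J : Type) (le : J -> J -> Prop) (T : Type)
    (uJ : J -> T -> \bar R) (u : T -> \bar R) :=
  forall x A, nbhs (u x) A -> exists j0, forall j, le j0 j -> A (uJ j x).

End Psh.

(* Main.v *)
(** As a limit of the [u_j], [u] satisfies the comparison with a
harmonic function [h] on a strictly affinoid curve [U] as soon as the boundary of
[U] is finite: for [eps > 0] one then has [u_j <= h + eps] on the whole boundary for
[j] large, hence on [U], and one lets [j] grow and [eps] tend to [0].

The finiteness comes from the semistable model attached to [h]. It lives over a
finite extension [K/k] and has finitely many vertices; every boundary point of [U]
is the image of a vertex. Indeed a point [x] of [U] lifts to a point [y] of [U_K],
and if [y] is not a vertex it reduces to a closed point of the special fiber. By
Zariski's lemma the coordinates on a chart of the model are then residually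
algebraic at [y], so [y] is interior in that chart. At an interior point the powers
of a power-bounded function [f] are, up to elements of absolute value [< 1], in a
fixed finite dimensional space, so [f] satisfies a monic equation up to such an
element. Applied to the coordinates on [U] this makes [x] interior in [U]. *)
Require Import Defs.
From HB Require Import structures.
From mathcomp Require Import all_boot all_order all_algebra.
From mathcomp Require Import all_classical all_reals all_analysis.
From mathcomp Require Import ring lra ring_quotient generic_quotient.
Set Implicit Arguments.
Unset Strict Implicit.
Unset Printing Implicit Defensive.
Import Order.TTheory GRing.Theory Num.Theory.
Import numFieldNormedType.Exports.
Local Open Scope classical_set_scope.
Local Open Scope ring_scope.

(** * Zariski's lemma *)

(** Two features of the definitions shape the work. A base change is given only by its universal
    property, so a point can be lifted only after exhibiting a Banach [K]-algebra to which its
    seminorm extends. Hence [K (x)_k B] is built by hand in a basis of [K]. Its coordinate norm need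
    not be homogeneous over [K], and is submultiplicative only up to a constant, so it has to be
    renormed. In the same way the coordinatewise extension of a point is only a seminorm, and
    becomes multiplicative by passing to a minimal one. Interiority, on the other hand, asks for a
    presentation over [k], while the charts of the model live over [K] and have coordinates of their
    own. What passes between the two is the notion of being residually algebraic with coefficients
    from [k]. It is phrased by values [< 1], so the residue field of [k] is never formed: Zariski's
    lemma is proved over a ring, with denominators, and is applied over the valuation ring, where a
    denominator with nonzero residue is a unit. *)

Section Zariski.
Variable L : comNzRingType.
Hypothesis Ldom : forall x y : L, x * y = 0 -> x = 0 \/ y = 0.

Definition heval (R : comNzRingType) (phi : {rmorphism R -> L}) (a : L) :
    {rmorphism {poly R} -> L} :=
  horner_morph (fun x => mulrC a (phi x) : GRing.comm a (phi x)).

Lemma hevalE (R : comNzRingType) (phi : {rmorphism R -> L}) a p :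
  heval phi a p = (map_poly phi p).[a].
Proof. by []. Qed.

(** Adjoining an element replaces the base [R] by [{poly R}], so an induction on [s] moves elements
    into the base. This is why the base is an arbitrary ring with a morphism to [L]. *)
Fixpoint adj (R : comNzRingType) (phi : {rmorphism R -> L}) (s : seq L) : L -> Prop :=
  if s is a :: s' then adj (heval phi a) s' else fun e => exists r, e = phi r.

Lemma adj_base s (R : comNzRingType) (phi : {rmorphism R -> L}) r : adj phi s (phi r).
Proof.
elim: s R phi r => [|a s IH] R phi r /=; first by exists r.
by have := IH _ (heval phi a) r%:P; rewrite hevalE map_polyC hornerC.
Qed.

Lemma adj_mem s (R : comNzRingType) (phi : {rmorphism R -> L}) a : a \in s -> adj phi s a.
Proof.
elim: s R phi => [|b s IH] R phi //=; rewrite inE => /orP[/eqP->|]; last exact: IH.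
by have := adj_base s (heval phi b) 'X; rewrite hevalE map_polyX hornerX.
Qed.

Lemma adjD s (R : comNzRingType) (phi : {rmorphism R -> L}) x y :
  adj phi s x -> adj phi s y -> adj phi s (x + y).
Proof.
elim: s R phi => [|b s IH] R phi /=; last exact: IH.
by move=> [r ->] [r' ->]; exists (r + r'); rewrite rmorphD.
Qed.

Lemma adjM s (R : comNzRingType) (phi : {rmorphism R -> L}) x y :
  adj phi s x -> adj phi s y -> adj phi s (x * y).
Proof.
elim: s R phi => [|b s IH] R phi /=; last exact: IH.
by move=> [r ->] [r' ->]; exists (r * r'); rewrite rmorphM.
Qed.

Lemma adj_min s (R : comNzRingType) (phi : {rmorphism R -> L}) (T : L -> Prop) :
  (forall r, T (phi r)) -> {in s, forall a, T a} ->
  (forall x y, T x -> T y -> T (x + y)) -> (forall x y, T x -> T y -> T (x * y)) ->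
  forall e, adj phi s e -> T e.
Proof.
move=> + + TD TM; elim: s R phi => [|b s IH] R phi /= T0 Ts e; first by case=> r ->.
apply: IH => [p|a as_]; last by apply: Ts; rewrite inE as_ orbT.
rewrite hevalE; elim/poly_ind: p => [|p c IHp].
  by rewrite rmorph0 horner0 -(rmorph0 phi).
rewrite rmorphD rmorphM /= map_polyX map_polyC hornerMXaddC.
apply: TD; last exact: T0.
by apply: TM; [exact: IHp | apply: Ts; rewrite inE eqxx].
Qed.

Section Int.
Variables (R : comNzRingType) (phi : {rmorphism R -> L}).
Notation int := (integralOver phi).

Lemma int_exp x n : int x -> int (x ^+ n).
Proof.
move=> ix; elim: n => [|n IH]; first exact: integral1.
by rewrite exprS; apply: integral_mul.
Qed.

Lemma int_sum (I : Type) (s : seq I) (P : pred I) (F : I -> L) :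
  (forall i, int (F i)) -> int (\sum_(i <- s | P i) F i).
Proof. by move=> h; apply: big_ind => //; [exact: mxpoly.integral0|exact: integral_add]. Qed.

(** Transitivity of integrality: the coefficients lie in [L] and need only be integral
    themselves. *)
Lemma int_eqn n (f : nat -> L) y : (forall i, (i < n)%N -> int (f i)) ->
  y ^+ n + \sum_(i < n) f i * y ^+ i = 0 -> int y.
Proof.
move=> fi y0; pose p : {poly L} := \poly_(i < n.+1) (if i == n then 1 else f i).
have pn : p`_n = 1 by rewrite coef_poly leqnn eqxx.
have szp : size p = n.+1.
  apply/eqP; rewrite eqn_leq size_poly /= ltnNge; apply/negP => /leq_sizeP/(_ n (leqnn _)).
  by rewrite pn => /eqP; rewrite oner_eq0.
apply: (integral_root_monic (p := p)).
- by apply/monicP; rewrite lead_coefE szp.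
- rewrite /root horner_coef szp big_ord_recr /= pn mul1r addrC; apply/eqP; rewrite -[RHS]y0.
  congr (_ + _); apply: eq_bigr => i _.
  by rewrite coef_poly (ltnS i) ltnW // (ltn_eqF (ltn_ord i)).
- move=> x /(nthP 0)[i]; rewrite szp ltnS => ilen <-; rewrite coef_poly ltnS ilen.
  by case: eqP => [_|/eqP ne]; [exact: integral1|apply: fi; rewrite ltn_neqAle ne].
Qed.

Lemma int_eqnP y : int y -> exists n, exists f : nat -> R,
  y ^+ n + \sum_(i < n) phi (f i) * y ^+ i = 0.
Proof.
case=> p mp; rewrite /root horner_coef size_map_poly_id0; last first.
  by rewrite (monicP mp) (rmorph1 phi) oner_eq0.
move: (monic_neq0 mp); rewrite -size_poly_gt0; move: (monicP mp); rewrite lead_coefE.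
case: (size p) => // n /= pn _; rewrite big_ord_recr /= coef_map pn /= rmorph1 mul1r addrC => /eqP e.
exists n, (fun i => p`_i); rewrite -[RHS]e; congr (_ + _).
by apply: eq_bigr => i _; rewrite coef_map.
Qed.

(** With [l] the leading coefficient and [n.+1] the degree, [l ^+ n] times the relation is a monic
    equation for [l * a], with coefficients [l ^+ (n - i) * Q_i]. *)
Lemma int_lead (Q : {poly L}) a : Q != 0 -> root Q a -> (forall i, int Q`_i) ->
  int (lead_coef Q * a).
Proof.
move=> Q0 /eqP Qa iQ; set l := lead_coef Q.
case E: (size Q) => [|n]; first by move/eqP: E; rewrite size_poly_eq0 (negPf Q0).
case: n E => [|n] E.
  have QE := size1_polyC (eq_leq E).
  by move: Qa; rewrite QE hornerC => Qa; move: Q0; rewrite QE Qa eqxx.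
apply: (@int_eqn n.+1 (fun i => l ^+ (n - i) * Q`_i)) => [i _|].
  by apply: integral_mul => //; apply: int_exp; apply: iQ.
rewrite -[RHS](mulr0 (l ^+ n)) -[X in _ = _ * X]Qa horner_coef E [in RHS]big_ord_recr /= mulrDr [RHS]addrC mulr_sumr.
have -> : Q`_n.+1 = l by rewrite /l lead_coefE E.
congr (_ + _); first by rewrite exprMn mulrA -exprSr.
apply: eq_bigr => i _; have le_in : (i <= n)%N by rewrite -ltnS.
by rewrite exprMn mulrACA -exprD subnK // mulrA.
Qed.

(** Multiplying the equation by [g ^+ n] leaves at least one factor [g] for each [f i]. *)
Lemma int_scale g n (f : nat -> L) y : int g -> (forall i, (i < n)%N -> int (g * f i)) ->
  y ^+ n + \sum_(i < n) f i * y ^+ i = 0 -> int (g * y).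
Proof.
move=> ig fi y0; apply: (@int_eqn n (fun i => g ^+ (n - i.+1) * (g * f i))) => [i lin|].
  by apply: integral_mul; [apply: int_exp|apply: fi].
rewrite -[RHS](mulr0 (g ^+ n)) -[X in _ = _ * X]y0 mulrDr exprMn mulr_sumr; congr (_ + _).
apply: eq_bigr => i _; rewrite exprMn.
have -> : g ^+ n = g ^+ (n - i.+1) * g * g ^+ i by rewrite -exprSr subnSK // -exprD subnK // ltnW.
by rewrite !mulrA; congr (_ * _); rewrite mulrAC.
Qed.

(** Once the factors ['X] are stripped from the relation, its constant term is nonzero, and the rest
    of the relation exhibits it as a multiple of [w]. *)
Lemma alg_divisor w (U : {poly R}) : w != 0 -> map_poly phi U != 0 ->
  (map_poly phi U).[w] = 0 ->
  exists d (t : {poly R}), phi d != 0 /\ phi d = w * (map_poly phi t).[w].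
Proof.
move=> w0; elim/poly_ind: U => [|U c IH]; first by rewrite rmorph0 eqxx.
rewrite rmorphD rmorphM /= map_polyX map_polyC hornerMXaddC /=.
have [pc0|pc0 _] := eqVneq (phi c) 0; last first.
  move/eqP; rewrite addr_eq0 => /eqP e.
  exists c, (- U); split=> //; rewrite rmorphN hornerN mulrN mulrC e opprK //.
rewrite pc0 polyC0 !addr0 => U0 Uw; apply: IH.
  by apply: contraNneq U0 => ->; rewrite mul0r.
by case: (Ldom Uw) => // /eqP; rewrite (negPf w0).
Qed.

Lemma uniform_denominator (s : seq L) :
  {in s, forall a, exists2 r, phi r != 0 & int (phi r * a)} ->
  exists2 r, phi r != 0 & {in s, forall a, int (phi r * a)}.
Proof.
elim: s => [|b s IH] h; first by exists 1 => //; rewrite rmorph1 oner_eq0.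
have [|r r0 hr] := IH; first by move=> a as_; apply: h; rewrite inE as_ orbT.
have [|r' r'0 hr'] := h b; first by rewrite inE eqxx.
exists (r * r'); rewrite rmorphM.
  by apply/eqP => /Ldom[]/eqP; apply/negP.
move=> a; rewrite inE => /orP[/eqP->|/hr ia].
  by rewrite -mulrA; apply: integral_mul => //; apply: integral_id.
by rewrite mulrAC; apply: integral_mul => //; apply: integral_id.
Qed.

Lemma adj_denominator (s : seq L) p : {in s, forall b, int (phi p * b)} ->
  forall e, adj phi s e -> exists m, int (phi p ^+ m * e).
Proof.
move=> h; apply: adj_min.
- by move=> r; exists 0%N; rewrite mul1r; apply: integral_id.
- by move=> b bs; exists 1%N; apply: h.
- move=> x y [m hm] [n hn]; exists (m + n)%N; rewrite mulrDr; apply: integral_add.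
    by rewrite addnC exprD -mulrA; apply: integral_mul => //; apply: int_exp; apply: integral_id.
  by rewrite exprD -mulrA; apply: integral_mul => //; apply: int_exp; apply: integral_id.
- by move=> x y [m hm] [n hn]; exists (m + n)%N; rewrite exprD mulrACA; apply: integral_mul.
Qed.

(* Each [c^n P] is a polynomial in [c a], hence integral. *)
Lemma heval_denominator c a : int (phi c * a) ->
  forall p : {poly R}, forall n, (size p <= n.+1)%N -> int (phi c ^+ n * heval phi a p).
Proof.
move=> ica p n szp; rewrite hevalE (@horner_coef_wide _ n.+1); last first.
  exact: leq_trans (size_poly _ _) szp.
rewrite mulr_sumr; apply: int_sum => i; rewrite coef_map.
have -> : phi c ^+ n * (phi p`_i * a ^+ i) = phi c ^+ (n - i) * phi p`_i * (phi c * a) ^+ i.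
  have le_in : (i <= n)%N by rewrite -ltnS.
  by rewrite exprMn mulrACA -exprD subnK // mulrA.
apply: integral_mul; last exact: int_exp.
by apply: integral_mul; [apply: int_exp|]; apply: integral_id.
Qed.
End Int.

(* Otherwise an inverse of [1 + a P] would be, up to a power of [P], integral over
   the polynomials in [a], which would make the polynomial [1 + 'X * p] a unit. *)
Lemma adjoin_transcendental (R : comNzRingType) (phi : {rmorphism R -> L}) a (s : seq L) :
  (forall e, adj phi (a :: s) e -> e != 0 -> exists2 e', adj phi (a :: s) e' & e * e' = 1) ->
  forall p, heval phi a p != 0 ->
  {in s, forall b, integralOver (heval phi a) (heval phi a p * b)} ->
  exists2 q : {poly R}, map_poly phi q != 0 & (map_poly phi q).[a] = 0.
Proof.
move=> inv p p0 ps; apply: contrapT => tr.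
have {}tr q : heval phi a q = 0 -> map_poly phi q = 0.
  by move=> q0; apply/eqP/negPn/negP => qn; apply: tr; exists q.
set P := heval phi a p in p0 ps.
pose g := 1 + 'X * p.
have gE : heval phi a g = 1 + a * P.
  by rewrite rmorphD rmorphM rmorph1 hevalE map_polyX hornerX.
have mg : map_poly phi g = 1 + 'X * map_poly phi p.
  by rewrite rmorphD rmorphM /= rmorph1 map_polyX.
have g0 : heval phi a g != 0.
  apply/eqP => /tr/(congr1 (fun q : {poly L} => q`_0)); rewrite mg coefD coefXM coef0 coef1 /= addr0.
  by move/eqP; rewrite oner_eq0.
have [e ae ge] := inv _ (adj_base s (heval phi a) g) g0.
have [m] := adj_denominator ps ae; set w := _ * e => /int_eqnP[N [f fw]].
have gw : heval phi a g * w = P ^+ m by rewrite /w mulrCA ge mulr1.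
clearbody w.
(* [I] is the ideal generated by [1 + a P] among the polynomials in [a]. It contains [P ^+ (m * N)]
   because [w] is integral, and modulo [I] the product [a P] is [-1]; together these put [1] in
   [I]. *)
pose I v := exists h, v = heval phi a g * heval phi a h.
have ID x y : I x -> I y -> I (x + y).
  by move=> [h ->] [h' ->]; exists (h + h'); rewrite rmorphD mulrDr.
have IM x y : I y -> I (heval phi a x * y).
  by move=> [h ->]; exists (x * h); rewrite rmorphM mulrCA.
(* In [g(a) ^+ N * w ^+ i] with [i < N], the factor [w ^+ i] uses up only [i] of the [g(a)], each
   product [g(a) * w] being [P ^+ m]; at least one [g(a)] remains. *)
have I1 : I (P ^+ (m * N)).
  rewrite exprM -gw exprMn.
  have -> : w ^+ N = - \sum_(i < N) heval phi a (f i) * w ^+ i.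
    by apply/eqP; rewrite -addr_eq0; apply/eqP.
  rewrite mulrN mulr_sumr -sumrN; apply: big_ind => //.
    by exists 0; rewrite rmorph0 mulr0.
  move=> i _; exists (- (g ^+ (N - i.+1) * f i * (p ^+ m) ^+ i)).
  rewrite rmorphN mulrN; congr (- _); rewrite 2!rmorphM !rmorphXn -/P -gw exprMn.
  have -> : heval phi a g ^+ N = heval phi a g * heval phi a g ^+ (N - i.+1) * heval phi a g ^+ i.
    by rewrite -exprS -exprD subnSK // subnK // ltnW.
  by rewrite -!mulrA; do 2 congr (_ * _); rewrite mulrCA.
have I2 n : I ((a * P) ^+ n - (-1) ^+ n).
  have -> : a * P = heval phi a g - 1 by rewrite gE addrAC subrr add0r.
  elim: n => [|n [h IH]]; first by exists 0; rewrite subrr rmorph0 mulr0.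
  exists ((g - 1) ^+ n - h); rewrite rmorphB rmorphXn rmorphB rmorph1 mulrBr -IH.
  by rewrite !exprS mulrBl mul1r opprB addrA addrAC mulN1r opprK -!addrA; congr (_ + _);
     rewrite addrCA addrA addrC.
have [h h1] : I 1.
  set n := (m * N)%N in I1.
  have : I ((-1) ^+ n).
    have -> : (-1) ^+ n = (a * P) ^+ n + (-1) * ((a * P) ^+ n - (-1) ^+ n) :> L.
      by rewrite mulN1r opprB addrC subrK.
    apply: ID.
      by rewrite exprMn; have := IM ('X ^+ n) _ I1; rewrite rmorphXn hevalE map_polyX hornerX.
    by have := IM (-1) _ (I2 n); rewrite rmorphN rmorph1.
  move=> /(IM ((-1) ^+ n)); rewrite rmorphXn rmorphN rmorph1 -exprMn mulrNN mulr1 expr1n.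
  by [].
(* Transcendence turns the identity at [a] into one of polynomials over the domain [L]; there [g]
   has positive degree, one more than that of [p], and cannot be a unit. *)
have : map_poly phi (g * h) = 1.
  apply/eqP; rewrite -subr_eq0 -(rmorph1 (map_poly phi)) -rmorphB; apply/eqP/tr.
  by rewrite rmorphB rmorph1 rmorphM -h1 subrr.
rewrite rmorphM /= => /(congr1 (fun q : {poly L} => size q)); rewrite size_poly1.
have mp0 : map_poly phi p != 0.
  by apply: contraNneq p0; rewrite /P hevalE => ->; rewrite horner0.
have szg : size (map_poly phi g) = (size (map_poly phi p)).+1.
  by rewrite mg addrC mulrC size_MXaddC (negPf mp0).
have [->|h0] := eqVneq (map_poly phi h) 0; first by rewrite mulr0 size_poly0.
rewrite size_proper_mul; last first.
  apply/eqP => /Ldom[]/eqP; rewrite lead_coef_eq0 ?(negPf h0) //.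
  by rewrite -size_poly_eq0 szg.
rewrite szg addSn /=; move: mp0 h0; rewrite -!size_poly_gt0.
by case: (size _) => // x; case: (size _) => // y _ _; rewrite addSn addnS.
Qed.

(** Denominators replace fraction fields. In the induction the tail of [s] is integral, up to the
    factor [P], over the polynomials in [a]; since [a] is algebraic by the preceding lemma, [P] can
    be exchanged for a denominator from the base. *)
Theorem zariski (s : seq L) (R : comNzRingType) (phi : {rmorphism R -> L}) :
  (forall e, adj phi s e -> e != 0 -> exists2 e', adj phi s e' & e * e' = 1) ->
  {in s, forall a, exists2 r, phi r != 0 & integralOver phi (phi r * a)}.
Proof.
elim: s R phi => [|a s IH] R phi inv //.
have /uniform_denominator[p p0 ps] := IH _ (heval phi a) inv.
have [q q0 qa] := adjoin_transcendental inv p0 ps.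
have [c cE] : exists c, phi c = lead_coef (map_poly phi q).
  by rewrite lead_coefE coef_map; eexists.
have c0 : phi c != 0 by rewrite cE lead_coef_eq0.
have ica : integralOver phi (phi c * a).
  by rewrite cE; apply: int_lead => // [|i]; [apply/eqP|rewrite coef_map; apply: integral_id].
have exp0 n : phi c ^+ n != 0.
  elim: n => [|n IHn]; first by rewrite oner_eq0.
  by rewrite exprS; apply/eqP => /Ldom[]/eqP; apply/negP.
move=> b; rewrite inE => /orP[/eqP->|bs]; first by exists c.
set P := heval phi a p in p0 ps.
have iw := heval_denominator ica (leqnSn (size p)).
set n := size p in iw; set w := _ * _ in iw.
have w0 : w != 0 by apply/eqP => /Ldom[]/eqP; apply/negP.
have [U Um Uw] := iw.
(* The element [w] is nonzero and integral over the base, so it has a nonzero multiple [phi d]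
   there. As [w] is itself a multiple of [P], so is [phi d]. *)
have [|d [t [d0 dE]]] := alg_divisor w0 _ (eqP Uw).
  by rewrite -size_poly_gt0 size_map_poly_id0 ?size_poly_gt0 ?monic_neq0 //
    (monicP Um) rmorph1 oner_eq0.
have [e eE] : exists e, phi d = heval phi a e * P.
  exists (c%:P ^+ n * \sum_(i < size t) (t`_i)%:P * (c%:P ^+ n * p) ^+ i).
  rewrite dE {1}/w rmorphM rmorphXn (hevalE _ _ c%:P) map_polyC hornerC -/P mulrAC; congr (_ * _ * _).
  rewrite rmorph_sum (@horner_coef_wide _ (size t)); last exact: size_poly.
  apply: eq_bigr => i _; rewrite coef_map rmorphM hevalE map_polyC hornerC; congr (_ * _).
  by rewrite rmorphXn rmorphM rmorphXn hevalE map_polyC hornerC.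
have : integralOver (heval phi a) (phi d * b).
  by rewrite eE -mulrA; apply: integral_mul; [apply: integral_id|apply: ps].
case/int_eqnP => N [f fE].
(* The coefficients of the equation are polynomials in [a]; [phi c ^+ M] makes all of them integral
   over the base at once. *)
pose M := \max_(i < N) size (f i).
exists (c ^+ M * d); rewrite rmorphM rmorphXn; first by apply/eqP => /Ldom[]/eqP; apply/negP.
rewrite -mulrA; apply: int_scale fE.
  by apply: int_exp; apply: integral_id.
move=> i iN; apply: (heval_denominator ica (p := f i) (n := M)).
by apply: leqW; apply: (@leq_bigmax _ (fun i : 'I_N => size (f i)) (Ordinal iN)).
Qed.
End Zariski.

(** * Norms and points *)

Lemma geo_small (R : realType) (M th e : R) : 0 <= M -> 0 <= th < 1 -> 0 < e ->
  exists N, forall n, (N <= n)%N -> M * th ^+ n < e.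
Proof.
move=> M0 /andP[t0 t1] e0.
have M1 : 0 < M + 1 by rewrite ltr_wpDl.
have /cvgr0_norm_lt h0 : (fun n => th ^+ n) @ \oo --> (0 : R).
  by apply: cvg_expr; rewrite ger0_norm.
have [N _ hN] := h0 _ (divr_gt0 e0 M1).
exists N => n Nn; have := hN n Nn; rewrite /= ger0_norm ?exprn_ge0 // => h.
rewrite ltr_pdivlMr // in h; apply: le_lt_trans h.
by rewrite mulrC ler_wpM2l ?exprn_ge0 // lerDl.
Qed.

Section Ultra.
Variable R : realType.

Definition ultra (V : zmodType) (q : V -> R) :=
  [/\ q 0 = 0, forall x, q (- x) = q x & forall x y, q (x + y) <= Num.max (q x) (q y)].

Section UltraTheory.
Variables (V : zmodType) (q : V -> R).
Hypothesis uq : ultra q.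

Lemma ultra0 : q 0 = 0. Proof. by case: uq. Qed.
Lemma ultraN x : q (- x) = q x. Proof. by case: uq. Qed.
Lemma ultraBC x y : q (x - y) = q (y - x). Proof. by rewrite -opprB ultraN. Qed.
Lemma ultra_ge0 x : 0 <= q x.
Proof. by case: uq => q0 qN /(_ x (- x)); rewrite subrr q0 qN maxxx. Qed.
Lemma ultraD M x y : q x <= M -> q y <= M -> q (x + y) <= M.
Proof. by case: uq => _ _ /(_ x y) h hx hy; apply: le_trans h _; rewrite ge_max hx. Qed.
Lemma ultraB M x y : q x <= M -> q y <= M -> q (x - y) <= M.
Proof. by move=> hx hy; apply: ultraD; rewrite ?ultraN. Qed.
Lemma ultraD_lt M x y : q x < M -> q y < M -> q (x + y) < M.
Proof. by case: uq => _ _ /(_ x y) h hx hy; apply: le_lt_trans h _; rewrite gt_max hx. Qed.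
Lemma ultraB_lt M x y : q x < M -> q y < M -> q (x - y) < M.
Proof. by move=> hx hy; apply: ultraD_lt; rewrite ?ultraN. Qed.
Lemma ultra_sum (I : Type) (s : seq I) (P : pred I) (F : I -> V) M :
  0 <= M -> (forall i, P i -> q (F i) <= M) -> q (\sum_(i <- s | P i) F i) <= M.
Proof.
move=> M0 h; apply: (big_ind (fun x => q x <= M)) => //; first by rewrite ultra0.
exact: ultraD.
Qed.
Lemma ultra_sum_lt (I : Type) (s : seq I) (P : pred I) (F : I -> V) M :
  0 < M -> (forall i, P i -> q (F i) < M) -> q (\sum_(i <- s | P i) F i) < M.
Proof.
move=> M0 h; apply: (big_ind (fun x => q x < M)) => //; first by rewrite ultra0.
exact: ultraD_lt.
Qed.
End UltraTheory.

Section Field.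
Variable k : nafield R.

Lemma nabs0 : nabs (0 : k) = 0. Proof. exact/nabs_eq0. Qed.
Lemma nabs_gt0 (x : k) : x != 0 -> 0 < nabs x.
Proof.
by move=> x0; rewrite lt_def nabs_ge0 andbT; apply: contra_neq x0 => /nabs_eq0.
Qed.
Lemma nabs1 : nabs (1 : k) = 1.
Proof.
apply: (@mulfI _ (nabs (1 : k))); first by rewrite gt_eqF // nabs_gt0 // oner_eq0.
by rewrite -nabsM !mulr1.
Qed.
Lemma nabsN1 : nabs (- 1 : k) = 1.
Proof.
have : nabs (- 1 : k) ^+ 2 == 1 by rewrite expr2 -nabsM mulrNN mulr1 nabs1.
by rewrite sqrf_eq1 => /orP[/eqP //|/eqP h]; have := nabs_ge0 (- 1 : k); rewrite h ler0N1.
Qed.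
Lemma nabs_ultra : ultra (@nabs R k).
Proof.
split; [exact: nabs0| |exact: nabsD].
by move=> x; rewrite -mulN1r nabsM nabsN1 mul1r.
Qed.
Lemma nabsV (x : k) : nabs x^-1 = (nabs x)^-1.
Proof.
have [->|x0] := eqVneq x 0; first by rewrite invr0 nabs0 invr0.
apply: (@mulfI _ (nabs x)); first by rewrite gt_eqF // nabs_gt0.
by rewrite -nabsM !divff ?nabs1 // gt_eqF // nabs_gt0.
Qed.
End Field.

Section Alg.
Variables (k : nafield R) (A : banalg k).

Lemma bnorm0 : bnorm (0 : A) = 0. Proof. exact/bnorm_eq0. Qed.
Lemma bnorm_ultra : ultra (@bnorm R k A).
Proof.
split; [exact: bnorm0| |exact: bnormD].
by move=> x; rewrite -mulN1r -(rmorphN1 (ba_str A)) bnormZ nabsN1 mul1r.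
Qed.
Lemma bnorm_str c : bnorm (ba_str A c) <= nabs c.
Proof. by rewrite -[ba_str A c]mulr1 bnormZ ler_piMr ?nabs_ge0 // bnorm1. Qed.

(** Boundedness gives the inequality [<=] for both [c] and its inverse, and multiplicativity then
    forces equality. *)
Lemma pt_str (z : A -> R) c : is_pt z -> z (ba_str A c) = nabs c.
Proof.
case=> z1 zM zD zb.
have le c' : z (ba_str A c') <= nabs c'.
  by have /andP[_ h] := zb (ba_str A c'); apply: le_trans h (bnorm_str _).
have [->|c0] := eqVneq c 0.
  by rewrite nabs0; apply/eqP; rewrite eq_le -{1}(nabs0 k) le /=; case/andP: (zb (ba_str A 0)).
apply/eqP; rewrite eq_le le /=.
have := z1; rewrite -(rmorph1 (ba_str A)) -(divff c0) rmorphM zM => h.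
have zc : 0 <= z (ba_str A c) by case/andP: (zb (ba_str A c)).
have : 1 <= z (ba_str A c) * (nabs c)^-1.
  by rewrite -h ler_wpM2l // -nabsV le.
by rewrite ler_pdivlMr ?mul1r // nabs_gt0.
Qed.

Lemma pt_ultra (z : A -> R) : is_pt z -> ultra z.
Proof.
move=> zp; have [z1 zM zD zb] := zp; split=> //.
  by rewrite -(rmorph0 (ba_str A)) pt_str // nabs0.
by move=> x; rewrite -mulN1r -(rmorphN1 (ba_str A)) zM pt_str // nabsN1 mul1r.
Qed.

Lemma ptX (z : A -> R) x n : is_pt z -> z (x ^+ n) = z x ^+ n.
Proof. by case=> z1 zM _ _; elim: n => [|n IH]; rewrite ?z1 // !exprS zM IH. Qed.

Lemma pt_le (z : A -> R) x : is_pt z -> z x <= bnorm x.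
Proof. by case=> _ _ _ /(_ x)/andP[]. Qed.

(* Compare [z (x ^+ n)] with [C * bnorm x ^+ n] and let [n] grow. *)
Lemma pt_le_of_bounded (z : A -> R) (C : R) : z 1 = 1 -> (forall x y, z (x * y) = z x * z y) ->
  (forall x, 0 <= z x) -> (forall x, z x <= C * bnorm x) -> forall x, z x <= bnorm x.
Proof.
move=> z1 zM z0 zC x; rewrite leNgt; apply/negP => lt.
have bX n : bnorm (x ^+ n) <= bnorm x ^+ n.
  elim: n => [|n IH]; first exact: bnorm1.
  by rewrite !exprS; apply: le_trans (bnormM _ _) _; rewrite ler_wpM2l ?bnorm_ge0.
have zX n : z (x ^+ n) = z x ^+ n.
  by elim: n => [|n IH]; rewrite ?z1 // !exprS zM IH.
have zx : 0 < z x by apply: le_lt_trans lt; apply: bnorm_ge0.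
have C0 : 0 <= C.
  rewrite leNgt; apply/negP => C0; have := lt_le_trans zx (zC x).
  by rewrite ltNge nmulr_rle0 // bnorm_ge0.
have [|N /(_ N (leqnn N))] := @geo_small _ C (bnorm x / z x) 1 C0 _ ltr01.
  by rewrite divr_ge0 ?bnorm_ge0 ?(ltW zx) //= ltr_pdivrMr // mul1r.
rewrite expr_div_n mulrA ltr_pdivrMr ?exprn_gt0 // mul1r ltNge => /negP; apply.
by rewrite -zX; apply: le_trans (zC _) _; rewrite ler_wpM2l.
Qed.
End Alg.
End Ultra.

(** * Presentations *)

Section PolynomialSpan.
Variables (R : realType) (k : nafield R) (A : banalg k) (n : nat).
Variables (r : 'I_n -> R) (t : 'I_n -> A).
Hypothesis r_gt0 : forall i, 0 < r i.

Definition madd (nu mu : mindex n) : mindex n := [ffun i => (nu i + mu i)%N].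
Definition munit (i : 'I_n) : mindex n := [ffun j => (j == i) : nat].

Lemma wt_gt0 nu : 0 < wt r nu.
Proof. by apply: prodr_gt0 => i _; apply: exprn_gt0. Qed.
Lemma wt_madd nu mu : wt r (madd nu mu) = wt r nu * wt r mu.
Proof. by rewrite -big_split; apply: eq_bigr => i _; rewrite ffunE exprD. Qed.
Lemma mon_madd nu mu : mon t (madd nu mu) = mon t nu * mon t mu.
Proof. by rewrite -big_split; apply: eq_bigr => i _; rewrite ffunE exprD. Qed.
Lemma wt_munit i : wt r (munit i) = r i.
Proof.
rewrite /wt (bigD1 i) //= ffunE eqxx expr1 big1 ?mulr1 // => j /negPf ji.
by rewrite ffunE ji.
Qed.
Lemma mon_munit i : mon t (munit i) = t i.
Proof.
rewrite /mon (bigD1 i) //= ffunE eqxx expr1 big1 ?mulr1 // => j /negPf ji.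
by rewrite ffunE ji.
Qed.

(* Polynomials in [t] of norm at most [M] for the Gauss norm of radius [r]. *)
Definition polyspan (M : R) (f : A) := exists l : seq (k * mindex n),
  all (fun p => nabs p.1 * wt r p.2 <= M) l /\
  f = \sum_(p <- l) ba_str A p.1 * mon t p.2.

Lemma polyspan0 M : polyspan M 0.
Proof. by exists [::]; rewrite big_nil. Qed.

Lemma polyspan_term M c nu : nabs c * wt r nu <= M -> polyspan M (ba_str A c * mon t nu).
Proof. by move=> h; exists [:: (c, nu)]; rewrite /= h big_seq1. Qed.

Lemma polyspan_mono M M' f : M <= M' -> polyspan M f -> polyspan M' f.
Proof.
by move=> le [l [h ->]]; exists l; split=> //; apply: sub_all h => p /le_trans; apply.
Qed.

Lemma polyspanD M f g : polyspan M f -> polyspan M g -> polyspan M (f + g).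
Proof. by move=> [l [h ->]] [l' [h' ->]]; exists (l ++ l'); rewrite all_cat h h' big_cat. Qed.

Lemma polyspan_sum M (I : Type) (s : seq I) (P : pred I) (F : I -> A) :
  (forall i, P i -> polyspan M (F i)) -> polyspan M (\sum_(i <- s | P i) F i).
Proof. by move=> h; apply: big_ind => //; [apply: polyspan0|apply: polyspanD]. Qed.

Lemma polyspanM M M' f g : polyspan M f -> polyspan M' g -> polyspan (M * M') (f * g).
Proof.
move=> [l [/allP h ->]] [l' [/allP h' ->]].
rewrite big_distrlr /= big_seq; apply: polyspan_sum => p pl; rewrite big_seq; apply: polyspan_sum => q ql.
have -> : ba_str A p.1 * mon t p.2 * (ba_str A q.1 * mon t q.2) =
    ba_str A (p.1 * q.1) * mon t (madd p.2 q.2).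
  by rewrite rmorphM mon_madd mulrACA.
apply: polyspan_term; rewrite nabsM wt_madd mulrACA.
apply: ler_pM; [| |exact: h|exact: h']; by rewrite mulr_ge0 ?nabs_ge0 // ltW // wt_gt0.
Qed.

Lemma polyspan_mon nu : polyspan (wt r nu) (mon t nu).
Proof.
by have := @polyspan_term (wt r nu) 1 nu; rewrite nabs1 mul1r rmorph1 mul1r; apply.
Qed.

Lemma polyspan_coord i : polyspan (r i) (t i).
Proof. by rewrite -{1}(wt_munit i) -(mon_munit i); apply: polyspan_mon. Qed.

Lemma polyspan_str c : polyspan (nabs c) (ba_str A c).
Proof.
have w1 : wt r [ffun=> 0%N] = 1 by rewrite /wt big1 // => i _; rewrite ffunE.
have m1 : mon t [ffun=> 0%N] = 1 by rewrite /mon big1 // => i _; rewrite ffunE.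
by have := @polyspan_term (nabs c) c [ffun=> 0%N]; rewrite w1 m1 !mulr1; apply.
Qed.

Lemma polyspan1 : polyspan 1 1.
Proof. by rewrite -{1}(nabs1 k) -(rmorph1 (ba_str A)); apply: polyspan_str. Qed.

Lemma polyspanX M f m : polyspan M f -> polyspan (M ^+ m) (f ^+ m).
Proof. by move=> h; elim: m => [|m IH]; [apply: polyspan1|rewrite !exprS; apply: polyspanM]. Qed.

Lemma polyspan_prod (I : Type) (s : seq I) (M : I -> R) (F : I -> A) :
  (forall i, polyspan (M i) (F i)) -> polyspan (\prod_(i <- s) M i) (\prod_(i <- s) F i).
Proof.
by move=> h; elim: s => [|i s IH]; rewrite ?big_nil ?big_cons; [apply: polyspan1|apply: polyspanM].
Qed.

Lemma polyspan1X f m : polyspan 1 f -> polyspan 1 (f ^+ m).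
Proof. by move=> /polyspanX-/(_ m); rewrite expr1n. Qed.

Lemma polyspan1_prod (I : Type) (s : seq I) (F : I -> A) :
  (forall i, polyspan 1 (F i)) -> polyspan 1 (\prod_(i <- s) F i).
Proof. by move=> h; have := polyspan_prod s h; rewrite big1. Qed.

Lemma polyspan_partial_sum M (a : mindex n -> k) N :
  (forall nu, nabs (a nu) * wt r nu <= M) -> polyspan M (partial_sum t a N).
Proof. by move=> h; apply: polyspan_sum => nu _; apply: polyspan_term. Qed.

Lemma polyspan_bnorm C M f : (forall nu, bnorm (mon t nu) <= C * wt r nu) -> 0 <= C ->
  0 <= M -> polyspan M f -> bnorm f <= C * M.
Proof.
move=> hC C0 M0 [l [/allP h ->]]; rewrite big_seq.
apply: (ultra_sum (bnorm_ultra A)) => [|p pl]; first exact: mulr_ge0.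
rewrite bnormZ; apply: le_trans (_ : nabs p.1 * (C * wt r p.2) <= _).
  by rewrite ler_wpM2l ?nabs_ge0.
by rewrite mulrCA ler_wpM2l // h.
Qed.

Lemma polyspan_pt z M f : is_pt z -> 0 <= M -> (forall i, z (t i) <= r i) -> polyspan M f -> z f <= M.
Proof.
move=> zp M0 zt [l [/allP h ->]]; rewrite big_seq.
apply: (ultra_sum (pt_ultra zp)) => // p pl.
have zm : z (mon t p.2) <= wt r p.2.
  rewrite /mon /wt; have [z1 zM _ _] := zp.
  rewrite (big_morph z zM z1); apply: ler_prod => i _.
  by rewrite (ptX _ _ zp) exprn_ge0 ?(ultra_ge0 (pt_ultra zp)) // lerXn2r //
    ?nnegrE ?(ultra_ge0 (pt_ultra zp)) ?ltW.
have [_ zM _ _] := zp; rewrite zM (pt_str _ zp); apply: le_trans (h _ pl).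
by rewrite ler_wpM2l ?nabs_ge0.
Qed.

Lemma partial_sumD (a b : mindex n -> k) N :
  partial_sum t (fun nu => a nu + b nu) N = partial_sum t a N + partial_sum t b N.
Proof. by rewrite -big_split; apply: eq_bigr => nu _; rewrite rmorphD mulrDl. Qed.

Lemma partial_sumB (a b : mindex n -> k) N :
  partial_sum t (fun nu => a nu - b nu) N = partial_sum t a N - partial_sum t b N.
Proof. by rewrite -sumrB; apply: eq_bigr => nu _; rewrite rmorphB mulrBl. Qed.

Lemma partial_sum0 N : partial_sum t (fun=> 0) N = 0.
Proof. by apply: big1 => nu _; rewrite rmorph0 mul0r. Qed.

Lemma mindex_lt (nu : mindex n) N : (\sum_i nu i < N)%N -> forall i, (nu i < N)%N.
Proof. by move=> h i; apply: leq_ltn_trans h; rewrite (bigD1 i) //= leq_addr. Qed.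

Lemma partial_sum_delta (nu : mindex n) c N : (\sum_i nu i < N)%N ->
  partial_sum t (fun mu => if mu == nu then c else 0) N = ba_str A c * mon t nu.
Proof.
move=> /mindex_lt nuN; pose nu' : {ffun 'I_n -> 'I_N} := [ffun i => Ordinal (nuN i)].
have nuE : [ffun i => nat_of_ord (nu' i)] = nu by apply/ffunP => i; rewrite !ffunE.
rewrite /partial_sum (bigD1 nu') //= nuE eqxx big1 ?addr0 // => mu /negPf ne.
case: eqP => [e|_]; last by rewrite rmorph0 mul0r.
move: ne; suff -> : mu = nu' by rewrite eqxx.
by apply/ffunP => i; apply: val_inj; move/ffunP/(_ i): e; rewrite !ffunE.
Qed.

(** The list behind [polyspan] may repeat an exponent; by the ultrametric inequality, collecting its
    coefficients does not worsen the bound. *)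
Lemma polyspan_family M f : 0 <= M -> polyspan M f -> exists a : mindex n -> k, exists N,
  [/\ forall nu, nabs (a nu) * wt r nu <= M,
      forall nu : mindex n, (N <= \sum_i nu i)%N -> a nu = 0 &
      forall N', (N <= N')%N -> partial_sum t a N' = f].
Proof.
move=> M0 [l [h ->]]; elim: l h => [_|[c nu] l IH /= /andP[hc /IH[a [N [aM a0 aS]]]]].
  exists (fun=> 0), 0%N; rewrite big_nil; split=> // [nu|N' _]; last exact: partial_sum0.
  by rewrite nabs0 mul0r.
exists (fun mu => (if mu == nu then c else 0) + a mu), (maxn N (\sum_i nu i).+1); split.
- move=> mu; rewrite -ler_pdivlMr ?wt_gt0 //; apply: (ultraD (nabs_ultra k)).
    by case: eqP => [->|_]; rewrite ler_pdivlMr ?wt_gt0 // nabs0 mul0r.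
  by rewrite ler_pdivlMr ?wt_gt0.
- move=> mu; rewrite geq_max => /andP[h1 h2]; rewrite a0 // addr0.
  by case: eqP => // e; move: h2; rewrite e ltnn.
- move=> N'; rewrite geq_max => /andP[h1 h2].
  by rewrite partial_sumD partial_sum_delta // aS // big_cons.
Qed.

Lemma sums_to_pt (z : A -> R) a f : is_pt z -> sums_to t a f -> forall e, 0 < e ->
  exists N, z (f - partial_sum t a N) < e.
Proof.
move=> zp h e /h[N /(_ N (leqnn N)) lt]; exists N; rewrite (ultraBC (pt_ultra zp)).
exact: le_lt_trans (pt_le _ zp) lt.
Qed.
End PolynomialSpan.

Lemma half_small (R : realType) (M e : R) : 0 <= M -> 0 < e ->
  exists N, forall n, (N <= n)%N -> M * 2^-1 ^+ n < e.
Proof.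
by move=> M0 e0; apply: geo_small => //; rewrite invr_ge0 ler0n invf_lt1 // ltr1n.
Qed.

Section Presentation.
Variables (R : realType) (k : nafield R) (A : banalg k) (n : nat).
Variables (r : 'I_n -> R) (t : 'I_n -> A).

Lemma pres_bound : is_presentation r t -> exists C, 0 <= C /\
  forall nu, bnorm (mon t nu) <= C * wt r nu.
Proof.
case=> r0 [C hC] _; exists (Num.max C 0); rewrite le_max lexx orbT; split=> // nu.
by apply: le_trans (hC nu) _; rewrite ler_wpM2r ?le_max ?lexx // ltW // wt_gt0.
Qed.

Lemma pres_expand : is_presentation r t -> exists C, 0 <= C /\
  forall f, exists a : mindex n -> k, [/\ restricted r a, sums_to t a f &
            forall nu, nabs (a nu) * wt r nu <= C * bnorm f].
Proof.
case=> r0 _ [C hC]; exists (Num.max C 0); rewrite le_max lexx orbT; split=> // f.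
have [a [h1 h2 h3]] := hC f; exists a; split=> // nu.
by apply: le_trans (h3 nu) _; rewrite ler_wpM2r ?le_max ?lexx // bnorm_ge0.
Qed.

Lemma pres_approx : is_presentation r t -> exists C, 0 <= C /\
  forall f e, 0 < e -> exists2 p, polyspan r t (C * bnorm f) p & bnorm (f - p) < e.
Proof.
move=> h; have [r0 _ _] := h; have [C [C0 hC]] := pres_expand h.
exists C; split=> // f e e0; have [a [ra /(_ e e0)[N aN] aM]] := hC f.
exists (partial_sum t a N); first exact: polyspan_partial_sum.
by rewrite (ultraBC (bnorm_ultra A)) aN.
Qed.

Section Approx.
Variable C C' : R.
Hypotheses (r0 : forall i, 0 < r i) (C0 : 0 <= C) (C'0 : 0 <= C')
  (hC' : forall nu, bnorm (mon t nu) <= C' * wt r nu)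
  (app : forall f, exists2 p, polyspan r t (C * bnorm f) p & bnorm (f - p) <= 2^-1 * bnorm f).

(** Successive approximation: the remainder is halved at each step, so the coefficients of the
    successive polynomials decrease geometrically and can be summed in the complete field [k]. Thus
    a presentation is recognised from polynomial approximation up to half the norm. *)
Lemma approx_expand f : exists a : mindex n -> k, [/\ restricted r a, sums_to t a f &
  forall nu, nabs (a nu) * wt r nu <= C * bnorm f].
Proof.
have [P hP] : {P : A -> A & forall f, polyspan r t (C * bnorm f) (P f) /\
    bnorm (f - P f) <= 2^-1 * bnorm f}.
  by apply: (@choice _ _ (fun f p => polyspan r t (C * bnorm f) p /\
    bnorm (f - p) <= 2^-1 * bnorm f)) => g; have [p h1 h2] := app g; exists p.
have [a ha] : {a : A -> mindex n -> k & forall f, exists N,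
  [/\ forall nu, nabs (a f nu) * wt r nu <= C * bnorm f,
      forall nu : mindex n, (N <= \sum_i nu i)%N -> a f nu = 0 &
      forall N', (N <= N')%N -> partial_sum t (a f) N' = P f]}.
  apply: (@choice _ _ (fun f a => exists N,
  [/\ forall nu, nabs (a nu) * wt r nu <= C * bnorm f,
      forall nu : mindex n, (N <= \sum_i nu i)%N -> a nu = 0 &
      forall N', (N <= N')%N -> partial_sum t a N' = P f])) => g.
  by apply: polyspan_family => //; [rewrite mulr_ge0 ?bnorm_ge0|have [] := hP g].
pose F := fix F m := if m is m'.+1 then F m' - P (F m') else f.
have FS m : bnorm (F m) <= bnorm f * 2^-1 ^+ m.
  elim: m => [|m IH]; first by rewrite mulr1.
  by apply: le_trans (hP _).2 _; rewrite exprS mulrCA ler_pM2l // invr_gt0.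
(* Coefficients of the sum of the first [m] polynomials: finitely supported, with remainder [F m].
   For each [nu] they form a Cauchy sequence, at a rate that is uniform in [nu] after weighting by
   [wt r nu]. *)
pose S m nu : k := \sum_(j < m) a (F j) nu.
have Sfin m : exists N, (forall nu : mindex n, (N <= \sum_i nu i)%N -> S m nu = 0) /\
    forall N', (N <= N')%N -> partial_sum t (S m) N' = f - F m.
  elim: m => [|m [N [h1 h2]]].
    exists 0%N; split=> [nu _|N' _]; first by rewrite /S big_ord0.
    rewrite subrr -[RHS](partial_sum0 t N'); apply: eq_bigr => nu _.
    by rewrite /S big_ord0.
  have [N2 [_ h3 h4]] := ha (F m); exists (maxn N N2); split.
    move=> nu; rewrite geq_max => /andP[n1 n2].
    by rewrite /S big_ord_recr /= -/(S m nu) h1 // h3 // addr0.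
  move=> N'; rewrite geq_max => /andP[n1 n2].
  have -> : partial_sum t (S m.+1) N' = partial_sum t (fun nu => S m nu + a (F m) nu) N'.
    by apply: eq_bigr => nu _; rewrite /S big_ord_recr.
  by rewrite partial_sumD h2 // h4 // /= opprD opprK addrA.
pose B m := C * bnorm f * 2^-1 ^+ m.
have B0 m : 0 <= B m by rewrite !mulr_ge0 ?bnorm_ge0 // exprn_ge0 // invr_ge0.
have Bmono m m' : (m <= m')%N -> B m' <= B m.
  by move=> mm; rewrite ler_wpM2l ?mulr_ge0 ?bnorm_ge0 // ler_wiXn2l // ?invr_ge0 // invf_le1 // ler1n.
have Bsmall e : 0 < e -> exists m, B m < e.
  by move=> e0; have [|m /(_ m (leqnn m))] := @half_small _ (C * bnorm f) e _ e0;
    [rewrite mulr_ge0 ?bnorm_ge0|exists m].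
have aB m nu : nabs (a (F m) nu) * wt r nu <= B m.
  have [N [h _ _]] := ha (F m); apply: le_trans (h nu) _.
  by rewrite /B -mulrA ler_wpM2l.
have SB m d nu : nabs (S (m + d)%N nu - S m nu) <= B m / wt r nu.
  rewrite /S; elim: d => [|d IH].
    by rewrite addn0 subrr nabs0 divr_ge0 // ltW // wt_gt0.
  rewrite addnS big_ord_recr /= addrAC; apply: (ultraD (nabs_ultra k)) => //.
  by rewrite ler_pdivlMr ?wt_gt0 //; apply: le_trans (aB _ _) (Bmono _ _ (leq_addr _ _)).
have SB2 m m' M nu : (M <= m)%N -> (M <= m')%N -> nabs (S m nu - S m' nu) <= B M / wt r nu.
  move=> h1 h2; have -> : S m nu - S m' nu = (S m nu - S M nu) - (S m' nu - S M nu).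
    by rewrite opprB addrA subrK.
  have := SB M (m' - M)%N nu; have := SB M (m - M)%N nu; rewrite !subnKC //.
  exact: (ultraB (nabs_ultra k)).
have [b hb] : {b : mindex n -> k & forall nu e, 0 < e -> exists N, forall m, (N <= m)%N ->
    nabs (S m nu - b nu) < e}.
  apply: (@choice _ _ (fun nu l => forall e, 0 < e -> exists N, forall m, (N <= m)%N ->
    nabs (S m nu - l) < e)) => nu; apply: nabs_complete => e e0.
  have [M hM] := Bsmall (e * wt r nu) (mulr_gt0 e0 (wt_gt0 r0 nu)).
  exists M => m m' h1 h2; apply: le_lt_trans (SB2 _ _ _ _ h1 h2) _.
  by rewrite ltr_pdivrMr ?wt_gt0.
have bS m nu : nabs (b nu - S m nu) * wt r nu <= B m.
  rewrite -ler_pdivlMr ?wt_gt0 // leNgt; apply/negP => lt.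
  have [N hN] := hb nu _ (le_lt_trans (divr_ge0 (B0 m) (ltW (wt_gt0 r0 nu))) lt).
  have := hN (maxn N m) (leq_maxl _ _); rewrite ltNge => /negP; apply.
  have e : b nu - S m nu = (b nu - S (maxn N m) nu) + (S (maxn N m) nu - S m nu).
    by rewrite addrA subrK.
  have := nabsD (b nu - S (maxn N m) nu) (S (maxn N m) nu - S m nu); rewrite -e => h.
  rewrite [X in _ <= X](ultraBC (nabs_ultra k)); move: h; rewrite le_max => /orP[//|h].
  by have := le_trans h (SB2 _ _ _ _ (leq_maxr N m) (leqnn m)); rewrite leNgt lt.
exists b; split.
- move=> e /Bsmall[m Bm]; have [N [h1 _]] := Sfin m; exists N => nu /h1 S0.
  by have := bS m nu; rewrite S0 subr0 => /le_lt_trans; apply.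
(* The error splits into the polynomial with coefficients [b - S m], of norm at most [C' * B m], and
   the remainder [F m]. Using [C' + 1] avoids a division by zero. *)
- move=> e e0; have D0 : 0 < C' + 1 by rewrite ltr_wpDl.
  have [m1 hm1] := Bsmall (e / (C' + 1)) (divr_gt0 e0 D0).
  have [m2 hm2] := half_small (bnorm_ge0 f) e0.
  set m := maxn m1 m2.
  have [N [_ h2]] := Sfin m; exists N => N' NN'.
  have -> : partial_sum t b N' - f =
     partial_sum t (fun nu => b nu - S m nu) N' - F m.
    by rewrite partial_sumB h2 // opprB addrA addrAC addrK.
  apply: (ultraB_lt (bnorm_ultra A)); last first.
    by apply: le_lt_trans (FS _) (hm2 _ _); rewrite leq_maxr.
  apply: le_lt_trans (polyspan_bnorm hC' C'0 (B0 m) (polyspan_partial_sum t N' (bS m))) _.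
  apply: le_lt_trans (_ : (C' + 1) * B m1 < e); last by rewrite mulrC -ltr_pdivlMr.
  apply: ler_pM => //; first by rewrite lerDl.
  by rewrite Bmono // leq_maxl.
- by move=> nu; have := bS 0%N nu; rewrite /S big_ord0 subr0 /B mulr1.
Qed.

Lemma approx_pres : is_presentation r t.
Proof. by split=> //; [exists C'|exists C; apply: approx_expand]. Qed.
End Approx.
End Presentation.

(** * Interior points *)

Section Integral.
Variable R : realType.

(** The map [g] is a parameter so that coefficients in [k] can also be used in algebras over an
    extension of [k]. *)
Definition monic_value (k : nafield R) (A : comPzRingType) (g : k -> A) (a : A)
    (d : nat) (c : nat -> k) : A := a ^+ d + \sum_(i < d) g (c i) * a ^+ i.

(* The reduction of [a] at [z] is algebraic over the residue field of [k]. *)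
Definition residually_algebraic (k : nafield R) (A : comPzRingType) (g : k -> A)
    (z : A -> R) (a : A) :=
  exists d c, (forall i, nabs (c i) <= 1) /\ z (monic_value g a d c) < 1.

Definition power_bounded (k : nafield R) (A : banalg k) (f : A) :=
  exists C, forall N, bnorm (f ^+ N) <= C.

Lemma power_bounded_pt (k : nafield R) (A : banalg k) (z : A -> R) (f : A) :
  is_pt z -> power_bounded f -> z f <= 1.
Proof.
move=> zp [C hC]; rewrite leNgt; apply/negP => lt.
have z0 : 0 < z f by apply: lt_trans lt.
have C0 : 0 <= C by apply: le_trans (hC 0%N); apply: bnorm_ge0.
have [|N /(_ N (leqnn N))] := @geo_small _ C (z f)^-1 1 C0 _ ltr01.
  by rewrite invr_ge0 (ltW z0) invf_lt1.
rewrite exprVn ltr_pdivrMr ?exprn_gt0 // mul1r ltNge => /negP; apply.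
by rewrite -(ptX _ _ zp); apply: le_trans (pt_le _ zp) (hC _).
Qed.

Lemma power_bounded_coord (k : nafield R) (A : banalg k) n (t : 'I_n -> A) i :
  is_presentation (fun=> 1) t -> power_bounded (t i).
Proof.
move=> /[dup] ht [r0 _ _]; have [C [C0 hC]] := pres_bound ht.
exists C => N; rewrite -[C]mulr1; apply: (polyspan_bnorm hC) => //.
by apply: (polyspan1X r0); apply: (polyspan_coord (fun=> 1)).
Qed.

Section Interior.
Variables (k : nafield R) (A : banalg k) (n : nat) (t : 'I_n -> A) (z : A -> R).
Hypotheses (ht : is_presentation (fun=> 1) t) (zp : is_pt z).
Variables (d : 'I_n -> nat) (c : 'I_n -> nat -> k).
Hypotheses (c1 : forall i j, nabs (c i j) <= 1)
  (hz : forall i, z (monic_value (ba_str A) (t i) (d i) (c i)) < 1).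

(* Adding the coordinates [s i] of radius [1] makes it possible to enlarge the radius
   of [t i] from [1] to [2]. *)
Let s i := monic_value (ba_str A) (t i) (d i) (c i).
Let r2 (i : 'I_(n + n)) : R := if fintype.split i is inl _ then 1 else 2.
Let t2 (i : 'I_(n + n)) : A := match fintype.split i with inl j => s j | inr j => t j end.

Let r2_gt0 i : 0 < r2 i.
Proof. by rewrite /r2; case: fintype.split. Qed.

Let s_polyspan i : polyspan r2 t2 1 (s i).
Proof.
have := polyspan_coord r2 t2 (lshift n i).
by rewrite /r2 /t2; case: fintype.splitP => j /= e; [rewrite (_ : i = j) //; apply: val_inj|
  have := ltn_ord i; rewrite e ltnNge leq_addr].
Qed.

Let t_polyspan i : polyspan r2 t2 2 (t i).
Proof.
have := polyspan_coord r2 t2 (rshift n i).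
rewrite /r2 /t2; case: fintype.splitP => j /= e; first by have := ltn_ord j; rewrite -e ltnNge leq_addr.
by rewrite (_ : i = j) //; apply: val_inj; apply/eqP; rewrite -(eqn_add2l n) e.
Qed.

Let d_gt0 i : (0 < d i)%N.
Proof.
rewrite lt0n; apply/negP => /eqP di; have := hz i.
by rewrite /monic_value di big_ord0 addr0; have [-> _ _ _] := zp; rewrite ltxx.
Qed.

(** Division by the monic polynomial defining [s i]: a power of [t i] is a combination of products
    of powers of [s i], of radius [1], with powers of [t i] below [d i]. So the bound does not grow
    with [m]. *)
Let tX_polyspan i m : polyspan r2 t2 (2 ^+ d i) (t i ^+ m).
Proof.
have ge1 p : 1 <= 2 ^+ p :> R by rewrite exprn_ege1 // ler1n.
elim/ltn_ind: m => m IH; have [md|dm] := ltnP m (d i).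
  by apply: polyspan_mono (polyspanX r2_gt0 m (t_polyspan i)); rewrite ler_weXn2l ?ler1n // ltnW.
have -> : t i ^+ m = s i * t i ^+ (m - d i)
    + \sum_(j < d i) ba_str A (- c i j) * t i ^+ (m - d i + j).
  rewrite /s /monic_value mulrDl -exprD subnKC // -addrA [X in _ = _ + X](_ : _ = 0) ?addr0 //.
  rewrite mulr_suml -big_split big1 //= => j _.
  by rewrite rmorphN mulNr -mulrA -exprD [(j + _)%N]addnC subrr.
apply: polyspanD; first by rewrite -[2 ^+ _]mul1r; apply: polyspanM => //; apply: IH;
  rewrite ltn_subrL d_gt0 (leq_trans _ dm).
apply: polyspan_sum => j _; apply: polyspan_mono (polyspanM r2_gt0 (polyspan_str _ _ _) (IH _ _)).
  by rewrite ler_piMl ?(ultraN (nabs_ultra k)) // (le_trans _ (ge1 _)).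
by rewrite -ltn_subRL subKn // ltn_ord.
Qed.

Let one_gt0 (i : 'I_n) : (0 : R) < (fun=> 1) i.
Proof. exact: ltr01. Qed.

Let polyspan_new M f : polyspan (fun=> 1) t M f -> polyspan r2 t2 (M * \prod_i 2 ^+ d i) f.
Proof.
move=> [l [/allP h ->]]; rewrite [X in polyspan _ _ _ X]big_seq; apply: polyspan_sum => p pl.
have D0 : 0 <= \prod_i 2 ^+ d i :> R by apply: prodr_ge0 => i _; rewrite exprn_ge0.
apply: (@polyspan_mono _ _ _ _ _ _ (nabs p.1 * \prod_i 2 ^+ d i)).
  apply: ler_wpM2r => //; have := h _ pl.
  by rewrite /wt big1 ?mulr1 // => i _; rewrite expr1n.
by apply: polyspanM (polyspan_str _ _ _) _; last apply: polyspan_prod.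
Qed.

Let t2_polyspan i : polyspan (fun=> 1) t 1 (t2 i).
Proof.
have ti j : polyspan (fun=> 1) t 1 (t j) by apply: (polyspan_coord (fun=> 1)).
rewrite /t2; case: fintype.split => j //; apply: polyspanD.
  exact: (polyspan1X one_gt0).
apply: polyspan_sum => m _; apply: polyspan_mono (polyspanM one_gt0 (polyspan_str _ _ _) (polyspan1X one_gt0 m (ti j))).
by rewrite mulr1.
Qed.

(** The enlarged system is still a presentation, because rewriting a polynomial in the new
    coordinates costs at most the fixed factor [\prod_i 2 ^+ d i]. At [z] all strict inequalities
    now hold: [s i] is below [1] by hypothesis, and [t i] is at most [1 < 2]. *)
Lemma interior_of_monic : is_interior z.
Proof.
exists (n + n)%N, r2, t2; split.
  have [C [C0 hC]] := pres_bound ht; have [C' [C'0 hC']] := pres_approx ht.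
  apply: (@approx_pres _ _ _ _ _ _ (C' * \prod_i 2 ^+ d i) C) => //.
  - by rewrite mulr_ge0 //; apply: prodr_ge0 => i _; rewrite exprn_ge0.
  - move=> nu; apply: (@le_trans _ _ (C * 1)).
      apply: (polyspan_bnorm hC) => //.
      by apply: (polyspan1_prod one_gt0) => i; apply: (polyspan1X one_gt0); apply: t2_polyspan.
    rewrite ler_wpM2l //; apply: (big_ind (fun x => 1 <= x)) => // [x y|i _].
      exact: mulr_ege1.
    by rewrite exprn_ege1 // /r2; case: fintype.split => _ //; rewrite ler1n.
  - move=> f; have [->|f0] := eqVneq f 0.
      by exists 0; [apply: polyspan0|rewrite subrr bnorm0 mulr0].
    have bf : 0 < 2^-1 * bnorm f.
      rewrite mulr_gt0 ?invr_gt0 // lt_def bnorm_ge0 andbT.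
      by apply: contra_neq f0 => /bnorm_eq0.
    have [p hp /ltW lp] := hC' f _ bf; exists p => //.
    by rewrite mulrAC; apply: polyspan_new.
move=> i; rewrite /t2 /r2; case: fintype.split => j; first exact: hz.
apply: le_lt_trans (_ : 1 < 2); last by rewrite ltr1n.
by apply: power_bounded_pt => //; apply: power_bounded_coord.
Qed.
End Interior.

Lemma interior_of_residually_algebraic (k : nafield R) (A : banalg k) n (t : 'I_n -> A)
    (z : A -> R) : is_presentation (fun=> 1) t -> is_pt z ->
  (forall i, residually_algebraic (ba_str A) z (t i)) -> is_interior z.
Proof.
move=> ht zp /choice[d /choice[c h]].
by apply: (@interior_of_monic _ _ _ _ _ ht zp d c) => i; have [] := h i.
Qed.

Lemma linear_dependence (F : fieldType) (U : finType) (c : nat -> U -> F) :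
  exists2 lam : nat -> F, (exists2 i, (i <= #|U|)%N & lam i != 0) &
    forall u, \sum_(i < #|U|.+1) lam i * c i u = 0.
Proof.
pose M : 'M[F]_(#|U|.+1, #|U|) := \matrix_(i, j) c i (enum_val j).
have : kermx M != 0.
  by rewrite -mxrank_eq0 mxrank_ker subn_eq0 -ltnNge ltnS rank_leq_col.
case/matrix0Pn => i [j kij]; exists (fun m => kermx M i (inord m)).
  exists j; last by rewrite inord_val.
  by rewrite -ltnS.
move=> u; have := mulmx_ker M => /matrixP/(_ i (enum_rank u)); rewrite mxE [RHS]mxE => e.
rewrite -[RHS]e; apply: eq_bigr => m _.
by rewrite inord_val [M _ _]mxE enum_rankK.
Qed.

(** Dividing a linear relation by its last coefficient of maximal absolute value makes it monic of
    that degree: lower coefficients become at most [1], higher ones [< 1] and hence negligible. *)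
Lemma last_max (v : nat -> R) n : exists2 m, (m <= n)%N &
  (forall i, (i <= n)%N -> v i <= v m) /\ (forall i, (m < i <= n)%N -> v i < v m).
Proof.
elim: n => [|n [m mn [h1 h2]]].
  exists 0%N => //; split=> i; first by rewrite leqn0 => /eqP ->.
  by case: i.
have [le|lt] := leP (v m) (v n.+1).
  exists n.+1 => //; split=> i; last by case/andP => /leq_trans/[apply]; rewrite ltnn.
  by rewrite leq_eqVlt => /orP[/eqP->//|/h1 h]; apply: le_trans h le.
exists m; first exact: leqW.
split=> i; first by rewrite leq_eqVlt => /orP[/eqP->|/h1//]; apply: ltW.
by case/andP=> mi; rewrite leq_eqVlt => /orP[/eqP->//|iN]; apply: h2; rewrite mi.
Qed.

Section Algebraic.
Variables (k K : nafield R) (io : aext k K) (C : banalg K) (z : C -> R) (zp : is_pt z).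
Variables (m : nat) (b : 'I_m -> K).
Hypothesis span : forall x, exists c : 'I_m -> k, x = \sum_i io (c i) * b i.

Let g c := ba_str C (io c).
Let zg c : z (g c) = nabs c.
Proof. by rewrite pt_str // aext_isom. Qed.

(** The point is that [M] does not depend on [N]: power-boundedness bounds the expansions of all
    [f ^+ N] together, and interiority makes their terms of high degree [< 1] at [z]. *)
Lemma interior_finite_span n (r : 'I_n -> R) (t : 'I_n -> C) f :
  is_presentation r t -> (forall i, z (t i) < r i) -> power_bounded f ->
  exists M, forall N, exists a : mindex n -> K, z (f ^+ N - partial_sum t a M) < 1.
Proof.
move=> ht zt [Cf hf]; have [r0 _ _] := ht; have [C1 [C10 hC1]] := pres_expand ht.
have [z1 zM zD zb] := zp; have uz := pt_ultra zp.
(* The largest ratio [z (t i) / r i]; it is [< 1] since there are finitely many coordinates, so a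
   monomial of degree [m] gains the factor [th ^+ m] over its weight. *)
pose th := \big[Num.max/0]_i (z (t i) / r i).
have th0 : 0 <= th by apply: bigmax_ge_id.
have th1 : th < 1 by apply: bigmax_lt => // i _; rewrite ltr_pdivrMr // mul1r.
have zth i : z (t i) <= th * r i by rewrite -ler_pdivrMr //; apply: le_bigmax.
have zmon (nu : mindex n) : z (mon t nu) <= th ^+ (\sum_i nu i) * wt r nu.
  rewrite -prodrXr -big_split /= /mon (big_morph z zM z1).
  apply: ler_prod => i _; rewrite (ptX _ _ zp) exprn_ge0 ?(ultra_ge0 uz) //= -exprMn.
  by apply: lerXn2r; rewrite ?nnegrE ?(ultra_ge0 uz) // mulr_ge0 // ltW.
have Cf0 : 0 <= Cf by apply: le_trans (hf 0%N); apply: bnorm_ge0.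
have [|M hM] := @geo_small _ (C1 * Cf) th 1 (mulr_ge0 C10 Cf0) _ ltr01.
  by rewrite th0.
exists M => N; have [a [_ sa aM]] := hC1 (f ^+ N).
have [N' hN'] := sums_to_pt zp sa ltr01.
suff [a' ha'] : exists a', z (partial_sum t a N' - partial_sum t a' M) < 1.
  exists a'; rewrite -(subrK (partial_sum t a N') (f ^+ N)) -addrA.
  exact: (ultraD_lt uz).
(* Terms of total degree below [M] have all exponents below [M], so they fit in a partial sum with
   bound [M]; the other terms are [< 1] at [z]. *)
rewrite {1}/partial_sum (bigID (fun nu : {ffun 'I_n -> 'I_N'} => (\sum_i nu i < M)%N)) /=.
set S1 := \sum_(nu | _) _; set S2 := \sum_(nu | _) _.
have [a' ->] : exists a', S1 = partial_sum t a' M.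
  apply: (big_ind (fun x => exists a', x = partial_sum t a' M)).
  - by exists (fun=> 0); rewrite partial_sum0.
  - by move=> x y [a1 ->] [a2 ->]; exists (fun nu => a1 nu + a2 nu); rewrite partial_sumD.
  - move=> nu nuM; set nu' := [ffun i => nat_of_ord (nu i)].
    exists (fun mu => if mu == nu' then a nu' else 0); rewrite partial_sum_delta //.
    by rewrite (eq_bigr (fun i => nat_of_ord (nu i))) // => i _; rewrite ffunE.
exists a'; rewrite addrAC subrr add0r; apply: (ultra_sum_lt uz) => // nu; rewrite -leqNgt.
set nu' := [ffun i => nat_of_ord (nu i)] => nuM.
rewrite zM pt_str //; apply: le_lt_trans (_ : C1 * Cf * th ^+ (\sum_i nu i) < 1); last exact: hM.
apply: le_trans (_ : nabs (a nu') * wt r nu' * th ^+ (\sum_i nu i) <= _).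
  rewrite -mulrA ler_wpM2l ?nabs_ge0 // mulrC; have := zmon nu'.
  by rewrite (eq_bigr (fun i => nat_of_ord (nu i))) // => i _; rewrite ffunE.
rewrite ler_wpM2r ?exprn_ge0 //; apply: le_trans (aM nu') _.
by rewrite ler_wpM2l.
Qed.

(* Modulo elements of absolute value [< 1] at [z], the powers of [f] stay in a
   finite dimensional [k]-space, so they satisfy a linear relation. *)
Lemma interior_residually_algebraic f : is_interior z -> power_bounded f ->
  residually_algebraic g z f.
Proof.
move=> [n [r [t [ht zt]]]] fb; have zf := power_bounded_pt zp fb.
have uz := pt_ultra zp; have [z1 zM zD zb] := zp.
have [M /choice[a ha]] := interior_finite_span ht zt fb.
have [c cE] := choice (fun x => span x).
(* The relation is wanted over [k], so each coefficient in [K] is expanded in the generators [b]; a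
   vector is indexed by an exponent and a generator. The powers from [0] to [#|U|] are then
   dependent. *)
pose U : finType := ({ffun 'I_n -> 'I_M} * 'I_m)%type.
pose nuof (nu : {ffun 'I_n -> 'I_M}) : mindex n := [ffun i => nat_of_ord (nu i)].
have [lam [i0 i0U li0] lamE] :=
  linear_dependence (fun N (u : U) => c (a N (nuof u.1)) u.2).
have [m0 m0U [max1 max2]] := last_max (fun i => nabs (lam i)) #|U|.
have lm0 : 0 < nabs (lam m0) by apply: lt_le_trans (max1 _ i0U); apply: nabs_gt0.
pose mu i := lam i / lam m0.
have nmu i : nabs (mu i) = nabs (lam i) / nabs (lam m0) by rewrite /mu nabsM nabsV.
have mu1 i : (i <= #|U|)%N -> nabs (mu i) <= 1.
  by move=> /max1; rewrite nmu ler_pdivrMr // mul1r.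
have mu2 i : (m0 < i <= #|U|)%N -> nabs (mu i) < 1.
  by move=> /max2; rewrite nmu ltr_pdivrMr // mul1r.
have mum0 : mu m0 = 1.
  by rewrite /mu divff //; apply: contraTneq lm0 => ->; rewrite nabs0 ltxx.
have dep : \sum_(i < #|U|.+1) g (mu i) * partial_sum t (a i) M = 0.
  rewrite /partial_sum; under eq_bigr do rewrite mulr_sumr.
  rewrite exchange_big big1 //= => nu _; under eq_bigr do rewrite mulrA.
  rewrite -mulr_suml; apply/eqP; rewrite /g.
  under eq_bigr do rewrite -rmorphM.
  rewrite -rmorph_sum /=; set X := \sum_(i < _) _; suff -> : X = 0 by rewrite rmorph0 mul0r.
  have -> : X = \sum_(i < #|U|.+1) \sum_j io (mu i * c (a i (nuof nu)) j) * b j.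
    apply: eq_bigr => i _; rewrite {1}(cE (a i _)) mulr_sumr; apply: eq_bigr => j _.
    by rewrite rmorphM mulrA.
  rewrite exchange_big big1 //= => j _; rewrite -mulr_suml -rmorph_sum.
  rewrite [X in io X](_ : _ = (\sum_(i < #|U|.+1) lam i * c (a i (nuof nu)) j) / lam m0).
    by have := lamE (nu, j) => /= ->; rewrite mul0r rmorph0 mul0r.
  by rewrite mulr_suml; apply: eq_bigr => i _; rewrite mulrAC.
have dep2 : z (\sum_(i < #|U|.+1) g (mu i) * f ^+ i) < 1.
  rewrite -[X in z X](subr0) -[X in _ - X]dep -sumrB.
  apply: (ultra_sum_lt uz) => // i _; rewrite -mulrBr zM zg.
  by apply: le_lt_trans (ha i); rewrite ler_piMl ?(ultra_ge0 uz) // mu1 // -ltnS.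
(* The coefficient bound is required at every index, whereas [mu] is controlled only up to [#|U|];
   hence the value [0] beyond. *)
exists m0, (fun i => if (i <= #|U|)%N then mu i else 0); split.
  by move=> i; case: ifP => [/mu1 //|_]; rewrite nabs0.
have <- : \sum_(i < #|U|.+1) g (mu i) * f ^+ i - \sum_(i < #|U|.+1 | (m0 < i)%N) g (mu i) * f ^+ i
   = monic_value g f m0 (fun i => if (i <= #|U|)%N then mu i else 0).
  rewrite (bigID (fun i : 'I_ _ => (m0 < i)%N)) /= addrAC subrr add0r.
  under eq_bigl do rewrite -leqNgt -ltnS.
  rewrite (big_ord_narrow (m0U : (m0.+1 <= #|U|.+1)%N)) /= big_ord_recr /= mum0.
  rewrite [g 1](rmorph1 (ba_str C \o io)) mul1r addrC; congr (_ + _).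
  by apply: eq_bigr => i _; rewrite ifT // (leq_trans _ m0U) // ltnW.
apply: (ultraB_lt uz) => //; apply: (ultra_sum_lt uz) => // i m0i.
have iU : (m0 < i <= #|U|)%N by rewrite m0i -ltnS ltn_ord.
rewrite zM zg (ptX _ _ zp); apply: le_lt_trans (mu2 i iU).
by rewrite ler_piMr ?nabs_ge0 // exprn_ile1 // (ultra_ge0 uz).
Qed.
End Algebraic.
End Integral.

(** * Model rings and residue rings *)

Section ModelRing.
Variables (R : realType) (k : nafield R) (A : banalg k) (n : nat) (t : 'I_n -> A).
Hypothesis ht : is_presentation (fun=> 1) t.

Definition model_ring : set A := [set f | exists a : mindex n -> k,
  [/\ restricted (fun=> 1) a, forall nu, nabs (a nu) <= 1 & sums_to t a f]].

Let one_gt0 (i : 'I_n) : (0 : R) < (fun=> 1) i.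
Proof. exact: ltr01. Qed.
Let wt1 (nu : mindex n) : wt (fun=> 1 : R) nu = 1.
Proof. by rewrite /wt big1 // => i _; rewrite expr1n. Qed.

(** The model ring is the closure of the polynomials with integral coefficients; in this form its
    closure under products needs no multiplication of series. *)
Lemma model_ringP f : model_ring f <->
  forall e, 0 < e -> exists2 p, polyspan (fun=> 1) t 1 p & bnorm (f - p) < e.
Proof.
split=> [[a [ra a1 sa]] e e0|h].
  have [N hN] := sa e e0; exists (partial_sum t a N).
    by apply: polyspan_partial_sum => nu; rewrite wt1 mulr1.
  by rewrite (ultraBC (bnorm_ultra A)) hN.
have [C [C0 hC]] := pres_expand ht; have C1 : 0 < C + 1 by rewrite ltr_wpDl.
(* A remainder this small has an expansion with coefficients of absolute value at most [1]. *)
have [|p pp fp] := h (C + 1)^-1; first by rewrite invr_gt0.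
have [a [N [a1 a0 aS]]] := polyspan_family one_gt0 ler01 pp.
have [b [rb sb b1]] := hC (f - p).
exists (fun nu => a nu + b nu); split.
- move=> e e0; have [N' hN'] := rb e e0; exists (maxn N N') => nu.
  by rewrite geq_max => /andP[n1 n2]; rewrite a0 // add0r hN'.
- move=> nu; apply: (ultraD (nabs_ultra k)); first by have := a1 nu; rewrite wt1 mulr1.
  have := b1 nu; rewrite wt1 mulr1 => /le_trans; apply.
  apply: (@le_trans _ _ ((C + 1) * (C + 1)^-1)); last by rewrite divff // gt_eqF.
  by apply: ler_pM; rewrite ?bnorm_ge0 // ?lerDl // ltW.
- move=> e e0; have [N' hN'] := sb e e0; exists (maxn N N') => M.
  rewrite geq_max => /andP[n1 n2]; rewrite partial_sumD aS //.
  have -> : p + partial_sum t b M - f = partial_sum t b M - (f - p).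
    by rewrite opprB addrCA addrA.
  exact: hN'.
Qed.

Lemma model_ring_polyspan p : polyspan (fun=> 1) t 1 p -> model_ring p.
Proof. by move=> pp; apply/model_ringP => e e0; exists p => //; rewrite subrr bnorm0. Qed.

Lemma model_ringD f g : model_ring f -> model_ring g -> model_ring (f + g).
Proof.
move=> /model_ringP hf /model_ringP hg; apply/model_ringP => e e0.
have [p pp fp] := hf e e0; have [q qq gq] := hg e e0.
exists (p + q); first exact: polyspanD.
by rewrite opprD addrACA; apply: (ultraD_lt (bnorm_ultra A)).
Qed.

Lemma model_ringM f g : model_ring f -> model_ring g -> model_ring (f * g).
Proof.
move=> /model_ringP hf /model_ringP hg; apply/model_ringP => e e0.
have [C [C0 hC]] := pres_bound ht.
have pC p : polyspan (fun=> 1) t 1 p -> bnorm p <= C + 1.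
  move=> pp; apply: (@le_trans _ _ (C * 1)); last by rewrite mulr1 lerDl.
  exact: (polyspan_bnorm hC).
have C1 : 0 < C + 1 by rewrite ltr_wpDl.
have e1 : 0 < Num.min 1 (e / (C + 1)) by rewrite lt_min ltr01 divr_gt0.
have [p pp] := hf _ e1; rewrite lt_min => /andP[fp1 fp].
have [q qq] := hg _ e1; rewrite lt_min => /andP[gq1 gq].
exists (p * q); first by have := polyspanM one_gt0 pp qq; rewrite mulr1.
have -> : f * g - p * q = (f - p) * g + (g - q) * p.
  by rewrite !mulrBl [g * p]mulrC [q * p]mulrC addrA subrK.
apply: (ultraD_lt (bnorm_ultra A)); apply: le_lt_trans (bnormM _ _) _.
  apply: (@le_lt_trans _ _ (bnorm (f - p) * (C + 1))); last by rewrite -ltr_pdivlMr.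
  rewrite ler_wpM2l ?bnorm_ge0 // -(subrK q g); apply: (ultraD (bnorm_ultra A)); last exact: pC.
  by apply: ltW; apply: lt_le_trans gq1 _; rewrite lerDr.
apply: (@le_lt_trans _ _ (bnorm (g - q) * (C + 1))); last by rewrite -ltr_pdivlMr.
by rewrite ler_wpM2l ?bnorm_ge0 // pC.
Qed.

Lemma model_ring_str c : nabs c <= 1 -> model_ring (ba_str A c).
Proof. by move=> c1; apply: model_ring_polyspan; apply: polyspan_mono c1 (polyspan_str _ _ _). Qed.

Lemma model_ring1 : model_ring 1.
Proof. by rewrite -(rmorph1 (ba_str A)); apply: model_ring_str; rewrite nabs1. Qed.

Lemma model_ring_coord i : model_ring (t i).
Proof. by apply: model_ring_polyspan; apply: (polyspan_coord (fun=> 1)). Qed.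

Lemma model_ring_pt y f : is_pt y -> model_ring f -> y f <= 1.
Proof.
move=> yp /model_ringP/(_ 1 ltr01)[p pp fp]; rewrite -(subrK p f).
apply: (ultraD (pt_ultra yp)); first by apply: le_trans (pt_le _ yp) (ltW fp).
apply: (polyspan_pt one_gt0 yp) pp => // i.
by apply: power_bounded_pt => //; apply: power_bounded_coord.
Qed.

Lemma model_ring_red_ideal y : is_pt y -> ideal_in model_ring (red model_ring y).
Proof.
move=> yp; have uy := pt_ultra yp; have [y1 yM yD yb] := yp; split.
- by move=> a [].
- split; last by rewrite (ultra0 uy).
  by rewrite -(rmorph0 (ba_str A)); apply: model_ring_str; rewrite nabs0.
- move=> a b [Sa a1] [Sb b1]; split; first exact: model_ringD.
  exact: (ultraD_lt uy).
- move=> a b Sa [Sb b1]; split; first exact: model_ringM.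
  by rewrite yM; apply: le_lt_trans b1; rewrite ler_piMl ?(ultra_ge0 uy) // model_ring_pt.
Qed.

Lemma model_ring_red_prime y : is_pt y -> prime_in model_ring (red model_ring y).
Proof.
move=> yp; have uy := pt_ultra yp; have [y1 yM yD yb] := yp; split.
- exact: model_ring_red_ideal.
- by case; rewrite y1 ltxx.
- move=> a b Sa Sb [_]; rewrite yM => ab.
  have [a1|a1] := ltP (y a) 1; first by left.
  by right; split=> //; apply: le_lt_trans ab; rewrite ler_peMl ?(ultra_ge0 uy).
Qed.

Lemma model_ring_red_point y : is_pt y -> sp_point model_ring (red model_ring y).
Proof.
move=> yp; split; first exact: model_ring_red_prime.
move=> a [c [b [c1 Sb ->]]]; split.
  by apply: model_ringM => //; apply: model_ring_str; apply: ltW.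
have [_ yM _ _] := yp; rewrite yM pt_str //.
by apply: le_lt_trans c1; rewrite ler_piMr ?nabs_ge0 // model_ring_pt.
Qed.

End ModelRing.

Section Residue.
Local Open Scope quotient_scope.
Variables (R : realType) (k : nafield R) (A : banalg k) (z : A -> R).
Hypothesis zp : is_pt z.

(* The unused argument lets the instances below find the proof that [z] is a point. *)
Definition pt_ring_pred (_ : is_pt z) : pred A := fun a => z a <= 1.

Lemma pt_ring_closed : subring_closed (pt_ring_pred zp).
Proof.
have [z1 zM zD zb] := zp; split; rewrite ?unfold_in /=.
- by rewrite /pt_ring_pred z1.
- by move=> a b; rewrite !unfold_in => ha hb; apply: (ultraB (pt_ultra zp)).
- move=> a b; rewrite !unfold_in /pt_ring_pred zM => ha hb.
  by rewrite mulr_ile1 // (ultra_ge0 (pt_ultra zp)).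
Qed.
HB.instance Definition _ := GRing.isSubringClosed.Build A (pt_ring_pred zp) pt_ring_closed.

Record pt_ring := PtRing { pt_ring_val : A; pt_ring_le : pt_ring_val \in pt_ring_pred zp }.
HB.instance Definition _ := [isSub for pt_ring_val].
HB.instance Definition _ := [Choice of pt_ring by <:].
HB.instance Definition _ := GRing.SubChoice_isSubComPzRing.Build A _ pt_ring (GRing.subringClosedP _).

Lemma pt_ring_nonzero : (1 : pt_ring) != 0.
Proof.
apply/eqP => /(congr1 (fun a => z (val a))); have [z1 _ _ _] := zp.
by rewrite rmorph1 rmorph0 z1 (ultra0 (pt_ultra zp)) => /eqP; rewrite oner_eq0.
Qed.
HB.instance Definition _ := GRing.PzSemiRing_isNonZero.Build pt_ring pt_ring_nonzero.

Definition pt_ideal (_ : is_pt z) : pred pt_ring := fun a => z (val a) < 1.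
Lemma pt_ideal_closed : idealr_closed (pt_ideal zp).
Proof.
have [z1 zM zD zb] := zp; split; rewrite ?unfold_in.
- by change (z (val (0 : pt_ring)) < 1); rewrite rmorph0 (ultra0 (pt_ultra zp)).
- by change (~~ (z (val (1 : pt_ring)) < 1)); rewrite rmorph1 z1 ltxx.
- move=> a u v; rewrite !unfold_in => hu hv; change (z (val (a * u + v)) < 1).
  rewrite rmorphD rmorphM; apply: (ultraD_lt (pt_ultra zp)) => //.
  rewrite zM; apply: le_lt_trans (hu : z (val u) < 1).
  by rewrite ler_piMl ?(ultra_ge0 (pt_ultra zp)) //; have := valP a.
Qed.
HB.instance Definition _ := isIdealr.Build pt_ring (pt_ideal zp) pt_ideal_closed.

Definition pt_idealr : idealr pt_ring := pt_ideal zp.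
Definition residue : comNzRingType := {ideal_quot pt_idealr}.

(** Where [z f > 1] the value is the class of the default [0]; the lemmas on sums, products and
    vanishing therefore assume values at most [1]. *)
Definition residue_class (f : A) : residue := \pi_{ideal_quot pt_idealr} (insubd 0 f).
Notation rc := residue_class.

Lemma val_pt_ring f : z f <= 1 -> val (insubd (0 : pt_ring) f) = f.
Proof. by move=> h; rewrite val_insubd ifT. Qed.

Lemma residue_eq0 f : z f <= 1 -> rc f = 0 <-> z f < 1.
Proof.
move=> f1; rewrite -{2}(val_pt_ring f1).
have -> : (z (val (insubd (0 : pt_ring) f)) < 1) = (insubd 0 f - 0 \in pt_idealr).
  by rewrite subr0.
rewrite Quotient.idealrBE /rc; split=> [->|/eqP ->]; by rewrite rmorph0.
Qed.

Lemma residueD f g : z f <= 1 -> z g <= 1 -> rc (f + g) = rc f + rc g.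
Proof.
move=> f1 g1; rewrite /rc -rmorphD; congr (\pi _); apply: val_inj.
by rewrite rmorphD /= !val_pt_ring //; apply: (ultraD (pt_ultra zp)).
Qed.

Lemma residueM f g : z f <= 1 -> z g <= 1 -> rc (f * g) = rc f * rc g.
Proof.
move=> f1 g1; rewrite /rc -rmorphM; congr (\pi _); apply: val_inj.
rewrite rmorphM /= !val_pt_ring //; have [_ zM _ _] := zp.
by rewrite zM mulr_ile1 ?(ultra_ge0 (pt_ultra zp)).
Qed.

Lemma residue1 : rc 1 = 1.
Proof.
rewrite /rc -[RHS](rmorph1 \pi_{ideal_quot pt_idealr}); congr (\pi _); apply: val_inj.
by rewrite rmorph1 val_pt_ring //; have [-> _ _ _] := zp.
Qed.

Lemma residue_domain (x y : residue) : x * y = 0 -> x = 0 \/ y = 0.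
Proof.
have rcE (x' : residue) : exists2 f, z f <= 1 & x' = rc f.
  exists (val (repr x')); first exact: (valP (repr x')).
  by rewrite /rc valKd reprK.
have [f f1 ->] := rcE x; have [g g1 ->] := rcE y; have [_ zM _ _] := zp.
rewrite -residueM // => /residue_eq0; rewrite zM mulr_ile1 ?(ultra_ge0 (pt_ultra zp)) //.
move=> /(_ isT) fg; have [f2|f2] := ltP (z f) 1; first by left; apply/residue_eq0.
right; apply/residue_eq0 => //; apply: le_lt_trans fg.
by rewrite ler_peMl ?(ultra_ge0 (pt_ultra zp)).
Qed.

End Residue.

Section ValuationRing.
Variables (R : realType) (k : nafield R).

Definition vring_pred : pred k := fun c => nabs c <= 1.
Lemma vring_closed : subring_closed vring_pred.
Proof.
split; rewrite ?unfold_in /vring_pred /=.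
- by rewrite nabs1.
- by move=> a b; rewrite !unfold_in => ha hb; apply: (ultraB (nabs_ultra k)).
- by move=> a b; rewrite !unfold_in nabsM => ha hb; rewrite mulr_ile1 ?nabs_ge0.
Qed.
HB.instance Definition _ := GRing.isSubringClosed.Build k vring_pred vring_closed.

Record vring := VRing { vring_val : k; vring_le : vring_val \in vring_pred }.
HB.instance Definition _ := [isSub for vring_val].
HB.instance Definition _ := [Choice of vring by <:].
HB.instance Definition _ := [SubChoice_isSubComNzRing of vring by <:].

Lemma vringP (c : vring) : nabs (val c) <= 1.
Proof. exact: (valP c). Qed.

Variables (A : banalg k) (z : A -> R) (zp : is_pt z).
Notation rc := (residue_class zp).

Definition vring_residue (c : vring) : residue zp := rc (ba_str A (val c)).

Lemma vring_residue_le (c : vring) : z (ba_str A (val c)) <= 1.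
Proof. by rewrite pt_str // vringP. Qed.

Lemma vring_residue_zmod : zmod_morphism vring_residue.
Proof.
move=> a b; apply/eqP; rewrite eq_sym subr_eq /vring_residue -residueD ?vring_residue_le //.
by rewrite -rmorphD -rmorphD subrK.
Qed.
Lemma vring_residue_monoid : monoid_morphism vring_residue.
Proof.
split; first by rewrite /vring_residue !rmorph1 residue1.
by move=> a b; rewrite /vring_residue !rmorphM residueM ?vring_residue_le.
Qed.
HB.instance Definition _ := GRing.isZmodMorphism.Build vring (residue zp) vring_residue
  vring_residue_zmod.
HB.instance Definition _ := GRing.isMonoidMorphism.Build vring (residue zp) vring_residue
  vring_residue_monoid.

Definition vring_map : {rmorphism vring -> residue zp} := vring_residue.

(** A denominator with nonzero residue has absolute value [1], so it is a unit of the valuation ring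
    and can be divided out. The integral equation then lifts to [A] as a monic value that is [< 1]
    at [z]. *)
Lemma vring_residue_integral f : z f <= 1 ->
  (exists2 r, vring_map r != 0 & integralOver vring_map (vring_map r * rc f)) ->
  residually_algebraic (ba_str A) z f.
Proof.
move=> f1 [r r0 ir]; have uz := pt_ultra zp; have [z1 zM zD zb] := zp.
have nr : nabs (val r) = 1.
  apply/eqP; rewrite eq_le vringP leNgt; apply: contra_neqN r0 => lt.
  by apply/(residue_eq0 zp (vring_residue_le r)); rewrite pt_str.
have r'P : (val r)^-1 \in vring_pred by rewrite unfold_in /vring_pred nabsV nr invr1.
have {ir} /int_eqnP[n [c e]] : integralOver vring_map (rc f).
  have -> : rc f = vring_map (VRing r'P) * (vring_map r * rc f).
    rewrite mulrA -rmorphM [X in vring_map X](_ : _ = 1) ?rmorph1 ?mul1r //.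
    have vr0 : val r != 0.
      by apply: contra_eq_neq nr => ->; rewrite nabs0 eq_sym oner_eq0.
    by apply: val_inj; rewrite rmorphM rmorph1 /= mulVf.
  exact: integral_mul (integral_id _ _) ir.
exists n, (fun i => val (c i)); split=> [i|]; first exact: vringP.
have fX m : z (f ^+ m) <= 1 /\ rc (f ^+ m) = rc f ^+ m.
  elim: m => [|m [IH1 IH2]]; first by rewrite residue1 z1.
  by rewrite !exprS zM residueM // IH2 mulr_ile1 ?(ultra_ge0 uz).
have cfX m : z (ba_str A (val (c m)) * f ^+ m) <= 1.
  by rewrite zM mulr_ile1 ?(ultra_ge0 uz) ?vring_residue_le // (fX m).1.
have [S1 S2] : z (\sum_(i < n) ba_str A (val (c i)) * f ^+ i) <= 1 /\
    rc (\sum_(i < n) ba_str A (val (c i)) * f ^+ i) = \sum_(i < n) vring_map (c i) * rc f ^+ i.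
  elim: {e} n => [|m [IH1 IH2]].
    rewrite !big_ord0 (ultra0 uz); split=> //.
    by apply/residue_eq0; rewrite (ultra0 uz).
  rewrite !big_ord_recr /= residueD // IH2 residueM ?vring_residue_le ?(fX m).1 // (fX m).2.
  by split=> //; apply: (ultraD uz).
apply/(residue_eq0 zp); first by apply: (ultraD uz) => //; exact: (fX n).1.
by rewrite residueD ?(fX n).1 // (fX n).2 S2.
Qed.
End ValuationRing.

(* The maximal residue ring of a model is a field of finite type over the residue
   field of [k]. *)
Lemma maximal_residually_algebraic (R : realType) (k : nafield R) (A : banalg k) n (t : 'I_n -> A)
    (z : A -> R) : is_presentation (fun=> 1) t -> is_pt z ->
  maximal_in (model_ring t) (red (model_ring t) z) ->
  forall i, residually_algebraic (ba_str A) z (t i).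
Proof.
move=> ht zp [_ _ max] i; have uz := pt_ultra zp; have [z1 zM zD zb] := zp.
pose S := model_ring t; pose phi := vring_map zp.
have S1 f : S f -> z f <= 1 by apply: model_ring_pt.
pose s := [seq residue_class zp (t j) | j <- enum 'I_n].
have adjS e : adj phi s e -> exists2 f, S f & e = residue_class zp f.
  apply: (@adj_min _ s _ phi (fun e => exists2 f, S f & e = residue_class zp f)).
  - move=> r; exists (ba_str A (val r)) => //.
    by apply: (model_ring_str ht); apply: vringP.
  - by move=> _ /mapP[j _ ->]; exists (t j) => //; apply: model_ring_coord.
  - move=> _ _ [f Sf ->] [g Sg ->]; exists (f + g); first exact: model_ringD.
    by rewrite residueD ?S1.
  - move=> _ _ [f Sf ->] [g Sg ->]; exists (f * g); first exact: model_ringM.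
    by rewrite residueM ?S1.
have adjP f : polyspan (fun=> 1) t 1 f -> adj phi s (residue_class zp f).
  have one0 (j : 'I_n) : 0 < (1 : R) := ltr01.
  move=> [l [+ ->]]; elim: l => [_|[c nu] l IH /= /andP[c1 hl]].
    rewrite big_nil; have <- : phi 0 = residue_class zp 0; last exact: adj_base.
    by rewrite rmorph0; apply/esym/residue_eq0; rewrite (ultra0 uz).
  have {}c1 : nabs c <= 1.
    by move: c1; rewrite /wt big1 ?mulr1 // => j _; rewrite expr1n.
  have zt j : z (t j) <= 1 by apply: S1; apply: model_ring_coord.
  have cin : c \in @vring_pred R k by [].
  have [zm am] : z (mon t nu) <= 1 /\ adj phi s (residue_class zp (mon t nu)).
    rewrite /mon; apply: (big_ind (fun x => z x <= 1 /\ adj phi s (residue_class zp x))).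
    - by rewrite z1 residue1 -(rmorph1 phi); split=> //; apply: adj_base.
    - move=> x y [x1 ax] [y1 ay]; rewrite zM residueM // mulr_ile1 ?(ultra_ge0 uz) //.
      by split=> //; apply: adjM.
    - move=> j _; elim: (nu j) => [|m [IH1 IH2]].
        by rewrite z1 residue1 -(rmorph1 phi); split=> //; apply: adj_base.
      rewrite exprS zM residueM // mulr_ile1 ?(ultra_ge0 uz) //; split=> //.
      by apply: adjM => //; apply: adj_mem; apply: map_f; rewrite mem_enum.
  have cm : z (ba_str A c * mon t nu) <= 1.
    by rewrite zM mulr_ile1 ?(ultra_ge0 uz) // pt_str.
  rewrite big_cons residueD //; last first.
    by apply: S1; apply: (model_ring_polyspan ht); exists l.
  apply: adjD; last exact: IH.
  rewrite residueM // ?pt_str //; apply: adjM => //.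
  exact: (adj_base s phi (VRing cin)).
(* An element of the model ring differs from an integral polynomial by norm [< 1], which is
   invisible in the residue ring. With [adjS], the ring [adj phi s] is the image of the model
   ring. *)
have adjrc f : S f -> adj phi s (residue_class zp f).
  move=> Sf; have /(model_ringP ht)/(_ 1 ltr01)[p pp fp] := Sf.
  have zfp : z (f - p) < 1 by apply: le_lt_trans (pt_le _ zp) fp.
  have -> : residue_class zp f = residue_class zp p.
    rewrite -{1}(subrK p f) residueD ?(ltW zfp) //; last by apply: S1; apply: (model_ring_polyspan ht).
    by rewrite (residue_eq0 zp (ltW zfp)).2 // add0r.
  exact: adjP.
apply: (@vring_residue_integral _ _ _ _ zp); first by apply: S1; apply: model_ring_coord.
apply: (@zariski _ (@residue_domain _ _ _ _ zp) s); last first.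
  by apply: map_f; rewrite mem_enum.
move=> e /adjS[a Sa ->] a0.
have za : ~ z a < 1.
  by move=> lt; move/eqP: a0; apply; apply/(residue_eq0 zp (S1 _ Sa)).
(* [Q] is the ideal generated by the reduction ideal and [a]. By maximality it contains
   [1 = p + u * a], and the class of [u] inverts that of [a]. *)
pose Q : set A := [set b | exists p u, [/\ red S z p, S u & b = p + u * a]].
have [PS P0 PD PM] := model_ring_red_ideal ht zp.
have [p [u [[Sp p1] Su e1]]] : Q 1.
  apply: contrapT => Q1; suff QP : Q = red S z.
    have : Q a.
      by exists 0, 1; rewrite add0r mul1r; split=> //; apply: (model_ring1 ht).
    by rewrite QP => -[_ /za].
  apply: max => //; last first.
    move=> b Pb; exists b, 0; rewrite mul0r addr0; split=> //; exact: PS.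
  split.
  - move=> _ [p [u [[Sp _] Su ->]]]; apply: model_ringD => //; exact: model_ringM.
  - by exists 0, 0; rewrite mul0r addr0; split=> //; apply: PS.
  - move=> _ _ [p [u [Pp Su ->]]] [p' [u' [Pp' Su' ->]]]; exists (p + p'), (u + u').
    by split; [exact: PD|exact: model_ringD|rewrite mulrDl addrACA].
  - move=> b _ Sb [p [u [Pp Su ->]]]; exists (b * p), (b * u).
    by split; [exact: PM|exact: model_ringM|rewrite mulrDr mulrA].
exists (residue_class zp u); first exact: adjrc.
rewrite -residueM ?S1 // mulrC -(residue1 zp) e1 residueD ?S1 //; last exact: model_ringM.
by rewrite (residue_eq0 zp (S1 _ Sp)).2 // add0r.
Qed.

(** * Extension of seminorms *)

Section InfNonneg.
Variable R : realType.
Implicit Types (S : set R) (u v w s : R).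

Lemma inf_le_mem S s : (forall x, S x -> 0 <= x) -> S s -> inf S <= s.
Proof. by move=> S0 Ss; apply: ge_inf => //; exists 0 => x /S0. Qed.

Lemma le_of_gt u w : (forall s, u < s -> w <= s) -> w <= u.
Proof.
move=> h; rewrite leNgt; apply/negP => lt; have := h ((u + w) / 2); lra.
Qed.

Lemma le_mul_of_gt u v w : 0 <= u -> 0 <= v ->
  (forall s s', u < s -> v < s' -> w <= s * s') -> w <= u * v.
Proof.
move=> u0 v0 h; rewrite leNgt; apply/negP => lt.
(* For [e <= 1] the product [(u + e) * (v + e)] exceeds [u * v] by at most [e * (u + v + 1)]; the
   factor [2] keeps this below [w - u * v]. *)
pose d := 2 * (u + v + 1); have d0 : 0 < d by rewrite /d; lra.
pose e := Num.min 1 ((w - u * v) / d).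
have e0 : 0 < e by rewrite lt_min ltr01 divr_gt0 // subr_gt0.
have e1 : e <= 1 by rewrite ge_min lexx.
have e2 : e * d <= w - u * v by rewrite -ler_pdivlMr // ge_min lexx orbT.
have := h (u + e) (v + e); rewrite !ltrDl => /(_ e0 e0); rewrite /d in e2; nra.
Qed.
End InfNonneg.

(* The minimal elements among the submultiplicative seminorms extending [x] are
   multiplicative; this is the argument for the non-emptiness of a spectrum. *)
Section ExtendSeminorm.
Variables (R : realType) (B E : comPzRingType) (j : B -> E) (x : B -> R).
Hypotheses (j1 : j 1 = 1) (jM : forall a b, j (a * b) = j a * j b).
Hypotheses (x1 : x 1 = 1) (xM : forall a b, x (a * b) = x a * x b) (x0 : forall a, 0 <= x a).

(** The constant [C] is there because the seminorm built from coordinates is submultiplicative only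
    up to a constant. *)
Definition adm_seminorm (C : R) (q : E -> R) := [/\ ultra q,
  forall a b, q (a * b) <= C * (q a * q b) & forall b, q (j b) = x b].

Let jX b n : j (b ^+ n) = j b ^+ n.
Proof. by elim: n => [|n IH]; rewrite ?j1 // !exprS jM IH. Qed.
Let xX b n : x (b ^+ n) = x b ^+ n.
Proof. by elim: n => [|n IH]; rewrite ?x1 // !exprS xM IH. Qed.

Section Spectral.
Variables (C : R) (q : E -> R).
Hypotheses (C1 : 1 <= C) (aq : adm_seminorm C q).

Let uq : ultra q. Proof. by case: aq. Qed.
Let q0 a : 0 <= q a. Proof. exact: (ultra_ge0 uq). Qed.
Let q1 : q 1 = 1. Proof. by have [_ _ h] := aq; rewrite -j1 h x1. Qed.
Let C0 : 0 <= C. Proof. by apply: le_trans C1. Qed.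

(** The infimum of these growth rates is the spectral radius, the limit of the [n]-th roots of
    [q (c ^+ n)], expressed without roots or limits. *)
Definition spectral_bound (c : E) : set R :=
  [set s | 0 < s /\ exists D, forall n, q (c ^+ n) <= D * s ^+ n].
Definition spectral (c : E) : R := inf (spectral_bound c).

Lemma spectral_bound_self c s : C * q c <= s -> 0 < s -> spectral_bound c s.
Proof.
move=> cs s0; split=> //; exists 1 => n; rewrite mul1r.
elim: n => [|n IH]; first by rewrite q1.
rewrite !exprS; have [_ qM _] := aq; apply: le_trans (qM _ _) _.
by rewrite mulrA ler_pM // mulr_ge0.
Qed.

Let sb_ge0 c s : spectral_bound c s -> 0 <= s.
Proof. by case=> /ltW. Qed.

Let sb_neq0 c : spectral_bound c !=set0.
Proof.
exists (C * q c + 1); apply: spectral_bound_self; first by rewrite lerDl.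
by rewrite ltr_wpDl // mulr_ge0.
Qed.

Lemma spectral_le c s : spectral_bound c s -> spectral c <= s.
Proof. exact: inf_le_mem (sb_ge0 (c := c)). Qed.

Lemma spectral_ge0 c : 0 <= spectral c.
Proof. by apply: lb_le_inf => // s; apply: sb_ge0. Qed.

Lemma spectral_lt c s : spectral c < s -> spectral_bound c s.
Proof.
move=> /(inf_lt (sb_neq0 c))[s' [s'0 [D hD]] lt]; split; first exact: lt_trans lt.
exists D => n; apply: le_trans (hD n) _; rewrite ler_wpM2l //.
  by apply: le_trans (q0 1) _; have := hD 0%N; rewrite !expr0 mulr1.
by apply: lerXn2r; rewrite ?nnegrE ?ltW // (lt_trans s'0).
Qed.

Lemma spectral_le_self c : spectral c <= C * q c.
Proof.
apply: le_of_gt => s lt; apply: spectral_le; apply: spectral_bound_self (ltW lt) _.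
by apply: le_lt_trans lt; rewrite mulr_ge0.
Qed.

Lemma spectral_bound_ge0 c s D : (forall n, q (c ^+ n) <= D * s ^+ n) -> 0 <= D.
Proof. by move=> /(_ 0%N); rewrite !expr0 mulr1 => /(le_trans (q0 _)). Qed.

(** Growth rates ignore constant factors, so [C] is absorbed in [D] and the result is
    submultiplicative with constant [1]. On [j b] the rate is [x b], since [x] is multiplicative. *)
Lemma spectral_adm : adm_seminorm 1 spectral.
Proof.
have [_ qM qj] := aq; split; first split.
- apply/eqP; rewrite eq_le spectral_ge0 andbT; apply: le_trans (spectral_le_self _) _.
  by rewrite (ultra0 uq) mulr0.
- move=> c; congr inf; apply/seteqP.
  have sub c' : spectral_bound c' `<=` spectral_bound (- c').
    move=> s [s0 [D hD]]; split=> //; exists D => n; rewrite exprNn.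
    by rewrite -signr_odd; case: odd; rewrite ?expr1 ?mulN1r ?(ultraN uq) ?expr0 ?mul1r.
  by split; [rewrite -{2}(opprK c)|]; apply: sub.
- move=> a b; apply: le_of_gt => s; rewrite gt_max => /andP[/spectral_lt[s0 [D hD]]].
  move=> /spectral_lt[_ [D' hD']].
  have D0 := spectral_bound_ge0 hD; have D'0 := spectral_bound_ge0 hD'.
  apply: spectral_le; split=> //; exists (C * (D * D')) => n; rewrite exprDn.
  have snz m : 0 <= s ^+ m by rewrite exprn_ge0 // ltW.
  apply: (ultra_sum uq) => [|i _]; first by rewrite !mulr_ge0.
  (* Integer multiples, here the binomial coefficients, do not increase an ultrametric seminorm. *)
  have qn (c : E) m M : 0 <= M -> q c <= M -> q (c *+ m) <= M.
    move=> M0 cM; elim: m => [|m IH]; first by rewrite mulr0n (ultra0 uq).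
    by rewrite mulrS; apply: (ultraD uq).
  have le_in : (i <= n)%N by rewrite -ltnS.
  apply: qn; first by rewrite !mulr_ge0.
  apply: le_trans (qM _ _) _; rewrite -mulrA ler_wpM2l //.
  have -> : D * D' * s ^+ n = D * s ^+ (n - i) * (D' * s ^+ i).
    by rewrite mulrACA -exprD subnK.
  exact: ler_pM.
- move=> a b; rewrite mul1r; apply: le_mul_of_gt; rewrite ?spectral_ge0 //.
  move=> s s' /spectral_lt[s0 [D hD]] /spectral_lt[s'0 [D' hD']].
  apply: spectral_le; split; first exact: mulr_gt0.
  exists (C * (D * D')) => n; rewrite !exprMn; apply: le_trans (qM _ _) _.
  by rewrite -mulrA ler_wpM2l // mulrACA; apply: ler_pM.
- move=> b; apply/eqP; rewrite eq_le; apply/andP; split.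
    apply: le_of_gt => s xs; have s0 : 0 < s by apply: le_lt_trans xs.
    apply: spectral_le; split=> //; exists 1 => n; rewrite mul1r -jX qj xX.
    by apply: lerXn2r; rewrite ?nnegrE // ltW.
  apply: lb_le_inf => // s [s0 [D hD]]; rewrite leNgt; apply/negP => sx.
  have D0 := spectral_bound_ge0 hD; have xb : 0 < x b by apply: lt_trans sx.
  have [|N /(_ N (leqnn N))] := @geo_small _ D (s / x b) 1 D0 _ ltr01.
    by rewrite divr_ge0 ?(ltW s0) //= ltr_pdivrMr // mul1r.
  rewrite expr_div_n mulrA ltr_pdivrMr ?exprn_gt0 // mul1r ltNge => /negP; apply.
  by rewrite -xX -qj jX.
Qed.
End Spectral.

(** Zorn's lemma for the reversed pointwise order. The pointwise infimum of a chain is admissible: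
    each inequality involves at most two members of the chain, and the smaller one serves for
    both. *)
Lemma minimal_seminorm q : adm_seminorm 1 q -> exists2 q', adm_seminorm 1 q' &
  (forall c, q' c <= q c) /\
  forall p, adm_seminorm 1 p -> (forall c, p c <= q' c) -> forall c, q' c <= p c.
Proof.
move=> aq; pose T := {q' | adm_seminorm 1 q' /\ forall c, q' c <= q c}.
have Tge0 (p : T) c : 0 <= sval p c by have [[up _ _] _] := svalP p; apply: (ultra_ge0 up).
have t0 : T by exists q.
have [||A Atot|t tmax] := @ZL_preorder T t0 (fun p p' : T => `[< forall c, sval p' c <= sval p c >]).
- by move=> p; apply/asboolP.
- by move=> p' p p'' /asboolP h /asboolP h'; apply/asboolP => c; apply: le_trans (h' c) (h c).
- have [A0|/set0P[p0 Ap0]] := eqVneq A set0.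
    by exists t0 => s; rewrite A0.
  pose V c : set R := [set sval p c | p in A].
  have Vne c : V c !=set0 by exists (sval p0 c), p0.
  have V0 c r : V c r -> 0 <= r by case=> p _ <-.
  pose m c := inf (V c).
  have mle c p : A p -> m c <= sval p c by move=> Ap; apply: inf_le_mem (V0 c) _; exists p.
  have mlt c r : m c < r -> exists2 p, A p & sval p c < r.
    by move=> /(inf_lt (Vne c))[_ [p Ap <-] lt]; exists p.
  have m0 c : 0 <= m c by apply: lb_le_inf => // r; apply: V0.
  have chain p p' : A p -> A p' -> exists2 p'', A p'' &
      (forall c, sval p'' c <= sval p c) /\ (forall c, sval p'' c <= sval p' c).
    move=> Ap Ap'; have [/asboolP h|/asboolP h] := Atot _ _ Ap Ap'; first by exists p'.
    by exists p.
  have am : adm_seminorm 1 m.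
    split; first split.
    + apply/eqP; rewrite eq_le m0 andbT; apply: le_trans (mle _ _ Ap0) _.
      by have [[up _ _] _] := svalP p0; rewrite (ultra0 up).
    + move=> c; congr inf; apply/seteqP; split=> r [p Ap <-]; exists p => //;
      by have [[up _ _] _] := svalP p; rewrite (ultraN up).
    + move=> a b; apply: le_of_gt => s; rewrite gt_max => /andP[/mlt[p Ap pa] /mlt[p' Ap' pb]].
      have [p'' Ap'' [h1 h2]] := chain _ _ Ap Ap'; apply: le_trans (mle _ _ Ap'') _.
      have [[up _ _] _] := svalP p''.
      by apply: (ultraD up); [apply: le_trans (h1 _) (ltW pa)|apply: le_trans (h2 _) (ltW pb)].
    + move=> a b; rewrite mul1r; apply: le_mul_of_gt => // s s' /mlt[p Ap pa] /mlt[p' Ap' pb].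
      have [p'' Ap'' [h1 h2]] := chain _ _ Ap Ap'; apply: le_trans (mle _ _ Ap'') _.
      have [[_ pM _] _] := svalP p''; apply: le_trans (pM _ _) _; rewrite mul1r.
      by apply: ler_pM => //; [apply: le_trans (h1 _) (ltW pa)|apply: le_trans (h2 _) (ltW pb)].
    + move=> b; apply/eqP; rewrite eq_le; apply/andP; split.
        by apply: le_trans (mle _ _ Ap0) _; have [[_ _ ->] _] := svalP p0.
      by apply: lb_le_inf => // _ [p Ap <-]; have [[_ _ ->] _] := svalP p.
  have mq c : m c <= q c by apply: le_trans (mle _ _ Ap0) _; have [_ h] := svalP p0; exact: h.
  exists (exist _ m (conj am mq)) => p Ap; apply/asboolP => c /=; exact: mle.
exists (sval t); first by have [] := svalP t.
split=> [|p ap pt c]; first by have [] := svalP t.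
have pq c' : p c' <= q c' by apply: le_trans (pt _) _; have [_ h] := svalP t; exact: h.
have /asboolP h := tmax (exist _ p (conj ap pq)) (introT (asboolP _) pt).
exact: h.
Qed.

Section Minimal.
Variable q : E -> R.
Hypotheses (aq : adm_seminorm 1 q)
  (qmin : forall p, adm_seminorm 1 p -> (forall c, p c <= q c) -> forall c, q c <= p c).

Let uq : ultra q. Proof. by case: aq. Qed.
Let q0 a : 0 <= q a. Proof. exact: (ultra_ge0 uq). Qed.
Let qj b : q (j b) = x b. Proof. by case: aq. Qed.
Let q1 : q 1 = 1. Proof. by rewrite -j1 qj x1. Qed.
Let qM a b : q (a * b) <= q a * q b.
Proof. by case: aq => _ + _ => /(_ a b); rewrite mul1r. Qed.
Let qXle a n : q (a ^+ n) <= q a ^+ n.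
Proof.
elim: n => [|n IH]; first by rewrite q1.
by rewrite !exprS; apply: le_trans (qM _ _) _; rewrite ler_wpM2l.
Qed.

(** Otherwise [spectral q] would be an admissible seminorm below [q], strictly so at [a]. *)
Lemma minimal_sqr a : q (a ^+ 2) = q a ^+ 2.
Proof.
apply/eqP; rewrite eq_le qXle leNgt /=; apply/negP => lt.
have qa : 0 < q a.
  by rewrite lt_def q0 andbT; apply: contraTneq lt => ->; rewrite expr0n /= ltNge q0.
pose w := q (a ^+ 2) / q a ^+ 2.
have w1 : w < 1 by rewrite ltr_pdivrMr ?exprn_gt0 // mul1r.
have w0 : 0 <= w by rewrite divr_ge0 // exprn_ge0 // ltW.
(* A number below [q a] and at least the square root of [q (a ^+ 2)]: the arithmetic mean of [1] and
   [w] bounds their geometric mean. *)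
pose s := q a * ((1 + w) / 2).
have s0 : 0 < s by rewrite mulr_gt0 //; lra.
have sq : s < q a by rewrite gtr_pMr //; lra.
have s2 : q (a ^+ 2) <= s ^+ 2.
  have -> : q (a ^+ 2) = q a ^+ 2 * w by rewrite mulrC divfK // gt_eqF // exprn_gt0.
  rewrite exprMn ler_wpM2l ?exprn_ge0 ?(ltW qa) // expr2; nra.
suff : spectral_bound q a s.
  move=> /spectral_le h; have := qmin (spectral_adm (lexx 1) aq).
  have le c : spectral q c <= q c by have := spectral_le_self (lexx 1) aq c; rewrite mul1r.
  by move=> /(_ le a); rewrite leNgt (le_lt_trans h).
(* The factor [q a / s] pays for the single [a] left over when an odd power is grouped into
   squares. *)
split=> //; exists (q a / s) => n; rewrite -{1}(odd_double_half n).
rewrite -muln2 mulnC exprD exprM.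
have qs : 1 <= q a / s by rewrite ler_pdivlMr // mul1r ltW.
apply: le_trans (qM _ _) _.
have -> : s ^+ n = s ^+ odd n * (s ^+ 2) ^+ n./2.
  by rewrite -exprM -exprD mulnC muln2 odd_double_half.
rewrite mulrA; apply: ler_pM => //.
  case: odd; rewrite ?expr1 ?expr0 ?q1 ?mulr1 //.
  by rewrite divfK // gt_eqF.
apply: le_trans (qXle _ _) _; apply: lerXn2r; rewrite ?nnegrE // exprn_ge0 //.
exact: ltW.
Qed.

(** Squaring gives the exponents [2 ^ n]; a general exponent follows by splitting [a ^+ (2 ^ n)] as
    [a ^+ n] times the rest and cancelling. *)
Lemma minimal_exp a n : q (a ^+ n) = q a ^+ n.
Proof.
have pow2 m : q (a ^+ (2 ^ m)) = q a ^+ (2 ^ m).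
  by elim: m => [|m IH]; rewrite ?expr1 // expnS mulnC !exprM minimal_sqr IH.
have [qa|qa] := eqVneq (q a) 0.
  case: n => [|n]; first by rewrite q1.
  by apply/eqP; rewrite eq_le qXle /= qa expr0n /=.
have {}qa : 0 < q a by rewrite lt_def qa q0.
apply/eqP; rewrite eq_le qXle /= -(ler_pM2r (exprn_gt0 (2 ^ n - n) qa)).
have nn : (n <= 2 ^ n)%N by apply/ltnW/ltn_expl.
rewrite -exprD subnKC // -pow2 -{1}(subnKC nn) exprD.
by apply: le_trans (qM _ _) _; rewrite ler_wpM2l.
Qed.

(** The infimum over [n] of [q (a ^+ n * c) / q a ^+ n] is again an admissible seminorm below [q],
    the second hypothesis making it extend [x]; by minimality it is [q]. It is applied first to [a]
    in the image of [j], and the resulting formula provides that hypothesis for general [a]. *)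
Lemma minimal_regular a : 0 < q a -> (forall n b, q (a ^+ n * j b) = q a ^+ n * x b) ->
  forall c, q a * q c <= q (a * c).
Proof.
move=> qa aj c; pose V c : set R := [set q (a ^+ n * c) / q a ^+ n | n in [set: nat]].
have an0 n : 0 < q a ^+ n by apply: exprn_gt0.
have V0 c' r : V c' r -> 0 <= r by case=> n _ <-; rewrite divr_ge0 // ltW.
have Vne c' : V c' !=set0 by exists (q (a ^+ 0 * c') / q a ^+ 0), 0%N.
pose p c := inf (V c).
have p0 c' : 0 <= p c' by apply: lb_le_inf => // r; apply: V0.
have ple c' n : p c' <= q (a ^+ n * c') / q a ^+ n by apply: inf_le_mem (V0 c') _; exists n.
have plt c' r : p c' < r -> exists n, forall m, (n <= m)%N -> q (a ^+ m * c') <= r * q a ^+ m.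
  move=> /(inf_lt (Vne c'))[_ [n _ <-]]; rewrite ltr_pdivrMr // => lt; exists n => m nm.
  rewrite -(subnK nm) !exprD -mulrA [leRHS]mulrCA; apply: le_trans (qM _ _) _.
  by apply: ler_pM => //; apply: ltW.
have pq c' : p c' <= q c' by have := ple c' 0%N; rewrite !expr0 mul1r divr1.
have ap : adm_seminorm 1 p.
  split; first split.
  + apply/eqP; rewrite eq_le p0 andbT; apply: le_trans (pq _) _.
    by rewrite (ultra0 uq).
  + by move=> c'; congr inf; apply/seteqP; split=> r [n _ <-]; exists n => //;
      rewrite mulrN (ultraN uq).
  + move=> b c'; apply: le_of_gt => s; rewrite gt_max => /andP[/plt[n hn] /plt[n' hn']].
    apply: le_trans (ple _ (maxn n n')) _; rewrite ler_pdivrMr // mulrDr.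
    by apply: (ultraD uq); [apply: hn|apply: hn']; rewrite ?leq_maxl ?leq_maxr.
  + move=> b c'; rewrite mul1r; apply: le_mul_of_gt => // s s' /plt[n hn] /plt[n' hn'].
    apply: le_trans (ple _ (n + n')%N) _; rewrite ler_pdivrMr // !exprD mulrACA.
    by rewrite [leRHS]mulrACA; apply: le_trans (qM _ _) _; apply: ler_pM => //; [apply: hn|apply: hn'].
  + move=> b; apply/eqP; rewrite eq_le -{1}qj pq /=.
    by apply: lb_le_inf => // _ [n _ <-]; rewrite aj mulrC mulKf // gt_eqF.
have := le_trans (qmin ap pq c) (ple c 1%N).
by rewrite !expr1 ler_pdivlMr // mulrC.
Qed.

Lemma minimal_base b c : q (j b * c) = x b * q c.
Proof.
apply/eqP; rewrite eq_le -{1}qj qM /=.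
have [->|xb] := eqVneq (x b) 0; first by rewrite mul0r.
rewrite -qj; apply: minimal_regular; first by rewrite qj lt_def xb x0.
by move=> n b'; rewrite -jX -jM !qj xM xX.
Qed.

Lemma minimal_multiplicative a b : q (a * b) = q a * q b.
Proof.
apply/eqP; rewrite eq_le qM /=.
have [->|qa] := eqVneq (q a) 0; first by rewrite mul0r.
apply: minimal_regular; first by rewrite lt_def qa q0.
by move=> n b'; rewrite mulrC minimal_base minimal_exp mulrC.
Qed.
End Minimal.

Theorem extend_seminorm C q : 1 <= C -> adm_seminorm C q -> exists y : E -> R,
  [/\ ultra y, forall a b, y (a * b) = y a * y b, forall b, y (j b) = x b &
      forall c, y c <= C * q c].
Proof.
move=> C1 aq; have [y ay [yle ymin]] := minimal_seminorm (spectral_adm C1 aq).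
exists y; split; [by case: ay|exact: minimal_multiplicative|by case: ay|].
by move=> c; apply: le_trans (yle c) (spectral_le_self C1 aq c).
Qed.
End ExtendSeminorm.

(** * Finite extensions *)

Section FiniteExtension.
Variables (R : realType) (k K : nafield R) (io : aext k K).

Definition kspan n (b : 'I_n -> K) := forall z, exists c : 'I_n -> k, z = \sum_i io (c i) * b i.
Definition kfree n (b : 'I_n -> K) := forall c : 'I_n -> k,
  \sum_i io (c i) * b i = 0 -> forall i, c i = 0.

Lemma kspan_drop n (b : 'I_n.+1 -> K) i (c : 'I_n.+1 -> k) : kspan b ->
  \sum_j io (c j) * b j = 0 -> c i != 0 -> kspan (fun j => b (lift i j)).
Proof.
move=> sb; have big_lift (F : 'I_n.+1 -> K) : \sum_j F j = F i + \sum_j F (lift i j).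
  rewrite (bigD1 i) //=; congr (_ + _).
  rewrite (reindex_omap (lift i) (unlift i)) /=.
    by apply: eq_bigl => j; rewrite eq_sym neq_lift liftK eqxx.
  by move=> j; rewrite eq_sym => /unlift_some[j' -> ->].
rewrite big_lift => c0 ci z; have [a za] := sb z.
have bi : b i = - \sum_j io (c (lift i j) / c i) * b (lift i j).
  have ic : io (c i) != 0 by rewrite fmorph_eq0.
  apply: (mulfI ic); move/eqP: c0; rewrite addr_eq0 => /eqP ->.
  rewrite mulrN mulr_sumr; congr (- _); apply: eq_bigr => j _.
  by rewrite mulrA -rmorphM [c i * _]mulrC divfK.
exists (fun j => a (lift i j) - a i * (c (lift i j) / c i)).
rewrite za big_lift bi mulrN mulr_sumr addrC -sumrB; apply: eq_bigr => j _.
by rewrite rmorphB mulrBl [io (a i * _)]rmorphM mulrA.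
Qed.

Lemma kbasis n (b : 'I_n -> K) : kspan b -> exists m (e : 'I_m -> K), kspan e /\ kfree e.
Proof.
elim: n b => [|n IH] b sb; first by exists 0%N, b; split=> // c _ [].
have [fb|nfb] := pselect (kfree b); first by exists n.+1, b.
suff [i [c [c0 ci]]] : exists i, exists c : 'I_n.+1 -> k,
    \sum_j io (c j) * b j = 0 /\ c i != 0 by apply: IH (kspan_drop sb c0 ci).
apply: contrapT => h; apply: nfb => c c0 i; apply/eqP/negPn/negP => ci.
by apply: h; exists i, c.
Qed.

(** Equivalence of norms in finite dimension, by induction. The last vector stays at a distance
    [de > 0] from the span of the others: otherwise the induction bound makes the coordinates of the
    approximations Cauchy, and their limit is a nontrivial relation. *)
Lemma kfree_bound n (e : 'I_n -> K) : kfree e -> exists2 C, 0 <= C &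
  forall (c : 'I_n -> k) i, nabs (c i) <= C * nabs (\sum_i io (c i) * e i).
Proof.
have uk := nabs_ultra k; have uK := nabs_ultra K.
elim: n e => [|n IH] e fe; first by exists 0 => // c [].
pose e' i := e (widen_ord (leqnSn n) i); pose ed := e ord_max.
have [|C' C'0 hC'] := IH e'.
  move=> c c0 i; pose c1 (j : 'I_n.+1) := if unlift ord_max j is Some j' then c j' else 0.
  have c1w j : c1 (widen_ord (leqnSn n) j) = c j.
    rewrite /c1 (_ : widen_ord _ j = lift ord_max j) ?liftK //.
    by apply: val_inj; rewrite /= /bump leqNgt ltn_ord.
  rewrite -c1w; apply: fe; rewrite big_ord_recr /= /c1 unlift_none rmorph0 mul0r addr0.
  by rewrite -[RHS]c0; apply: eq_bigr => j _; rewrite -/(c1 _) c1w.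
have [de [de0 hde]] : exists de, 0 < de /\
    forall c : 'I_n -> k, de <= nabs (\sum_i io (c i) * e' i + ed).
  apply: contrapT => h.
  have {h} /choice[c hc] m : exists c : 'I_n -> k,
      nabs (\sum_i io (c i) * e' i + ed) < 2^-1 ^+ m.
    apply: contrapT => h'; apply: h; exists (2^-1 ^+ m).
    split=> [|c]; first by rewrite exprn_gt0 // invr_gt0.
    by rewrite leNgt; apply/negP => lt; apply: h'; exists c.
  have cc m m' i : nabs (c m i - c m' i) <= C' * Num.max (2^-1 ^+ m) (2^-1 ^+ m').
    apply: le_trans (hC' (fun i => c m i - c m' i) i) _; rewrite ler_wpM2l //.
    have -> : \sum_i io (c m i - c m' i) * e' i =
        (\sum_i io (c m i) * e' i + ed) - (\sum_i io (c m' i) * e' i + ed).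
      rewrite opprD addrACA subrr addr0 -sumrB.
      by apply: eq_bigr => j _; rewrite rmorphB mulrBl.
    by apply: (ultraB uK); rewrite le_max (ltW (hc _)) ?orbT.
  have halfle m m' : (m <= m')%N -> 2^-1 ^+ m' <= 2^-1 ^+ m :> R.
    by move=> mm; rewrite ler_wiXn2l // ?invr_ge0 // invf_le1 // ler1n.
  have [l hl] : {l : 'I_n -> k & forall i eps, 0 < eps -> exists N, forall m, (N <= m)%N ->
      nabs (c m i - l i) < eps}.
    apply: (@choice _ _ (fun i l => forall eps, 0 < eps -> exists N, forall m, (N <= m)%N ->
      nabs (c m i - l) < eps)) => i; apply: nabs_complete => eps eps0.
    have [N hN] := half_small C'0 eps0; exists N => m m' Nm Nm'.
    apply: le_lt_trans (cc m m' i) (le_lt_trans _ (hN N (leqnn N))).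
    by rewrite ler_wpM2l // ge_max !halfle.
  pose c1 (j : 'I_n.+1) := if unlift ord_max j is Some j' then l j' else 1.
  have c1w j : c1 (widen_ord (leqnSn n) j) = l j.
    rewrite /c1 (_ : widen_ord _ j = lift ord_max j) ?liftK //.
    by apply: val_inj; rewrite /= /bump leqNgt ltn_ord.
  have c1d : c1 ord_max = 1 by rewrite /c1 unlift_none.
  suff z0 : \sum_i io (c1 i) * e i = 0.
    by have := fe c1 z0 ord_max; rewrite c1d => /eqP; rewrite oner_eq0.
  rewrite big_ord_recr /= c1d rmorph1 mul1r -/ed.
  under eq_bigr do rewrite c1w -/(e' _).
  apply/nabs_eq0/eqP; rewrite eq_le nabs_ge0 andbT; apply: le_of_gt => eps eps0.
  pose E := \sum_i nabs (e' i) + 1.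
  have eE i : nabs (e' i) <= E.
    by rewrite /E (bigD1 i) //= -addrA lerDl addr_ge0 // sumr_ge0 // => *; apply: nabs_ge0.
  have E0 : 0 < E by rewrite ltr_wpDl // sumr_ge0 // => *; apply: nabs_ge0.
  have [N1 hN1] := half_small ler01 eps0.
  have /choice[N2 hN2] i := hl i _ (divr_gt0 eps0 E0).
  pose m := maxn N1 (\max_i N2 i).
  have -> : \sum_i io (l i) * e' i + ed =
     (\sum_i io (c m i) * e' i + ed) - \sum_i io (c m i - l i) * e' i.
    rewrite addrAC -sumrB; congr (_ + _); apply: eq_bigr => i _.
    by rewrite rmorphB mulrBl opprB addrCA subrr addr0.
  apply: (ultraB uK).
    apply: ltW; apply: lt_trans (hc m) _.
    by have := hN1 m (leq_maxl _ _); rewrite mul1r.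
  apply: (ultra_sum uK) => [|i _]; first exact: ltW.
  rewrite nabsM aext_isom -(divfK (lt0r_neq0 E0) eps).
  apply: ler_pM; rewrite ?nabs_ge0 //; apply/ltW/hN2.
  by apply: leq_trans (leq_maxr _ _); apply: leq_bigmax.
(* The term [de^-1] bounds the last coordinate; subtracting its contribution, the induction bound
   gives the rest for the others. *)
pose D := de^-1 + C' * (1 + nabs ed / de).
have ed0 : 0 <= nabs ed / de by rewrite divr_ge0 ?nabs_ge0 // ltW.
have di0 : 0 <= de^-1 by rewrite invr_ge0 ltW.
exists D; first by rewrite addr_ge0 // mulr_ge0 // addr_ge0.
move=> c; set z := \sum_(i < n.+1) _.
have zE : z = \sum_i io (c (widen_ord (leqnSn n) i)) * e' i + io (c ord_max) * ed.
  by rewrite /z big_ord_recr.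
have cd : nabs (c ord_max) <= de^-1 * nabs z.
  have [->|cd0] := eqVneq (c ord_max) 0; first by rewrite nabs0 mulr_ge0 ?nabs_ge0.
  have := hde (fun i => c (widen_ord (leqnSn n) i) / c ord_max).
  have -> : \sum_i io (c (widen_ord (leqnSn n) i) / c ord_max) * e' i + ed = z / io (c ord_max).
    rewrite zE mulrDl mulr_suml mulrAC divff ?fmorph_eq0 // mul1r; congr (_ + _).
    by apply: eq_bigr => i _; rewrite rmorphM fmorphV mulrAC.
  rewrite nabsM nabsV aext_isom ler_pdivlMr ?nabs_gt0 // => h.
  by rewrite mulrC ler_pdivlMr // mulrC.
have cn i : nabs (c (widen_ord (leqnSn n) i)) <= C' * (1 + nabs ed / de) * nabs z.
  apply: le_trans (hC' (fun i => c (widen_ord (leqnSn n) i)) i) _.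
  rewrite -mulrA ler_wpM2l //.
  have -> : \sum_i io (c (widen_ord (leqnSn n) i)) * e' i = z - io (c ord_max) * ed.
    by rewrite zE addrK.
  apply: (ultraB uK); rewrite mulrDl mul1r; first by rewrite lerDl mulr_ge0 ?nabs_ge0.
  apply: (@le_trans _ _ (nabs ed / de * nabs z)); last by rewrite lerDr nabs_ge0.
  by rewrite nabsM aext_isom mulrC -mulrA ler_wpM2l ?nabs_ge0.
move=> i; case: (unliftP ord_max i) => [j ->|->].
  rewrite (_ : lift ord_max j = widen_ord (leqnSn n) j); last first.
    by apply: val_inj; rewrite /= /bump leqNgt ltn_ord.
  by apply: le_trans (cn j) _; rewrite ler_wpM2r ?nabs_ge0 // lerDr.
by apply: le_trans cd _; rewrite ler_wpM2r ?nabs_ge0 // lerDl mulr_ge0 // addr_ge0.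
Qed.

Definition coordinates d (e : 'I_d -> K) (cK : K -> 'I_d -> k) :=
  (forall z, z = \sum_i io (cK z i) * e i) /\
  forall c c' : 'I_d -> k, \sum_i io (c i) * e i = \sum_i io (c' i) * e i -> c =1 c'.

Lemma finite_coordinates n (b : 'I_n -> K) : kspan b ->
  exists d (e : 'I_d -> K) (cK : K -> 'I_d -> k) (C : R),
  [/\ coordinates e cK, 0 <= C & forall z i, nabs (cK z i) <= C * nabs z].
Proof.
move=> /kbasis[d [e [/choice[cK se] fe]]]; have [C C0 hC] := kfree_bound fe.
exists d, e, cK, C; split=> // [|z i]; last by rewrite {2}(se z).
split=> // c c' cc i; apply/eqP; rewrite -subr_eq0; apply/eqP.
apply: (fe (fun i => c i - c' i)); under eq_bigr do rewrite rmorphB mulrBl.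
by rewrite sumrB cc subrr.
Qed.
End FiniteExtension.

(** * Scalar extension *)

Section SupNorm.
Variables (R : realType) (V : zmodType) (I : Type) (D : I -> Prop) (T : I -> V -> V).
Variables (w : I -> R) (q : V -> R) (M : R) (i0 : I).
Hypotheses (Di0 : D i0) (TB : forall i x y, T i (x - y) = T i x - T i y).
Hypotheses (w0 : forall i, D i -> 0 < w i) (uq : ultra q).
Hypothesis qT : forall i a, D i -> q (T i a) <= M * q a * w i.

(** An operator norm for the family [T]. It is used with scalars acting, weighted by their absolute
    value, and with elements acting by multiplication, weighted by a norm; the constant [M] keeps
    the supremum finite. *)
Definition sup_norm (a : V) : R := sup [set q (T i a) / w i | i in D].

Lemma sup_norm_ge a i : D i -> q (T i a) <= sup_norm a * w i.
Proof.
move=> Di; rewrite -ler_pdivrMr ?w0 //; apply: sup_ubound; last by exists i.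
by exists (M * q a) => _ [i' Di' <-]; rewrite ler_pdivrMr ?w0 // qT.
Qed.

Lemma sup_norm_le a r : (forall i, D i -> q (T i a) <= r * w i) -> sup_norm a <= r.
Proof.
move=> h; apply: ge_sup; first by exists (q (T i0 a) / w i0), i0.
by move=> _ [i Di <-]; rewrite ler_pdivrMr ?w0 // h.
Qed.

Lemma sup_norm_ge0 a : 0 <= sup_norm a.
Proof.
rewrite -(pmulr_lge0 _ (w0 Di0)); apply: le_trans (sup_norm_ge a Di0).
exact: (ultra_ge0 uq).
Qed.

Lemma sup_norm_le_self a : sup_norm a <= M * q a.
Proof. by apply: sup_norm_le => i; apply: qT. Qed.

Lemma sup_norm_ultra : ultra sup_norm.
Proof.
have T0 i : T i 0 = 0 by have := TB i 0 0; rewrite subr0 subrr.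
have TN i x : T i (- x) = - T i x by have := TB i 0 x; rewrite !sub0r T0 sub0r.
have TD i x y : T i (x + y) = T i x + T i y by rewrite -[in LHS](opprK y) TB TN opprK.
split.
- apply/eqP; rewrite eq_le sup_norm_ge0 andbT; apply: sup_norm_le => i _.
  by rewrite T0 (ultra0 uq) mul0r.
- by move=> a; rewrite /sup_norm; congr sup; apply/seteqP; split=> _ [i Di <-]; exists i => //;
    rewrite TN (ultraN uq).
- move=> a b; apply: sup_norm_le => i Di; rewrite TD; apply: (ultraD uq).
    by apply: le_trans (sup_norm_ge _ Di) _; rewrite ler_wpM2r ?le_max ?lexx // ltW // w0.
  by apply: le_trans (sup_norm_ge _ Di) _; rewrite ler_wpM2r ?le_max ?lexx ?orbT // ltW // w0.
Qed.
End SupNorm.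

Section ScalarExtension.
Variables (R : realType) (k K : nafield R) (io : aext k K).
Variables (d : nat) (e : 'I_d -> K) (cK : K -> 'I_d -> k).
Hypothesis hc : coordinates io e cK.
Variable B : banalg k.

Lemma coord_uniq z c : \sum_i io (c i) * e i = z -> c =1 cK z.
Proof. by have [h1 h2] := hc; move=> h; apply: h2; rewrite h. Qed.

Lemma coordD z w l : cK (z + w) l = cK z l + cK w l.
Proof.
apply/esym/(@coord_uniq _ (fun l => cK z l + cK w l)).
under eq_bigr do rewrite rmorphD mulrDl.
by rewrite big_split /= -!hc.1.
Qed.

Lemma coord_mul z w n : cK (z * w) n = \sum_l cK z l * cK (e l * w) n.
Proof.
apply/esym/(@coord_uniq _ (fun n => \sum_l cK z l * cK (e l * w) n)).
rewrite [in RHS](hc.1 z) mulr_suml.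
under eq_bigr do rewrite rmorph_sum mulr_suml.
rewrite exchange_big; apply: eq_bigr => l _ /=.
rewrite -mulrA [in RHS](hc.1 (e l * w)) mulr_sumr; apply: eq_bigr => i _.
by rewrite rmorphM mulrA.
Qed.

Lemma coord_mulr z w n : cK (z * w) n = \sum_l cK w l * cK (z * e l) n.
Proof. by rewrite mulrC coord_mul; apply: eq_bigr => l _; rewrite [e l * z]mulrC. Qed.

Lemma coord_scale c z n : cK (io c * z) n = c * cK z n.
Proof.
apply/esym/(@coord_uniq _ (fun n => c * cK z n)).
under eq_bigr do rewrite rmorphM -mulrA.
by rewrite -mulr_sumr -hc.1.
Qed.

Lemma coord_e i n : cK (e i) n = (i == n)%:R.
Proof.
apply/esym/(@coord_uniq _ (fun n => (i == n)%:R)).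
rewrite (bigD1 i) //= eqxx rmorph1 mul1r big1 ?addr0 // => j /negPf ji.
by rewrite eq_sym ji rmorph0 mul0r.
Qed.

Local Notation str := (ba_str B).
Local Notation S i j n := (str (cK (e i * e j) n)).

(* The algebra [K (x)_k B], in the basis [e]; the unused argument determines the ring
   structure. *)
Definition scalar_ext (_ : coordinates io e cK) (B : banalg k) : Type := 'rV[B]_d.
Local Notation E := (scalar_ext hc B).
HB.instance Definition _ := GRing.Zmodule.copy E 'rV[B]_d.

Definition se_mul (a b : E) : E :=
  \row_n \sum_i \sum_j (a : 'rV_d) 0 i * (b : 'rV_d) 0 j * S i j n.
Definition se_str (z : K) : E := \row_n str (cK z n).

Lemma se_mulC : commutative se_mul.
Proof.
move=> a b; apply/rowP => n; rewrite !mxE exchange_big; apply: eq_bigr => i _.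
by apply: eq_bigr => j _; rewrite [e j * e i]mulrC [a _ _ * _]mulrC.
Qed.

Lemma se_mul_str z (a : E) n :
  se_mul (se_str z) a 0 n = \sum_j (a : 'rV_d) 0 j * str (cK (z * e j) n).
Proof.
rewrite mxE exchange_big; apply: eq_bigr => j _ /=.
rewrite coord_mul rmorph_sum mulr_sumr; apply: eq_bigr => i _.
by rewrite mxE rmorphM mulrCA mulrA.
Qed.

Lemma se_mul1 : left_id (se_str 1) se_mul.
Proof.
move=> a; apply/rowP => n; rewrite se_mul_str (bigD1 n) //= mul1r coord_e eqxx rmorph1 mulr1.
by rewrite big1 ?addr0 // => j /negPf jn; rewrite mul1r coord_e jn rmorph0 mulr0.
Qed.

Lemma se_mulDl : left_distributive se_mul +%R.
Proof.
move=> a b c; apply/rowP => n; rewrite !mxE -big_split; apply: eq_bigr => i _ /=.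
by rewrite -big_split; apply: eq_bigr => j _ /=; rewrite !mxE !mulrDl.
Qed.

(** One expansion of [(a b) c] as a triple sum suffices: commutativity reduces the other bracketing
    to it. *)
Lemma se_mulA : associative se_mul.
Proof.
have left (a b c : E) n : se_mul (se_mul a b) c 0 n =
    \sum_i \sum_j \sum_m (a : 'rV_d) 0 i * (b : 'rV_d) 0 j * (c : 'rV_d) 0 m *
      str (cK (e i * e j * e m) n).
  rewrite mxE exchange_big /=.
  transitivity (\sum_m \sum_i \sum_j (a : 'rV_d) 0 i * (b : 'rV_d) 0 j * (c : 'rV_d) 0 m *
      str (cK (e i * e j * e m) n)); last first.
    by rewrite exchange_big; apply: eq_bigr => i _; rewrite exchange_big.
  apply: eq_bigr => m _ /=.
  under eq_bigr do rewrite mxE !mulr_suml.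
  rewrite exchange_big; apply: eq_bigr => i _ /=.
  under eq_bigr do rewrite !mulr_suml.
  rewrite exchange_big; apply: eq_bigr => j _ /=.
  rewrite coord_mul rmorph_sum mulr_sumr; apply: eq_bigr => l _.
  by rewrite rmorphM -!mulrA; do 2 congr (_ * _); rewrite mulrCA.
move=> a b c; rewrite [LHS]se_mulC; apply/rowP => n; rewrite !left.
under eq_bigr do rewrite exchange_big.
rewrite exchange_big; apply: eq_bigr => i _ /=; apply: eq_bigr => j _; apply: eq_bigr => m _.
have -> : e j * e m * e i = e i * e j * e m by rewrite mulrC mulrA.
by congr (_ * _); rewrite mulrC mulrA.
Qed.

HB.instance Definition _ := GRing.Zmodule_isComPzRing.Build E se_mulA se_mulC se_mul1 se_mulDl.

Lemma se_str_zmod : zmod_morphism se_str.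
Proof.
move=> z w; apply/rowP => n; rewrite !mxE -rmorphB; congr (str _).
by apply/eqP; rewrite eq_sym subr_eq -coordD subrK.
Qed.
Lemma se_str_monoid : monoid_morphism se_str.
Proof.
split=> // z w; apply/rowP => n; rewrite se_mul_str mxE coord_mulr rmorph_sum.
by apply: eq_bigr => j _; rewrite mxE rmorphM.
Qed.
HB.instance Definition _ := GRing.isZmodMorphism.Build K E se_str se_str_zmod.
HB.instance Definition _ := GRing.isMonoidMorphism.Build K E se_str se_str_monoid.
Definition se_str_map : {rmorphism K -> E} := se_str.

Definition rowmax (q : B -> R) (a : E) : R := \big[Num.max/0]_i q ((a : 'rV_d) 0 i).

Section RowMax.
Variable q : B -> R.
Hypotheses (uq : ultra q) (qM : forall a b, q (a * b) <= q a * q b)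
  (qstr : forall c, q (str c) <= nabs c).
Variable C : R.
Hypotheses (C0 : 0 <= C) (hC : forall z i, nabs (cK z i) <= C * nabs z).

Lemma rowmax_ge a i : q ((a : 'rV_d) 0 i) <= rowmax q a.
Proof. exact: le_bigmax. Qed.

Lemma rowmax_le a r : 0 <= r -> (forall i, q ((a : 'rV_d) 0 i) <= r) -> rowmax q a <= r.
Proof. by move=> r0 h; apply: bigmax_le. Qed.

Lemma rowmax_ge0 a : 0 <= rowmax q a.
Proof. exact: bigmax_ge_id. Qed.

Lemma rowmax_ultra : ultra (rowmax q).
Proof.
split.
- apply/eqP; rewrite eq_le rowmax_ge0 andbT; apply: rowmax_le => // i.
  by rewrite mxE (ultra0 uq).
- by move=> a; apply: eq_bigr => i _; rewrite mxE (ultraN uq).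
- move=> a b; apply: rowmax_le => [|i]; first by rewrite le_max rowmax_ge0.
  by rewrite mxE; apply: (ultraD uq); rewrite le_max rowmax_ge ?orbT.
Qed.

(** The sum of the [nabs (e i)], squared, bounds every [e i * e j], and [C] passes to the structure
    constants, the coordinates of these products. *)
Definition se_const : R := C * (\sum_i nabs (e i)) ^+ 2.
Lemma se_const_ge0 : 0 <= se_const.
Proof. by rewrite mulr_ge0 // exprn_ge0 // sumr_ge0 // => i _; apply: nabs_ge0. Qed.

Lemma rowmaxM a b : rowmax q (a * b) <= se_const * (rowmax q a * rowmax q b).
Proof.
have le_e i : nabs (e i) <= \sum_j nabs (e j).
  by rewrite (bigD1 i) //= lerDl sumr_ge0 // => j _; apply: nabs_ge0.
have r0 : 0 <= se_const * (rowmax q a * rowmax q b).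
  by apply: mulr_ge0; [exact: se_const_ge0|apply: mulr_ge0; exact: rowmax_ge0].
have q0 := ultra_ge0 uq.
apply: rowmax_le => // n; rewrite mxE.
apply: (ultra_sum uq) => // i _; apply: (ultra_sum uq) => // j _.
apply: le_trans (qM _ _) _; rewrite mulrC; apply: ler_pM => //.
  apply: le_trans (qstr _) _; apply: le_trans (hC _ _) _.
  by rewrite nabsM ler_wpM2l // expr2 ler_pM ?nabs_ge0.
apply: le_trans (qM _ _) _; apply: ler_pM => //; exact: rowmax_ge.
Qed.

Lemma rowmax_str z : rowmax q (se_str z) <= C * nabs z.
Proof.
apply: rowmax_le => [|i]; first by rewrite mulr_ge0 ?nabs_ge0.
by rewrite mxE; apply: le_trans (qstr _) (hC _ _).
Qed.
End RowMax.

Section Norm.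
Variable C : R.
Hypotheses (C0 : 0 <= C) (hC : forall z i, nabs (cK z i) <= C * nabs z).
Hypothesis B1 : (1 : B) != 0.

Let uB := bnorm_ultra B.
Let p0 := rowmax (@bnorm R k B).
Let up0 : ultra p0 := rowmax_ultra uB.
Let M0 := se_const C.
Let M00 : 0 <= M0 := se_const_ge0 C0.
Let p0M a b : p0 (a * b) <= M0 * (p0 a * p0 b).
Proof. by apply: rowmaxM => //; [exact: bnormM|exact: bnorm_str]. Qed.
Let p0_ge0 a : 0 <= p0 a := ultra_ge0 up0 a.

Lemma se_rowmax_eq0 a : p0 a <= 0 -> a = 0.
Proof.
move=> h; apply/rowP => i; rewrite mxE; apply/bnorm_eq0/eqP; rewrite eq_le bnorm_ge0 andbT.
exact: le_trans (rowmax_ge _ a i) h.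
Qed.

Let str_inj c : str c = 0 -> c = 0.
Proof.
move=> c0; have := bnormZ c (1 : B); rewrite c0 mul0r bnorm0 => /esym/eqP.
rewrite mulf_eq0 => /orP[/eqP/nabs_eq0 //|/eqP/bnorm_eq0 h].
by move/eqP: B1.
Qed.

Lemma se_oner_neq0 : (1 : E) != 0.
Proof.
apply/eqP => h; have := oner_neq0 K; rewrite [1](hc.1 1) big1 ?eqxx // => i _.
have : (1 : E) 0 i = (0 : E) 0 i by rewrite h.
by rewrite !mxE => /str_inj ->; rewrite rmorph0 mul0r.
Qed.

Let nz (z : K) : Prop := z != 0.
Let nz1 : nz 1 := oner_neq0 K.
Let nzE (b : E) : Prop := b != 0.
Let nzE1 : nzE 1 := se_oner_neq0.
(* The first supremum makes the norm homogeneous over [K], the second one makes it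
   submultiplicative with [1] of norm at most [1]. *)
Let p1 := sup_norm nz (fun z a => se_str_map z * a) (@nabs R K) p0.
Let T1B z (x y : E) : se_str_map z * (x - y) = se_str_map z * x - se_str_map z * y.
Proof. exact: mulrBr. Qed.
Let w1 (z : K) : nz z -> 0 < nabs z := @nabs_gt0 R K z.
Let h1 z a : nz z -> p0 (se_str_map z * a) <= (M0 * C) * p0 a * nabs z.
Proof.
move=> _; apply: le_trans (p0M _ _) _.
rewrite [leRHS](_ : _ = M0 * (C * nabs z * p0 a)); last by ring.
rewrite ler_wpM2l // ler_wpM2r //; apply: rowmax_str => //; exact: bnorm_str.
Qed.
Let up1 : ultra p1 := sup_norm_ultra nz1 T1B w1 up0 h1.
Let p1_ge0 a : 0 <= p1 a := ultra_ge0 up1 a.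
Let p01 a : p0 a <= p1 a.
Proof.
by have := sup_norm_ge w1 h1 a nz1; rewrite rmorph1 mul1r nabs1 mulr1.
Qed.
Let p10 a : p1 a <= M0 * C * p0 a.
Proof. exact: (sup_norm_le_self nz1 w1 h1). Qed.
Let p1M a b : p1 (a * b) <= M0 * (p1 a * p1 b).
Proof.
apply: (sup_norm_le nz1 w1) => z z0; rewrite [X in p0 X](mulrA (se_str_map z) a b).
apply: le_trans (p0M _ _) _.
rewrite [leRHS](_ : _ = M0 * (p1 a * nabs z * p1 b)); last by ring.
rewrite ler_wpM2l //; apply: ler_pM; [exact: p0_ge0|exact: p0_ge0|exact: (sup_norm_ge w1 h1 a z0)|exact: p01].
Qed.
Let p1Z z a : p1 (se_str_map z * a) <= nabs z * p1 a.
Proof.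
have [->|z0] := eqVneq z 0.
  by rewrite rmorph0 mul0r (ultra0 up1) nabs0 mul0r.
apply: (sup_norm_le nz1 w1) => w w0.
rewrite [X in p0 X](mulrA (se_str_map w) (se_str_map z) a) -rmorphM.
apply: le_trans (sup_norm_ge w1 h1 a (_ : nz (w * z))) _; first exact: mulf_neq0.
rewrite nabsM -/p1 [leLHS](_ : _ = nabs z * p1 a * nabs w) //; ring.
Qed.
Let p1_gt0 b : nzE b -> 0 < p1 b.
Proof.
move=> b0; rewrite lt_def p1_ge0 andbT; apply: contra_neq (b0 : b != 0) => pb.
by apply: se_rowmax_eq0; rewrite -pb.
Qed.

Definition se_norm := sup_norm nzE (fun b a => b * a) p1 p1.
Let T2B b (x y : E) : b * (x - y) = b * x - b * y := mulrBr b x y.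
Let h2 b a : nzE b -> p1 (b * a) <= M0 * p1 a * p1 b.
Proof. by move=> _; rewrite -mulrA [p1 a * _]mulrC; apply: p1M. Qed.
Let up2 : ultra se_norm := sup_norm_ultra nzE1 T2B p1_gt0 up1 h2.
Let p2_ge0 a : 0 <= se_norm a := ultra_ge0 up2 a.
Let p2E b a : p1 (b * a) <= se_norm a * p1 b.
Proof.
have [->|b0] := eqVneq b 0; last exact: (sup_norm_ge p1_gt0 h2).
by rewrite mul0r (ultra0 up1) mulr_ge0.
Qed.

Lemma se_norm_le : exists2 D, 0 <= D & forall a, se_norm a <= D * rowmax (@bnorm R k B) a.
Proof.
exists (M0 * (M0 * C)) => [|a].
  by apply: mulr_ge0; [exact: M00|apply: mulr_ge0; [exact: M00|exact: C0]].
apply: le_trans (sup_norm_le_self nzE1 p1_gt0 h2 a) _.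
by rewrite -[leRHS]mulrA; apply: ler_wpM2l; [exact: M00|exact: p10].
Qed.

Lemma se_norm_ge : exists2 D, 0 <= D & forall a, rowmax (@bnorm R k B) a <= D * se_norm a.
Proof.
exists (p1 1) => // a; have := p2E 1 a; rewrite mul1r mulrC; exact: le_trans.
Qed.

Let se_norm_eq0 a : se_norm a = 0 <-> a = 0.
Proof.
split=> [h|->]; last exact: (ultra0 up2).
have [D D0 hD] := se_norm_ge; apply: se_rowmax_eq0.
by apply: le_trans (hD a) _; rewrite h mulr0.
Qed.

Let se_normM a b : se_norm (a * b) <= se_norm a * se_norm b.
Proof.
apply: (sup_norm_le nzE1 p1_gt0) => c c0; rewrite [X in p1 X](mulrA c a b).
apply: le_trans (p2E _ _) _; rewrite [leRHS](_ : _ = se_norm b * (se_norm a * p1 c)); last by ring.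
by apply: ler_wpM2l; [exact: p2_ge0|exact: p2E].
Qed.

Let se_norm1 : se_norm 1 <= 1.
Proof. by apply: (sup_norm_le nzE1 p1_gt0) => c c0; rewrite mulr1 mul1r. Qed.

Let se_normZ_le z a : se_norm (se_str_map z * a) <= nabs z * se_norm a.
Proof.
apply: (sup_norm_le nzE1 p1_gt0) => c c0; rewrite [X in p1 X](mulrCA c (se_str_map z) a).
by apply: le_trans (p1Z _ _) _; rewrite -mulrA ler_wpM2l ?nabs_ge0.
Qed.

Let se_normZ z a : se_norm (se_str_map z * a) = nabs z * se_norm a.
Proof.
have [->|z0] := eqVneq z 0; first by rewrite rmorph0 mul0r nabs0 mul0r (ultra0 up2).
apply/eqP; rewrite eq_le se_normZ_le /=.
have := se_normZ_le z^-1 (se_str_map z * a).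
by rewrite mulrA -rmorphM mulVf // rmorph1 mul1r nabsV mulrC ler_pdivlMr ?nabs_gt0 // mulrC.
Qed.

Let se_norm_complete : norm_complete se_norm.
Proof.
move=> s hs; have [D D0 hD] := se_norm_ge; have [D' D'0 hD'] := se_norm_le.
have D1 : 0 < D + 1 by rewrite ltr_wpDl.
have D'1 : 0 < D' + 1 by rewrite ltr_wpDl.
have [l hl] : {l : 'I_d -> B & forall i eps, 0 < eps -> exists N, forall n, (N <= n)%N ->
    bnorm ((s n : 'rV_d) 0 i - l i) < eps}.
  apply: (@choice _ _ (fun i l => forall eps, 0 < eps -> exists N, forall n, (N <= n)%N ->
    bnorm ((s n : 'rV_d) 0 i - l) < eps)) => i; apply: bnorm_complete => eps eps0.
  have [N hN] := hs _ (divr_gt0 eps0 D1); exists N => m n Nm Nn.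
  have -> : (s m : 'rV_d) 0 i - (s n : 'rV_d) 0 i = (s m - s n : 'rV_d) 0 i by rewrite !mxE.
  apply: le_lt_trans (rowmax_ge _ _ i) _; apply: le_lt_trans (hD _) _.
  apply: le_lt_trans (_ : (D + 1) * se_norm (s m - s n) < _).
    by rewrite ler_wpM2r // lerDl.
  by rewrite mulrC -ltr_pdivlMr // hN.
exists (\row_i l i) => eps eps0.
have /choice[N hN] i := hl i _ (divr_gt0 eps0 D'1).
exists (\max_i N i) => n hn; apply: le_lt_trans (hD' _) _.
apply: (@le_lt_trans _ _ (D' * (eps / (D' + 1)))).
  rewrite ler_wpM2l //; apply: rowmax_le => [|i]; first by rewrite divr_ge0 // ltW.
  rewrite !mxE; apply/ltW/hN; apply: leq_trans hn; exact: leq_bigmax.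
by rewrite mulrA ltr_pdivrMr // mulrC ltr_pM2l // ltrDl.
Qed.

Definition se_banalg : banalg K := @BanAlg R K E se_str_map se_norm p2_ge0 se_norm_eq0 se_normM
  se_norm1 se_normZ (fun a b => let: And3 _ _ h := up2 in h a b) se_norm_complete.

End Norm.
End ScalarExtension.

(** * Lifting points along a finite extension *)

Section Lift.
Variables (R : realType) (k K : nafield R) (io : aext k K).
Variables (B : banalg k) (x : B -> R) (xp : is_pt x).
Variables (d : nat) (e : 'I_d -> K) (cK : K -> 'I_d -> k) (C : R).
Hypotheses (hc : coordinates io e cK) (C0 : 0 <= C)
  (hC : forall z i, nabs (cK z i) <= C * nabs z) (B1 : (1 : B) != 0).

Local Notation str := (ba_str B).
Local Notation E := (scalar_ext hc B).
Let EK := se_banalg hc C0 hC B1.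

(** The element [b (x) 1]; its coordinates involve those of [1], which need not be one of the
    [e i]. *)
Definition se_incl (b : B) : E := \row_l (b * str (cK 1 l)).
Local Notation j0 := se_incl.

Let ux : ultra x := pt_ultra xp.

Let j0M a b : j0 (a * b) = j0 a * j0 b.
Proof.
apply/rowP => n; rewrite !mxE.
have -> : cK 1 n = \sum_i \sum_j cK 1 i * cK 1 j * cK (e i * e j) n.
  rewrite -[in LHS](mulr1 1) (coord_mul hc); apply: eq_bigr => i _.
  rewrite (coord_mulr hc) mulr_sumr; apply: eq_bigr => j _.
  by rewrite mulrA.
rewrite rmorph_sum mulr_sumr; apply: eq_bigr => i _.
rewrite rmorph_sum mulr_sumr; apply: eq_bigr => j _.
by rewrite !rmorphM !mxE mulrA [a * b * _]mulrACA.
Qed.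

Let j01 : j0 1 = 1.
Proof. by apply/rowP => n; rewrite !mxE mul1r. Qed.

Lemma se_incl_bhom : @bhom R k K io B EK j0.
Proof.
split=> //.
- by move=> a b; apply/rowP => n; rewrite !mxE mulrDl.
- move=> c; apply/rowP => n; rewrite !mxE -rmorphM; congr (str _).
  by rewrite -(coord_scale hc) mulr1.
- have [D D0 hD] := se_norm_le hc C0 hC B1.
  exists (D * C) => b; apply: le_trans (hD _) _; rewrite -mulrA ler_wpM2l //.
  apply: rowmax_le => [|i]; first by rewrite mulr_ge0 ?bnorm_ge0.
  rewrite mxE; apply: le_trans (bnormM _ _) _; rewrite mulrC ler_wpM2r ?bnorm_ge0 //.
  by apply: le_trans (bnorm_str _ _) _; have := hC 1 i; rewrite nabs1 mulr1.
Qed.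

(** As [1] need not be a basis vector, [rowmax x] restricts to [m] times [x] on the image of [B];
    dividing by [m] gives an extension of [x]. *)
Let m := rowmax (x : B -> R) (1 : E).
Let m_gt0 : 0 < m.
Proof.
rewrite lt_def rowmax_ge0 andbT; apply/eqP => m0.
have : (1 : K) = 0.
  rewrite (hc.1 1) big1 // => i _; rewrite [cK 1 i](_ : _ = 0) ?rmorph0 ?mul0r //.
  apply/nabs_eq0/eqP; rewrite eq_le nabs_ge0 andbT -(pt_str _ xp).
  by have := rowmax_ge hc x (1 : E) i; rewrite mxE -/m m0.
by move/eqP; rewrite oner_eq0.
Qed.

Let rowmax_incl b : rowmax x (j0 b) = x b * m.
Proof.
have [_ xM _ _] := xp; have x0 := ultra_ge0 ux.
apply/eqP; rewrite eq_le; apply/andP; split.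
  apply: rowmax_le => [|i]; first by rewrite mulr_ge0 // ltW.
  rewrite mxE xM ler_wpM2l //.
  by have := rowmax_ge hc x (1 : E) i; rewrite mxE.
have [->|xb] := eqVneq (x b) 0; first by rewrite mul0r rowmax_ge0.
have {}xb : 0 < x b by rewrite lt_def xb x0.
rewrite mulrC -ler_pdivlMr //; apply: rowmax_le => [|i].
  by rewrite divr_ge0 ?rowmax_ge0.
rewrite ler_pdivlMr // mulrC mxE -xM.
by have := rowmax_ge hc x (j0 b) i; rewrite mxE.
Qed.

Lemma se_point : exists y : E -> R, [/\ ultra y, forall a b, y (a * b) = y a * y b,
  forall b, y (j0 b) = x b &
  exists2 D, 0 <= D & forall c, y c <= D * @bnorm R K EK c].
Proof.
have [x1 xM xD xb] := xp; have x0 := ultra_ge0 ux.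
pose q (a : E) := rowmax x a / m.
have xstr c : x (str c) <= nabs c by rewrite pt_str.
have xMle a b : x (a * b) <= x a * x b by rewrite xM.
pose C' := Num.max 1 (se_const e C * m).
have C'0 : 0 <= C' by rewrite le_max ler01.
have aq : adm_seminorm j0 x C' q.
  have [u1 u2 u3] := rowmax_ultra hc ux; split; first split.
  - by rewrite /q u1 mul0r.
  - by move=> a; rewrite /q u2.
  - move=> a b; rewrite /q ler_pdivrMr // -maxr_pMl ?invr_ge0 ?(ltW m_gt0) //.
    by rewrite divfK ?gt_eqF.
  - move=> a b; rewrite /q ler_pdivrMr //.
    apply: le_trans (rowmaxM ux xMle xstr C0 hC a b) _.
    rewrite [leRHS](_ : _ = (C' / m) * (rowmax x a * rowmax x b)); last first.
      by field; rewrite gt_eqF.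
    rewrite ler_wpM2r ?mulr_ge0 ?rowmax_ge0 // ler_pdivlMr // le_max lexx orbT //.
  - by move=> b; rewrite /q rowmax_incl mulfK // gt_eqF.
have C'1 : 1 <= C' by rewrite le_max lexx.
have [y [uy yM yj yq]] := extend_seminorm j01 j0M x1 xM x0 C'1 aq.
exists y; split=> //; have [D D0 hD] := se_norm_ge hc C0 hC B1.
exists (C' / m * D) => [|c]; first by rewrite !mulr_ge0 // invr_ge0 ltW.
apply: le_trans (yq c) _; rewrite /q mulrA [leLHS]mulrAC -[leRHS]mulrA ler_wpM2l //.
  by rewrite divr_ge0 // ltW.
apply: le_trans (hD c); apply: rowmax_le => [|i]; first exact: rowmax_ge0.
by apply: le_trans (pt_le _ xp) _; apply: rowmax_ge.
Qed.
End Lift.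

(** The universal property maps [B'] to the explicit algebra on [K (x)_k B], and the point of [B']
    is the pullback of the seminorm extending [x] there. *)
Lemma spectrum_lift (R : realType) (k K : nafield R) (io : aext k K) (B : banalg k)
    (B' : banalg K) (j : B -> B') n (b : 'I_n -> K) (x : B -> R) :
  kspan io b -> is_bc_alg io j -> is_pt x -> exists y : B' -> R, is_pt y /\ y \o j = x.
Proof.
move=> /finite_coordinates[d [e [cK [C [hc C0 hC]]]]] [jh univ] xp.
have B1 : (1 : B) != 0.
  apply/eqP => h; have [x1 _ _ _] := xp; move: x1; rewrite h (ultra0 (pt_ultra xp)).
  by move/esym/eqP; rewrite oner_eq0.
have [g [[gh gj] _]] := univ _ _ (se_incl_bhom hc C0 hC B1).
have [gD gM g1 gstr [Cg hCg]] := gh.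
have [y [uy yM yj [D D0 hD]]] := se_point xp hc C0 hC B1.
have [jD jM j1 _ _] := jh.
have yjx a : y (g (j a)) = x a by rewrite gj yj.
exists (y \o g); split; last by apply/funext.
have y1 : y (g 1) = 1 by rewrite -j1 yjx; have [] := xp.
have yM' a c : y (g (a * c)) = y (g a) * y (g c) by rewrite gM yM.
split=> //= [a c|a]; first by rewrite gD; have [_ _] := uy; apply.
(* The pullback is bounded only up to a constant; multiplicativity removes the constant. *)
rewrite (ultra_ge0 uy) /=; apply: (@pt_le_of_bounded _ _ _ (y \o g) (D * Cg)) => // [c|c].
  exact: (ultra_ge0 uy).
by apply: le_trans (hD _) _; rewrite -mulrA ler_wpM2l.
Qed.

(** * Finiteness of the boundary *)

Section Boundary.
Variable R : realType.

Section Hom.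
Variables (k K : nafield R) (io : aext k K) (A : banalg k) (B : banalg K) (f : A -> B).
Hypothesis fh : bhom io f.

Lemma bhomX a n : f (a ^+ n) = f a ^+ n.
Proof. by have [_ fM f1 _ _] := fh; elim: n => [|n IH]; rewrite ?f1 // !exprS fM IH. Qed.

Lemma bhom_sum n (F : 'I_n -> A) : f (\sum_i F i) = \sum_i f (F i).
Proof.
have [fD _ _ _ _] := fh; have f0 : f 0 = 0.
  by apply: (@addrI _ (f 0)); rewrite -fD !addr0.
exact: (big_morph f fD f0).
Qed.

Lemma bhom_power_bounded a : power_bounded a -> power_bounded (f a).
Proof.
have [_ _ _ _ [C hC]] := fh; case=> D hD; exists (Num.max C 0 * D) => N.
rewrite -bhomX; apply: le_trans (hC _) _.
apply: (@le_trans _ _ (Num.max C 0 * bnorm (a ^+ N))).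
  by rewrite ler_wpM2r ?bnorm_ge0 // le_max lexx.
by rewrite ler_wpM2l // le_max lexx orbT.
Qed.

Lemma bhom_monic_value a d c :
  f (monic_value (ba_str A) a d c) = monic_value (fun x => ba_str B (io x)) (f a) d c.
Proof.
have [fD fM f1 fstr _] := fh; rewrite /monic_value fD bhomX bhom_sum; congr (_ + _).
by apply: eq_bigr => i _; rewrite fM fstr bhomX.
Qed.
End Hom.

(* By semistability a point reduces to a generic point or to a closed one. *)
Lemma nonvertex_interior (k : nafield R) (B : banalg k) (M : fmodel B) (y : B -> R) :
  semistable M -> is_pt y -> ~ fm_vertex M y ->
  exists i z, fm_lift M i z y /\ is_interior z.
Proof.
move=> [[_ Mring Mcover _] _ Msp] yp nv; have [i [z zl]] := Mcover y yp.
exists i, z; split=> //; have [zp _] := zl; have [n [t [ht Sring]]] := Mring i.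
have pt := model_ring_red_point ht zp; rewrite -[model_ring t]Sring in pt.
case: (Msp i _ pt) => [gen|[[maxP _] _]]; first by exfalso; apply: nv; exists i, z.
apply: (interior_of_residually_algebraic ht zp).
by apply: maximal_residually_algebraic => //; rewrite -[model_ring t]Sring.
Qed.

Lemma boundary_finite (k : nafield R) (B : banalg k) (h : (B -> R) -> R) :
  strictly_affinoid B -> th_harmonic h ->
  exists m (f : 'I_m -> B -> R), forall x, is_boundary x -> exists i, x = f i.
Proof.
move=> [n [t ht]] [_ [K [io [B' [j [M [G [tau [g]]]]]]]]].
move=> [[[m [b sb]] _] bc ss [[_ [_ vG] _ _ _] _] _].
exists (sk_nv G), (fun i => sk_vertex G i \o j) => x [xp nint].
have [y [yp yx]] := spectrum_lift sb bc xp.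
suff : fm_vertex M y by rewrite -vG => -[i _ e]; exists i; rewrite e.
apply: contrapT => nv; apply: nint.
have [i [z [[zp yz] zi]]] := nonvertex_interior ss yp nv.
apply: (interior_of_residually_algebraic ht xp) => l.
have [jh _] := bc; have [[Maff _ _ _] _ _] := ss; have [_ [_ mh _ _]] := Maff i.
have fb : power_bounded (fm_map M i (j (t l))).
  apply: (bhom_power_bounded mh); apply: (bhom_power_bounded jh).
  exact: power_bounded_coord.
have [d [c [c1 hz]]] := interior_residually_algebraic zp sb zi fb.
(* The coefficients come from [k], so both homomorphisms carry the equation along, and its value at
   [z] equals its value at [x] in [B]. *)
exists d, c; split=> //; rewrite -yx yz /= (bhom_monic_value jh).
have e := bhom_monic_value mh (j (t l)) d (fun i => io (c i)).
by rewrite [X in z X]e.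
Qed.
End Boundary.

(** * Limits of nets *)

Section NetLimit.
Variable R : realType.
Local Open Scope ereal_scope.

Lemma th_harmonic_shift (k : nafield R) (B : banalg k) (h : (B -> R) -> R) (eps : R) :
  th_harmonic h -> th_harmonic (fun x => h x + eps)%R.
Proof.
move=> [hcont [K [io [B' [j [M [G [tau [g [h1 h2 h3 h4 [[gc [al [be [ha hb]]]] hg]]]]]]]]]]].
split.
  by move=> x; apply: cvgD; [exact: hcont|exact: cvg_cst].
exists K, io, B', j, M, G, tau, (fun x => g x + eps)%R; split=> //; split; last first.
  by move=> x xp; rewrite hg.
split; first by move=> x; apply: cvgD; [exact: gc|exact: cvg_cst].
exists (fun i => al i + eps)%R, be; split=> // i s si.
by rewrite (ha i s si) addrAC.
Qed.

Lemma directed_finite (J : Type) (le : J -> J -> Prop) m (P : 'I_m -> J -> Prop) :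
  directed le -> (forall i, exists j0, forall j, le j0 j -> P i j) ->
  exists j0, forall j, le j0 j -> forall i, P i j.
Proof.
move=> [[i0] _ letr dir] /choice[f hf].
have [j0 hj0] : exists j0, forall i, i \in enum 'I_m -> le (f i) j0.
  elim: (enum 'I_m) => [|a s [j1 h1]]; first by exists i0.
  have [j0 l1 l2] := dir (f a) j1; exists j0 => i; rewrite inE => /orP[/eqP -> //|/h1 h].
  exact: letr h l2.
by exists j0 => j lj i; apply: hf; apply: letr (hj0 i _) lj; rewrite mem_enum.
Qed.

(** Finiteness of the boundary compensates for the absence of uniformity in pointwise convergence:
    finitely many conditions on the index hold simultaneously from some index on. *)
Lemma net_thuillier (k : nafield R) (Y : anspace k) (J : Type) (le : J -> J -> Prop)
    (vJ : J -> Y -> \bar R) (v : Y -> \bar R) :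
  directed le -> connected [set: Y] -> net_cvg_pointwise le vJ v -> usc v ->
  (forall j, thuillier_subharmonic (vJ j) \/ forall y, vJ j y = -oo) ->
  thuillier_subharmonic v \/ forall y, v y = -oo.
Proof.
move=> dir conn cvg uv hJ; have [hv|nv] := pselect (forall y, v y = -oo); first by right.
left; have [z0 vz0] : exists z, v z <> -oo.
  by apply: contrapT => h; apply: nv => y; apply: contrapT => vy; apply: h; exists y.
split=> // [y|U c h ad sa hh hb p Up].
  (* By connectedness the component of any point is the whole space, so one finite value
     suffices. *)
  by exists z0 => //; exists [set: Y].
apply/lee_addgt0Pr => eps eps0; rewrite -EFinD.
have hh' := th_harmonic_shift eps hh.
have [[_ [inj _] im] _] := ad.
have [m [f hf]] := boundary_finite sa hh.
(* A listed [f i] may correspond to no boundary point of [U], and then its condition is vacuous;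
   otherwise it comes from a single point, since evaluation is injective on [U]. *)
have [|j0 hj0] := @directed_finite J le m (fun i j => forall q, U q -> is_boundary (ch_ev c q) ->
    ch_ev c q = f i -> vJ j q <= (h (ch_ev c q) + eps)%:E) dir.
  move=> i; have [[q [Uq bq qf]]|nq] := pselect (exists q,
    [/\ U q, is_boundary (ch_ev c q) & ch_ev c q = f i]); last first.
    have [[j1] _ _ _] := dir; exists j1 => j _ q Uq bq qf; exfalso; apply: nq; exists q.
    by split.
  have lt : v q < (h (ch_ev c q) + eps)%:E.
    by apply: le_lt_trans (hb q Uq bq) _; rewrite lte_fin ltrDl.
  have [|j1 hj1] := cvg q [set w | w < (h (ch_ev c q) + eps)%:E].
    by apply: open_nbhs_nbhs; split=> //; exact: open_ereal_lt_ereal.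
  exists j1 => j /hj1 /= /ltW lej q' Uq' _ q'f.
  by rewrite (inj q' q Uq' Uq) // q'f qf.
(* If the bound failed at [p], it would fail for all late [vJ j] at [p], against the comparison for
   such a [vJ j], which is trivial if it is identically [-oo]. *)
rewrite leNgt; apply/negP => lt.
have [|j1 hj1] := cvg p [set w | (h (ch_ev c p) + eps)%:E < w].
  by apply: open_nbhs_nbhs; split=> //; exact: open_ereal_gt_ereal.
have [_ _ _ dirj] := dir; have [j l0 l1] := dirj j0 j1.
have := hj1 j l1 => /=; rewrite ltNge => /negP; apply.
have [[_ _ sub]|-> //] := hJ j; last exact: leNye.
apply: (sub U c (fun x => h x + eps)%R) => // q Uq bq.
by have [i fi] := hf _ bq; apply: (hj0 j l0 i).
Qed.

Lemma usc_comp (T T' : topologicalType) (u : T' -> \bar R) (f : T -> T') :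
  continuous f -> usc u -> usc (u \o f).
Proof.
move=> cf [u1 u2]; split=> [x|x a /u2[V nV hV]]; first exact: u1.
exists (f @^-1` V); first exact: (cf x V nV).
by move=> y /hV.
Qed.
End NetLimit.

Theorem theorem6p5 (R : realType) (k : nafield R) (X : anspace k)
    (J : Type) (leJ : J -> J -> Prop) (uJ : J -> X -> \bar R) (u : X -> \bar R) :
  directed leJ ->
  (forall j, classically_psh (uJ j)) ->
  net_cvg_pointwise leJ uJ u ->
  usc u ->
  classically_psh u.
Proof.
move=> dir psh cvg uscu; split=> // K io XK pi Y f hbc hY hf.
have [cpi _ _] := hbc; have [_ [_ _ cf _]] := hf.
have uscv : usc (u \o pi \o f) by do 2!apply: usc_comp => //.
split=> // K' io' XK' pi' Y' f' nt hbc' hY' sm conn sa hf'.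
have [cpi' _ _] := hbc'; have [_ [_ _ cf' _]] := hf'.
(* Pointwise convergence survives composition with the fixed chain of maps from [Y'] to [X], so both
   layers of test spaces reduce to one net on [Y']. *)
apply: (net_thuillier (vJ := fun j => uJ j \o pi \o f \o pi' \o f') dir conn).
- by move=> y A; apply: cvg.
- by do 2!apply: usc_comp => //.
- by move=> j; have [_ h] := (psh j).2 K io XK pi Y f hbc hY hf; exact: (h K' io' XK' pi' Y' f').
Qed.
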